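(* The family $\{\psi^k_{\alpha,\beta}\}_{(k,\alpha,\beta)\in\mathscr I}$ is an unconditional basis of $H^1_{\rm at}(\mathcal X)$. More precisely, for every $f\in H^1_{\rm at}(\mathcal X)$, $$f=\sum_{(k,\alpha,\beta)\in\mathscr I}\langle f,\psi^k_{\alpha,\beta}\rangle\psi^k_{\alpha,\beta}\quad\text{in }H^1_{\rm at}(\mathcal X),$$ this series converges unconditionally in $H^1_{\rm at}(\mathcal X)$, and the coefficients in any such expansion $f=\sum_{\mathscr I}\lambda^k_{\alpha,\beta}\psi^k_{\alpha,\beta}$ are unique, namely $\lambda^k_{\alpha,\beta}=\langle f,\psi^k_{\alpha,\beta}\rangle$.
   Context: Setting. $(\mathcal X,d,\mu)$ is a metric measure space of homogeneous type: $d$ is a metric, $\mu$ is a nonnegative Borel measure, finite and positive on balls $B(x,r):=\{y:d(x,y)<r\}$, with $\mu(B(x,2r))\le C_{(\mathcal X)}\mu(B(x,r))$ for all $x,r$. Assume $\operatorname{diam}\mathcal X=\infty$ and $\mu(\{x\})=0$ for all $x$. $V(x,r):=\mu(B(x,r))$. Dyadic structure. Fix $\delta\in(0,1/1000]$. For each $k\in\mathbb Z$, $\{x^k_\alpha\}_{\alpha\in\mathscr A_k}$ are reference dyadic points: $\{x^0_\alpha\}$ is a maximal $1$-separated set; for $k\ge1$, $\{x^k_\alpha\}\supset\{x^{k-1}_\alpha\}$ is maximal $\delta^k$-separated in $\mathcal X$ and $\{x^{-k}_\alpha\}\subset\{x^{-(k-1)}_\alpha\}$ is maximal $\delta^{-k}$-separated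 in $\{x^{-(k-1)}_\alpha\}$; $\mathscr A_k\subset\mathscr A_{k+1}$ and $x^{k+1}_\alpha=x^k_\alpha$ for $\alpha\in\mathscr A_k$. $\{Q^k_\alpha\}$ is the associated Hytönen–Kairema dyadic cube system (each generation partitions $\mathcal X$; nested or disjoint across generations; $B(x^k_\alpha,\delta^k/3)\subset Q^k_\alpha\subset B(x^k_\alpha,4\delta^k)$). $L(k,\alpha):=\{\beta\in\mathscr A_{k+1}:Q^{k+1}_\beta\subset Q^k_\alpha\}$, $\tilde{\mathscr A}:=\{(k,\alpha):\#L(k,\alpha)>1\}$, $\tilde L(k,\alpha):=L(k,\alpha)\setminus\{\alpha\}$, $\mathscr I:=\{(k,\alpha,\beta):(k,\alpha)\in\tilde{\mathscr A},\beta\in\tilde L(k,\alpha)\}$, $y^k_\beta:=x^{k+1}_\beta$. Wavelets. $\{\psi^k_{\alpha,\beta}\}_{(k,\alpha,\beta)\in\mathscr I}$ is the Auscher–Hytönen orthonormal basis of regular real-valued wavelets of $L^2(\mathcal X)$: with $\mathscr G_k:=\mathscr A_{k+1}\setminus\mathscr A_k$, splines $s^k_\alpha$ ($\chi_{B(x^k_\alpha,\delta^k/8)}\le s^k_\alpha\le\chi_{B(x^k_\alpha,8\delta^k)}$, $s^k_\alpha(x^k_\beta)=\delta_{\alpha\beta}$, $\sum_\alpha s^k_\alpha=1$, $\eta$-Hölder at scale $\delta^k$) and $\tilde M$ the matrix on $\ell^2(\mathscr G_k)$ with entries $(s^{k+1}_\gamma,s^{k+1}_{\gamma'})_{L^2}/\sqrt{V(y^k_\gamma,\delta^k)V(y^k_{\gamma'},\delta^k)}$,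 $\psi^k_{\alpha,\beta}:=\sum_{\gamma\in\mathscr G_k}\tilde M^{-1/2}(\beta,\gamma)s^{k+1}_\gamma/\sqrt{V(x^{k+1}_\gamma,\delta^{k+1})}$. For constants $\eta\in(0,1]$, $\nu,C>0$: $|\psi^k_{\alpha,\beta}(x)|\le CV(y^k_\beta,\delta^k)^{-1/2}e^{-\nu\delta^{-k}d(y^k_\beta,x)}$; $|\psi^k_{\alpha,\beta}(x)-\psi^k_{\alpha,\beta}(y)|\le CV(y^k_\beta,\delta^k)^{-1/2}(d(x,y)/\delta^k)^\eta e^{-\nu\delta^{-k}d(y^k_\beta,x)}$ if $d(x,y)\le\delta^k$; $\int\psi^k_{\alpha,\beta}d\mu=0$. Moreover (Auscher–Hytönen) for any finite $\mathscr I_N\subset\mathscr I$ and any signs $\epsilon\in\{-1,1\}^{\mathscr I}$, the kernel $\sum_{\mathscr I_N}\epsilon^k_{\alpha,\beta}\psi^k_{\alpha,\beta}(x)\psi^k_{\alpha,\beta}(y)$ is a Calderón–Zygmund kernel with constants independent of $N$ and $\epsilon$. Hardy space. For $q\in(1,\infty]$, a $(1,q)$-atom is a function $a$ supported in a ball $B$ with $\|a\|_{L^q}\le\mu(B)^{1/q-1}$ and $\int a\,d\mu=0$. $H^1_{\rm at}(\mathcal X)$ is the space of $f\in L^1(\mathcal X)$ of the form $f=\sum_j\lambda_ja_j$ in $L^1$ with atoms $a_j$ and $\sum|\lambda_j|<\infty$, normed by $\inf\sum_j|\lambda_j|$; it is independent of $q$, a Banach space, and the predual of $\mathrm{BMO}(\mathcal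 X)$. Since $\psi^k_{\alpha,\beta}\in L^\infty\subset\mathrm{BMO}$, $\langle f,\psi^k_{\alpha,\beta}\rangle:=\int_{\mathcal X}f\psi^k_{\alpha,\beta}\,d\mu$. An unconditional basis of a Banach space $\mathcal B$ is a countable family $\{x_n\}_{n\in A}$ such that every $x\in\mathcal B$ has a unique expansion $x=\sum_n\lambda_nx_n$ converging unconditionally (i.e., convergent under every enumeration of $A$). *)

(* Defs.v *)
From HB Require Import structures.
From mathcomp Require Import all_boot all_order all_algebra.
From mathcomp Require Import all_classical all_reals all_analysis.
Set Implicit Arguments. Unset Strict Implicit. Unset Printing Implicit Defensive.
Import Order.TTheory GRing.Theory Num.Theory.
Import numFieldNormedType.Exports.
Local Open Scope classical_set_scope.
Local Open Scope ring_scope.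

Section Defs.
Context {R : realType} {dsp : measure_display} {T : measurableType dsp}.
Variables (d : T -> T -> R) (mu : {measure set T -> \bar R}).

Definition dball (x : T) (r : R) : set T := [set y | d x y < r].

Definition Vol (x : T) (r : R) : R := fine (mu (dball x r)).

Record homogeneous_type : Prop := {
  ht_nonneg : forall x y, 0 <= d x y;
  ht_sep : forall x y, d x y = 0 <-> x = y;
  ht_sym : forall x y, d x y = d y x;
  ht_tri : forall x y z, d x z <= d x y + d y z;
  ht_ball_meas : forall x r, measurable (dball x r);
  ht_ball_pos : forall x r, 0 < r -> (0 < mu (dball x r))%E;
  ht_ball_fin : forall x r, (mu (dball x r) < +oo)%E;
  ht_doubling : exists C : R, forall x r, 0 < r ->
      (mu (dball x (2 * r)) <= C%:E * mu (dball x r))%E }.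

(** Reference dyadic points x^k_alpha = pt alpha (alpha in A k; labels are
    natural numbers, and x^{k+1}_alpha = x^k_alpha for alpha in A k is built
    in), and the associated dyadic cubes Q^k_alpha = Q k alpha. *)
Record dyadic_system (delta : R) (A : int -> set nat) (pt : nat -> T)
    (Q : int -> nat -> set T) : Prop := {
  dy_nest : forall k : int, A k `<=` A (k + 1);
  dy_sep : forall (k : int) a b, A k a -> A k b -> a <> b ->
      delta ^ k <= d (pt a) (pt b);
  dy_max_nonneg : forall k : int, (0 <= k) ->
      forall x, exists2 a, A k a & d x (pt a) < delta ^ k;
  dy_max_neg : forall k : int, (k < 0) ->
      forall b, A (k + 1) b -> exists2 a, A k a & d (pt b) (pt a) < delta ^ k;
  dy_Q_meas : forall k a, measurable (Q k a);
  dy_cover : forall (k : int) x, exists2 a, A k a & Q k a x;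
  dy_disj : forall (k : int) a b, A k a -> A k b -> a <> b -> Q k a `&` Q k b = set0;
  dy_nested : forall (k l : int) a b, (k <= l) -> A k a -> A l b ->
      Q l b `<=` Q k a \/ Q l b `&` Q k a = set0;
  dy_balls : forall (k : int) a, A k a ->
      dball (pt a) (delta ^ k / 3) `<=` Q k a /\ Q k a `<=` dball (pt a) (4 * delta ^ k) }.

Definition Lset (A : int -> set nat) (Q : int -> nat -> set T) (k : int) (a : nat)
  : set nat := [set b | A (k + 1) b /\ Q (k + 1) b `<=` Q k a].

Definition Iset (A : int -> set nat) (Q : int -> nat -> set T) : set (int * nat * nat) :=
  [set t | A t.1.1 t.1.2
           /\ (exists b1 b2, Lset A Q t.1.1 t.1.2 b1 /\ Lset A Q t.1.1 t.1.2 b2 /\ b1 <> b2)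
           /\ Lset A Q t.1.1 t.1.2 t.2 /\ t.2 <> t.1.2].

Definition CZ_kernel (eps C : R) (K : T -> T -> R) : Prop :=
  (forall x y, x <> y -> `|K x y| <= C / Vol x (d x y)) /\
  (forall x x' y, x <> y -> d x x' <= d x y / 2 ->
     `|K x y - K x' y| + `|K y x - K y x'| <= C * (d x x' / d x y) `^ eps / Vol x (d x y)).

(** Properties of the Auscher--Hytonen wavelets psi^k_{alpha,beta} = psi (k,alpha,beta),
    with y^k_beta = x^{k+1}_beta = pt beta. *)
Record AH_wavelets (delta : R) (A : int -> set nat) (pt : nat -> T)
    (Q : int -> nat -> set T) (psi : int * nat * nat -> T -> R) : Prop := {
  wv_meas : forall i, measurable_fun setT (psi i);
  wv_L2 : forall i, Iset A Q i -> mu.-integrable setT (fun x => ((psi i x) ^+ 2)%:E);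
  wv_orthonormal : forall i j, Iset A Q i -> Iset A Q j ->
      (\int[mu]_x (psi i x * psi j x)%:E = (if i == j then 1 else 0)%:E)%E;
  wv_complete : forall f : T -> R, measurable_fun setT f ->
      mu.-integrable setT (fun x => ((f x) ^+ 2)%:E) ->
      (forall i, Iset A Q i -> (\int[mu]_x (f x * psi i x)%:E = 0)%E) ->
      {ae mu, forall x, f x = 0};
  wv_size_reg : exists (eta nu C : R), [/\ 0 < eta <= 1, 0 < nu, 0 < C,
      (forall i x, Iset A Q i ->
         `|psi i x| <= C / Num.sqrt (Vol (pt i.2) (delta ^ i.1.1))
                       * expR (- nu * delta ^ (- i.1.1) * d (pt i.2) x)) &
      (forall i x y, Iset A Q i -> d x y <= delta ^ i.1.1 ->
         `|psi i x - psi i y| <= C / Num.sqrt (Vol (pt i.2) (delta ^ i.1.1))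
                       * (d x y / delta ^ i.1.1) `^ eta
                       * expR (- nu * delta ^ (- i.1.1) * d (pt i.2) x))];
  wv_cancel : forall i, Iset A Q i -> (\int[mu]_x (psi i x)%:E = 0)%E;
  wv_CZ : exists eps C : R, 0 < eps /\ 0 < C /\
      forall (s : seq (int * nat * nat)) (sgn : int * nat * nat -> R),
        uniq s -> (forall i, i \in s -> Iset A Q i) ->
        (forall i, sgn i = 1 \/ sgn i = -1) ->
        CZ_kernel eps C (fun x y => \sum_(i <- s) sgn i * psi i x * psi i y) }.

Definition atom (a : T -> R) : Prop :=
  exists x r, [/\ 0 < r, measurable_fun setT a,
    (forall y, ~ dball x r y -> a y = 0),
    {ae mu, forall y, `|a y| <= (Vol x r)^-1} &
    mu.-integrable setT (fun y => (a y)%:E) /\ (\int[mu]_y (a y)%:E = 0)%E].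

Definition H1_decomp (g : T -> R) (lam : nat -> R) (a : nat -> T -> R) : Prop :=
  [/\ forall j, atom (a j),
      (\sum_(j <oo) (`|lam j|)%:E < +oo)%E &
      (\int[mu]_x (`|g x - \sum_(j < n) lam j * a j x|)%:E)%E @[n --> \oo] --> 0%E].

Definition inH1 (g : T -> R) : Prop :=
  measurable_fun setT g /\ mu.-integrable setT (fun x => (g x)%:E) /\
  exists lam a, H1_decomp g lam a.

(** the H^1_at norm: inf sum |lam_j| over atomic decompositions (+oo if none) *)
Definition H1norm (g : T -> R) : \bar R :=
  ereal_inf [set s | exists lam a, H1_decomp g lam a /\ s = (\sum_(j <oo) (`|lam j|)%:E)%E].

Definition pairing (f g : T -> R) : R := fine (\int[mu]_x (f x * g x)%:E)%E.

Definition H1_series_cvg (f : T -> R) (c : int * nat * nat -> R)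
    (psi : int * nat * nat -> T -> R) (sigma : nat -> int * nat * nat) : Prop :=
  H1norm (fun x => f x - \sum_(n < N) c (sigma n) * psi (sigma n) x) @[N --> \oo] --> 0%E.

Definition H1_uncond_cvg (I : set (int * nat * nat)) (f : T -> R)
    (c : int * nat * nat -> R) (psi : int * nat * nat -> T -> R) : Prop :=
  forall sigma : nat -> int * nat * nat, set_bij setT I sigma ->
    H1_series_cvg f c psi sigma.

End Defs.

(* Main.v *)
Require Import Defs.
From HB Require Import structures.
From mathcomp Require Import all_boot all_order all_algebra.
From mathcomp Require Import all_classical all_reals all_analysis.
From mathcomp Require Import measurable_realfun ring lra zify.
(** Each partial sum of the expansion is an orthogonal projection [S_N] of L2
whose kernel is Calderon-Zygmund with constants independent of [N].  For an atom
[a] supported in a ball [B], the function [a - S_N a] has integral zero, decays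
like [2 ^ (- l * eps)] on the annulus [2 ^ l B], uniformly in [N], and tends to
zero in L2.  Cutting it at radius [2 ^ m r] leaves a tail of H1 norm
[O(2 ^ (- m * eps))] and a mean-zero function on [2 ^ m B] with small L2 norm.
The latter has small H1 norm because an L2 atom is a combination of bounded
atoms: a Calderon-Zygmund decomposition along the dyadic cubes is iterated until
its height exceeds the sup norm.  The dyadic Lebesgue differentiation this needs
follows from completeness of the wavelets, since their span consists of uniformly
continuous functions and is dense in L2.  Thus [a - S_N a] is bounded in H1
uniformly over all atoms and tends to zero for each of them, and summing over an
atomic decomposition gives the expansion of any [f].  Uniqueness holds because
the H1 norm dominates the L1 norm and the wavelets are bounded and orthonormal. *)

Set Implicit Arguments. Unset Strict Implicit. Unset Printing Implicit Defensive.
Import Order.TTheory GRing.Theory Num.Theory.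
Import numFieldNormedType.Exports.
Local Open Scope classical_set_scope.
Local Open Scope ring_scope.

(** * Integration of real functions *)

(** Atoms are bounded by the inverse volume of their ball, whereas [a - S_N a] tends to zero only in
    L2, so the passage from small L2 norm to small H1 norm on a ball is the core of the argument. It
    is quantitative because the sup norm only decides how many rounds of stopping are run and never
    enters the resulting bound; hence it may blow up with [N]. L2 boundedness costs nothing, as
    [S_N] is an orthogonal projection, and [S_N a] has integral zero since every wavelet has; the
    kernel estimates serve for the decay off the support. Unconditionality needs no separate
    argument: an arbitrary enumeration of the index set is fixed, and the kernel bounds are uniform
    over finite index sets. For uniqueness the index set must be shown infinite: convergence is
    quantified over bijections from [nat], and without any such bijection it would hold vacuously
    for all coefficients. This uses that the space is unbounded. The role of the Cauchy-Schwarz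
    inequality is played by the weighted bound [|uv| <= (t u^2 + t^-1 v^2) / 2], with [t] adapted to
    each use. *)

Section L1_functions.
Context {R : realType} {dsp : measure_display} {T : measurableType dsp}.
Variable mu : {measure set T -> \bar R}.
Implicit Types (f g : T -> R) (A : set T).

Definition isL1 f : Prop := mu.-integrable setT (EFin \o f).
Local Notation Int f := (Rintegral mu setT f).

Lemma isL1_measurable f : isL1 f -> measurable_fun setT f.
Proof. by move=> /measurable_int/measurable_EFinP. Qed.

Lemma isL1_ext f g : f =1 g -> isL1 f -> isL1 g.
Proof. by move=> fg; rewrite (_ : f = g)//; apply/funext. Qed.

Lemma isL1D f g : isL1 f -> isL1 g -> isL1 (fun x => f x + g x).
Proof. exact: integrableD. Qed.

Lemma isL1B f g : isL1 f -> isL1 g -> isL1 (fun x => f x - g x).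
Proof. exact: integrableB. Qed.

Lemma isL1Z c f : isL1 f -> isL1 (fun x => c * f x).
Proof. exact: integrableZl. Qed.

Lemma isL1_abs f : isL1 f -> isL1 (fun x => `|f x|).
Proof. exact: integrable_norm. Qed.

Lemma isL1_0 : isL1 (fun=> 0).
Proof. exact: integrable0. Qed.

Lemma isL1_sum I (s : seq I) (F : I -> T -> R) :
  (forall i, isL1 (F i)) -> isL1 (fun x => \sum_(i <- s) F i x).
Proof.
move=> iF; elim: s => [|i s IH].
  by apply: isL1_ext isL1_0 => x; rewrite big_nil.
by apply: isL1_ext (isL1D (iF i) IH) => x; rewrite big_cons.
Qed.

Lemma isL1_dom_ae f g : measurable_fun setT f -> isL1 g ->
  {ae mu, forall x, `|f x| <= g x} -> isL1 f.
Proof.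
move=> mf /integrableP[mg gi] fg; apply/integrableP; split.
  exact/measurable_EFinP.
apply: le_lt_trans gi; apply: ae_ge0_le_integral => //=.
- by apply/measurable_EFinP; exact: measurableT_comp.
- by apply/measurable_EFinP; apply: measurableT_comp => //; exact/measurable_EFinP.
- by apply: filterS fg => x fgx _; rewrite /= lee_fin (le_trans fgx)// ler_norm.
Qed.

Lemma isL1_dom f g : measurable_fun setT f -> isL1 g ->
  (forall x, `|f x| <= g x) -> isL1 f.
Proof. by move=> mf ig fg; apply: isL1_dom_ae ig _ => //; apply: aeW. Qed.

Lemma isL1_mulb f g M : isL1 f -> measurable_fun setT g ->
  (forall x, `|g x| <= M) -> isL1 (fun x => f x * g x).
Proof.
move=> fi mg gM; apply: (isL1_dom (g := fun x => M * `|f x|)).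
- by apply: measurable_funM => //; exact: isL1_measurable.
- exact/isL1Z/isL1_abs.
- by move=> x; rewrite normrM mulrC ler_wpM2r.
Qed.

Lemma normr_indic_le1 A x : `|\1_A x : R| <= 1.
Proof. by rewrite indicE; case: (_ \in _); rewrite ?normr1 ?normr0. Qed.

Lemma isL1_mul_indic f A : measurable A -> isL1 f ->
  isL1 (fun x => f x * \1_A x).
Proof.
move=> mA fi; apply: (isL1_mulb (M := 1)) => // x; exact: normr_indic_le1.
Qed.

Lemma isL1_indic A : measurable A -> (mu A < +oo)%E -> isL1 (\1_A).
Proof.
move=> mA Afin; apply/integrableP; split; first exact/measurable_EFinP.
rewrite (eq_integral (fun x => (\1_A x)%:E)); last first.
  by move=> x _; rewrite /= ger0_norm.
by rewrite integral_indic// setIT.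
Qed.

Lemma IntE f : isL1 f -> (\int[mu]_x (f x)%:E)%E = (Int f)%:E.
Proof. by move=> fi; rewrite fineK//; exact: integrable_fin_num. Qed.

Lemma eq_Int f g : f =1 g -> Int f = Int g.
Proof. by move=> fg; rewrite (_ : f = g)//; apply/funext. Qed.

Lemma IntD f g : isL1 f -> isL1 g -> Int (fun x => f x + g x) = Int f + Int g.
Proof. exact: RintegralD. Qed.

Lemma IntB f g : isL1 f -> isL1 g -> Int (fun x => f x - g x) = Int f - Int g.
Proof. exact: RintegralB. Qed.

Lemma IntZ c f : isL1 f -> Int (fun x => c * f x) = c * Int f.
Proof. exact: RintegralZl. Qed.

Lemma Int0 : Int (fun=> 0) = 0.
Proof. by rewrite (@Rintegral_cst _ _ _ mu setT)// mul0r. Qed.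

Lemma Int_sum I (s : seq I) (F : I -> T -> R) : (forall i, isL1 (F i)) ->
  Int (fun x => \sum_(i <- s) F i x) = \sum_(i <- s) Int (F i).
Proof.
move=> iF; elim: s => [|i s IH].
  by rewrite big_nil -[RHS]Int0; apply: eq_Int => x; rewrite big_nil.
rewrite big_cons -IH -IntD//; last exact: isL1_sum.
by apply: eq_Int => x; rewrite big_cons.
Qed.

Lemma Int_ge0 f : (forall x, 0 <= f x) -> 0 <= Int f.
Proof. by move=> f0; apply: Rintegral_ge0. Qed.

Lemma Int_le f g : isL1 f -> isL1 g -> (forall x, f x <= g x) -> Int f <= Int g.
Proof. by move=> fi gi fg; apply: le_Rintegral. Qed.

(** The difference [h] agrees almost everywhere with its absolute value, whose integral is
    nonnegative. *)
Lemma Int_le_ae f g : isL1 f -> isL1 g -> {ae mu, forall x, f x <= g x} ->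
  Int f <= Int g.
Proof.
move=> fi gi fg; rewrite -subr_ge0 -IntB//.
have hi := isL1B gi fi; set h := fun x => g x - f x in hi *.
have -> : Int h = Int (fun x => `|h x|).
  rewrite /Rintegral; congr fine; apply: ae_eq_integral => //=.
  - exact: measurable_int hi.
  - exact: measurable_int (isL1_abs hi).
  - by apply: filterS fg => x fgx _; rewrite /= ger0_norm// subr_ge0.
exact: Int_ge0.
Qed.

Lemma le_abs_Int f : isL1 f -> `|Int f| <= Int (fun x => `|f x|).
Proof. exact: le_normr_Rintegral. Qed.

Lemma Int_indic A : measurable A -> (mu A < +oo)%E -> Int (\1_A) = fine (mu A).
Proof. by move=> mA Afin; rewrite /Rintegral integral_indic// setIT. Qed.

Lemma Int_abs_eq0 f : isL1 f -> Int (fun x => `|f x|) = 0 ->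
  {ae mu, forall x, f x = 0}.
Proof.
move=> fi f0; have mf := measurable_int _ fi.
have : ae_eq mu setT (EFin \o f) (cst 0%E).
  apply/ae_eq_integral_abs => //=.
  by rewrite -[LHS]/(\int[mu]_x (`|f x|)%:E)%E (IntE (isL1_abs fi)) f0.
by apply: filterS => x /= /(_ I)[].
Qed.

(** Atomic decompositions are defined with extended real integrals, while the estimates are made
    with real ones; integrability lets one pass between the two. *)
Lemma Int_cvg0 (F : nat -> T -> R) : (forall n, isL1 (F n)) ->
  ((\int[mu]_x (F n x)%:E)%E @[n --> \oo] --> 0%E) <->
  (Int (F n) @[n --> \oo] --> (0 : R)).
Proof.
move=> iF.
under eq_fun do rewrite (IntE (iF _)).
split; last by move=> h; apply/fine_cvgP; split; [exact: nearW|].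
by move=> /fine_cvgP[].
Qed.

Lemma Int_dominated_cvg0 (F : nat -> T -> R) g :
  (forall n, measurable_fun setT (F n)) -> isL1 g ->
  (forall n x, `|F n x| <= g x) -> (forall x, F n x @[n --> \oo] --> 0) ->
  Int (fun x => `|F n x|) @[n --> \oo] --> (0 : R).
Proof.
move=> mF gi Fg F0.
have iF n : isL1 (F n) by apply: isL1_dom gi _.
apply/Int_cvg0; first by move=> n; exact: isL1_abs.
have mE n : measurable_fun setT (EFin \o F n) by exact: measurable_int (iF n).
have cE : {ae mu, forall x, setT x -> (EFin \o F n) x @[n --> \oo] --> cst 0%E x}.
  by apply: aeW => x _ /=; apply: cvg_EFin; [exact: nearW|exact: F0].
have dE : {ae mu, forall x n, setT x -> (`|(EFin \o F n) x| <= (EFin \o g) x)%E}.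
  by apply: aeW => x n _ /=; rewrite lee_fin.
have [_ + _] := dominated_convergence measurableT mE (measurable_cst _) cE gi dE.
suff -> : (fun n => \int[mu]_x (`|F n x|)%:E)%E =
  [sequence (\int[mu]_x `|(EFin \o F n) x - cst 0 x|)%E]_n by [].
by apply/funext => n; apply: eq_integral => x _; rewrite /= subr0.
Qed.

End L1_functions.

(** * The atomic norm *)

Section H1_norm.
Context {R : realType} {dsp : measure_display} {T : measurableType dsp}.
Variables (d : T -> T -> R) (mu : {measure set T -> \bar R}).
Hypothesis ht : homogeneous_type d mu.
Implicit Types (f g h a : T -> R).
Local Notation Int f := (Rintegral mu setT f).
Local Notation L1 := (isL1 mu).
Local Notation ball := (dball d).
Local Notation V := (Vol d mu).
Local Notation H1 := (H1norm d mu).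

Lemma VolE x r : mu (ball x r) = (V x r)%:E.
Proof.
by rewrite fineK// ge0_fin_numE//; exact: (ht_ball_fin ht).
Qed.

Lemma Vol_gt0 x r : 0 < r -> 0 < V x r.
Proof. by move=> r0; rewrite -lte_fin -VolE; exact: (ht_ball_pos ht). Qed.

Lemma Vol_ge0 x r : 0 <= V x r.
Proof. by rewrite fine_ge0. Qed.

Lemma isL1_ball x r : L1 (\1_(ball x r)).
Proof. by apply: isL1_indic; [exact: (ht_ball_meas ht)|exact: (ht_ball_fin ht)]. Qed.

Lemma Int_ball x r : Int (\1_(ball x r)) = V x r.
Proof. by apply: Int_indic; [exact: (ht_ball_meas ht)|exact: (ht_ball_fin ht)]. Qed.

Lemma isL1_bounded_supp f x r M : measurable_fun setT f ->
  (forall y, ~ ball x r y -> f y = 0) -> {ae mu, forall y, `|f y| <= M} -> L1 f.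
Proof.
move=> mf f0 fM; apply: (isL1_dom_ae (g := fun y => M * \1_(ball x r) y)) => //.
  exact/isL1Z/isL1_ball.
apply: filterS fM => y fyM; rewrite indicE.
case: (boolP (y \in _)) => [|/negP yB]; first by rewrite mulr1.
by rewrite f0 ?normr0 ?mulr0// => /mem_set.
Qed.

Lemma Int_abs_bounded_supp f x r M : measurable_fun setT f ->
  (forall y, ~ ball x r y -> f y = 0) -> {ae mu, forall y, `|f y| <= M} ->
  Int (fun y => `|f y|) <= M * V x r.
Proof.
move=> mf f0 fM; have fi := isL1_bounded_supp mf f0 fM.
rewrite -Int_ball -IntZ; last exact: isL1_ball.
apply: Int_le_ae; [exact: isL1_abs|exact/isL1Z/isL1_ball|].
apply: filterS fM => y fyM; rewrite indicE.
case: (boolP (y \in _)) => [|/negP yB]; first by rewrite mulr1.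
by rewrite f0 ?normr0 ?mulr0// => /mem_set.
Qed.

Lemma atom_isL1 a : atom d mu a -> L1 a.
Proof. by move=> [x [r [_ _ _ _ []]]]. Qed.

Lemma atom_Int_abs a : atom d mu a -> Int (fun y => `|a y|) <= 1.
Proof.
move=> [x [r [r0 ma a0 aV _]]].
rewrite (le_trans (Int_abs_bounded_supp ma a0 aV))// mulVf//.
exact/lt0r_neq0/Vol_gt0.
Qed.

(** An atom comes with a ball, hence the point [x0]. The zero atom pads partially indexed families
    into sequences. *)
Lemma atom_0 (x0 : T) : atom d mu (fun=> 0).
Proof.
exists x0, 1; split => //.
- by apply: aeW => y; rewrite normr0 invr_ge0 Vol_ge0.
- by split; [exact: isL1_0|rewrite integral0].
Qed.

Lemma nneseries_le_fin (u : nat -> R) (s : R) : (forall n, 0 <= u n) ->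
  ((\sum_(j <oo) (u j)%:E <= s%:E)%E <-> forall n, \sum_(j < n) u j <= s).
Proof.
move=> u0; split => [us n|us].
  rewrite -lee_fin (le_trans _ us)// -sumEFin.
  rewrite -(big_mkord xpredT (fun i => (u i)%:E)).
  by apply: nneseries_lim_ge => i _ _; rewrite lee_fin.
apply: lime_le; first by apply: is_cvg_nneseries => i _ _; rewrite lee_fin.
by apply: nearW => n; rewrite big_mkord sumEFin lee_fin.
Qed.

Lemma isL1_atom_comb (lam : nat -> R) (a : nat -> T -> R) n :
  (forall j, atom d mu (a j)) -> L1 (fun x => \sum_(j < n) lam j * a j x).
Proof. by move=> aa; apply: isL1_sum => j; apply/isL1Z/atom_isL1. Qed.

Lemma H1norm_le_decomp g (lam : nat -> R) (a : nat -> T -> R) (s : R) : L1 g ->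
  (forall j, atom d mu (a j)) -> (forall n, \sum_(j < n) `|lam j| <= s) ->
  Int (fun x => `|g x - \sum_(j < n) lam j * a j x|) @[n --> \oo] --> (0 : R) ->
  (H1 g <= s%:E)%E.
Proof.
move=> gi aa ls ga.
have ls' : (\sum_(j <oo) (`|lam j|)%:E <= s%:E)%E by apply/nneseries_le_fin.
apply: le_trans ls'; apply: ereal_inf_lbound; exists lam, a; split => //; split => //.
- by apply: (@le_lt_trans _ _ s%:E); [exact/nneseries_le_fin|exact: ltry].
- apply/Int_cvg0 => // n; apply/isL1_abs/isL1B => //; exact: isL1_atom_comb.
Qed.

(** The infimum need not be attained, so the inequality is strict and callers add a small margin to
    the norm bound they have. *)
Lemma H1norm_lt_decomp g (s : R) : L1 g -> (H1 g < s%:E)%E ->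
  exists (lam : nat -> R) (a : nat -> T -> R), [/\ forall j, atom d mu (a j),
    forall n, \sum_(j < n) `|lam j| <= s &
    Int (fun x => `|g x - \sum_(j < n) lam j * a j x|) @[n --> \oo] --> (0 : R)].
Proof.
move=> gi /ereal_inf_lt[_ [lam [a [[aa _ ga] ->]]] ls]; exists lam, a; split => //.
- by apply: (nneseries_le_fin (u := fun j => `|lam j|) s _).1 => //; exact: ltW.
- by apply/Int_cvg0 => // n; apply/isL1_abs/isL1B => //; exact: isL1_atom_comb.
Qed.

Lemma H1norm_ge0 g : (0 <= H1 g)%E.
Proof.
by apply: le_ereal_inf_tmp => _ [lam [a [_ ->]]]; apply: nneseries_ge0 => *; rewrite lee_fin.
Qed.

(** Each atom has L1 norm at most 1, so partial sums are bounded in L1 by their coefficients. The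
    margin [e] pays for the infimum, [e'] for truncating the series. *)
Lemma Int_abs_le_H1norm g (s : R) : L1 g -> (H1 g <= s%:E)%E ->
  Int (fun x => `|g x|) <= s.
Proof.
move=> gi gs; apply/ler_addgt0Pr => e e0.
have [|lam [a [aa ls ga]]] := @H1norm_lt_decomp g (s + e) gi.
  by rewrite (le_lt_trans gs)// lte_fin ltrDl.
apply/ler_addgt0Pr => e' e'0.
move/cvgrPdist_lt : ga => /(_ e' e'0)[n _ /(_ n (leqnn n))].
rewrite sub0r normrN => gn.
have ci := @isL1_atom_comb lam a n aa.
have di := isL1_abs (isL1B gi ci).
apply: (@le_trans _ _ (Int (fun x => `|\sum_(j < n) lam j * a j x| +
    `|g x - \sum_(j < n) lam j * a j x|))).
  apply: Int_le; [exact: isL1_abs|by apply: isL1D => //; exact: isL1_abs|move=> x].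
  by rewrite (le_trans _ (ler_normD _ _))// addrC subrK.
rewrite IntD//; last exact: isL1_abs.
apply: lerD; last by rewrite ltW// (le_lt_trans (ler_norm _)).
apply: le_trans (ls n).
apply: (@le_trans _ _ (Int (fun x => \sum_(j < n) `|lam j| * `|a j x|))).
  apply: Int_le; [exact: isL1_abs| |move=> x].
    by apply: isL1_sum => j; apply/isL1Z/isL1_abs/atom_isL1.
  by apply: (le_trans (ler_norm_sum _ _ _)); apply: ler_sum => j _; rewrite normrM.
rewrite Int_sum; last by move=> j; apply/isL1Z/isL1_abs/atom_isL1.
apply: ler_sum => j _; rewrite IntZ; last exact/isL1_abs/atom_isL1.
by rewrite ler_piMr//; exact: atom_Int_abs.
Qed.

(** [g / (M * V x r)] is a single atom. Apart from the zero function, this is the only place where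
    an atom is constructed. *)
Lemma H1norm_bounded_supp g x r M : 0 < r -> 0 <= M -> measurable_fun setT g ->
  (forall y, ~ ball x r y -> g y = 0) -> {ae mu, forall y, `|g y| <= M} ->
  Int g = 0 -> (H1 g <= (M * V x r)%:E)%E.
Proof.
move=> r0 M0 mg g0 gM ig.
have gi := isL1_bounded_supp mg g0 gM.
have V0 := Vol_gt0 x r0.
(* For [M = 0] the normalisation would divide by zero; [g] then vanishes almost everywhere and zero
   coefficients represent it. *)
have [M0'|M0'] := eqVneq M 0.
  apply: (@H1norm_le_decomp g (fun=> 0) (fun=> fun=> 0)) => //.
  - by move=> _; exact: atom_0.
  - by move=> n; rewrite big1 ?M0' ?mul0r// => j _; rewrite normr0.
  - have -> : (fun n => Int (fun x => `|g x - \sum_(j < n) 0 * 0|)) = cst 0.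
      apply/funext => n; apply/eqP; rewrite eq_le Int_ge0// andbT.
      have := @Int_abs_bounded_supp (fun y => g y - \sum_(j < n) 0 * 0) x r 0.
      rewrite [0 * V x r]mul0r; apply.
      - by apply: measurable_funB.
      - by move=> y yB; rewrite big1 ?mulr0 ?subr0 ?g0// => j _; rewrite mulr0.
      - by move: gM; rewrite M0'; apply: filterS => y; rewrite big1 ?mulr0 ?subr0// => j _; rewrite mulr0.
    exact: cvg_cst.
have MV : M * V x r != 0 by rewrite mulf_neq0// gt_eqF.
(* A decomposition is an infinite sequence: the one atom is repeated, with coefficient zero from the
   second place on. *)
pose lam (j : nat) := if j == 0%N then M * V x r else 0.
apply: (@H1norm_le_decomp g lam (fun=> fun y => (M * V x r)^-1 * g y)) => //.
- move=> _; exists x, r; split => //.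
  + exact: measurable_funM.
  + by move=> y yB; rewrite g0// mulr0.
  + apply: filterS gM => y gyM; rewrite normrM ger0_norm ?invr_ge0 ?mulr_ge0 ?Vol_ge0//.
    by rewrite ler_pdivrMl ?mulfK ?lt0r ?MV ?mulr_ge0 ?gt_eqF ?Vol_ge0.
  + split; first exact: isL1Z gi.
    by rewrite (IntE (isL1Z _ gi)) IntZ// ig mulr0.
- case=> [|n]; first by rewrite big_ord0 mulr_ge0// ltW.
  by rewrite big_ord_recl big1 ?addr0 /lam/= ?ger0_norm// ?mulr_ge0// ?ltW// => j _; rewrite normr0.
- apply: cvg_near_cst; near=> n.
  have n0 : (0 < n)%N by near: n; exact: nbhs_infty_gt.
  rewrite -[RHS](Int0 mu); apply: eq_Int => y.
  rewrite -(prednK n0) big_ord_recl big1 ?addr0 /lam/=; last by move=> j _; rewrite mul0r.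
  by rewrite mulrA mulfV// mul1r subrr normr0.
Unshelve. all: by end_near. Qed.

End H1_norm.

(** * Finite sums *)

Lemma ler_sum_subset (R : realDomainType) (I : eqType) (s t : seq I) (F : I -> R) :
  uniq s -> {subset s <= t} -> (forall i, 0 <= F i) ->
  \sum_(i <- s) F i <= \sum_(i <- t) F i.
Proof.
move=> + + F0; elim: s t => [|i s IH] t /=; first by rewrite big_nil sumr_ge0.
move=> /andP[iNs us] st; rewrite big_cons [leRHS](big_rem i)/=; last by apply: st; rewrite mem_head.
rewrite lerD2l; apply: IH => // j js; apply: rem_mem.
  by apply: contraNneq iNs => <-.
by apply: st; rewrite in_cons js orbT.
Qed.

Lemma sum_split_subset (V : zmodType) (I : eqType) (s t : seq I) (F : I -> V) :
  uniq s -> uniq t -> {subset t <= s} ->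
  \sum_(i <- s) F i = \sum_(i <- t) F i + \sum_(i <- [seq j <- s | j \notin t]) F i.
Proof.
move=> us ut ts; rewrite (bigID (mem t))/= big_filter; congr (_ + _).
rewrite -big_filter; apply: perm_big; apply: uniq_perm => //; first exact: filter_uniq.
by move=> i; rewrite mem_filter; apply: andb_idr => /ts.
Qed.

Lemma cvg_sum0 (R : realType) (I : Type) (s : seq I) (F : I -> nat -> R) :
  (forall i, F i n @[n --> \oo] --> 0) ->
  \sum_(i <- s) F i n @[n --> \oo] --> (0 : R).
Proof.
move=> F0; elim: s => [|i s IH].
  by under eq_fun do rewrite big_nil; exact: cvg_cst.
have -> : (fun n => \sum_(j <- i :: s) F j n) = (fun n => F i n + \sum_(j <- s) F j n).
  by apply/funext => n; rewrite big_cons.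
suff: F i n + \sum_(j <- s) F j n @[n --> \oo] --> (0 + 0 : R) by rewrite addr0.
exact: cvgD.
Qed.

Lemma sum_half_pow_le1 (R : realFieldType) n : \sum_(i < n) (2 ^- i.+1 : R) <= 1.
Proof.
suff -> : \sum_(i < n) (2 ^- i.+1 : R) = 1 - 2 ^- n.
  by rewrite gerBl invr_ge0 exprn_ge0.
elim: n => [|n IH]; first by rewrite big_ord0 expr0 invr1 subrr.
rewrite big_ord_recr/= IH exprS invfM.
by field; rewrite expf_neq0.
Qed.

(** * Countable subadditivity of the atomic norm *)

Section H1_series.
Context {R : realType} {dsp : measure_display} {T : measurableType dsp}.
Variables (d : T -> T -> R) (mu : {measure set T -> \bar R}).
Hypothesis ht : homogeneous_type d mu.
Implicit Types (f g h a : T -> R).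
Local Notation Int f := (Rintegral mu setT f).
Local Notation L1 := (isL1 mu).
Local Notation H1 := (H1norm d mu).

Let box N J : seq (nat * nat) := [seq (n, j) | n <- iota 0 N, j <- iota 0 J].

Let mem_box N J p : (p \in box N J) = (p.1 < N)%N && (p.2 < J)%N.
Proof.
apply/allpairsP/andP => [[[n j] /= [+ + ->/=]]|[pN pJ]].
  by rewrite !mem_iota.
by exists p; rewrite !mem_iota; split => //; case: p {pN pJ}.
Qed.

Let uniq_box N J : uniq (box N J).
Proof. by apply: allpairs_uniq; rewrite ?iota_uniq// => -[? ?] [? ?]. Qed.

Let big_box (V : zmodType) N J (F : nat * nat -> V) :
  \sum_(p <- box N J) F p = \sum_(n < N) \sum_(j < J) F (nat_of_ord n, nat_of_ord j).
Proof.
rewrite big_allpairs.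
have E K : iota 0 K = index_iota 0 K by rewrite /index_iota subn0.
by rewrite !E big_mkord; apply: eq_bigr => n _; rewrite big_mkord.
Qed.

Let box_cover (P : seq (nat * nat)) : exists K, forall N J, (K <= N)%N -> (K <= J)%N ->
  {subset P <= box N J}.
Proof.
exists (\max_(p <- P) maxn p.1 p.2).+1 => N J KN KJ p pP; rewrite mem_box.
have := @leq_bigmax_seq _ P xpredT (fun p => maxn p.1 p.2) p pP isT.
by move: (bigop _ _ _) KN KJ => m; lia.
Qed.

(** [pmap] drops the naturals that encode no pair, so these lists exhaust [nat * nat] in the order
    of the encoding. *)
Let enumP M : seq (nat * nat) := pmap (@pickle_inv _) (iota 0 M).

Let uniq_enumP M : uniq (enumP M).
Proof. by apply: (pmap_uniq (@pickle_invK _)); exact: iota_uniq. Qed.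

Let mem_enumP M p : (pickle p < M)%N -> p \in enumP M.
Proof.
move=> pM; rewrite mem_pmap; apply/mapP; exists (pickle p); last by rewrite pickleK_inv.
by rewrite mem_iota.
Qed.

Let enumP_cover (P : seq (nat * nat)) : exists K, forall M, (K <= M)%N ->
  {subset P <= enumP M}.
Proof.
exists (\max_(p <- P) pickle p).+1 => M KM p pP; apply: mem_enumP.
by apply: leq_trans KM; rewrite ltnS; exact: leq_bigmax_seq.
Qed.

(** A doubly indexed decomposition is flattened along the encoding of pairs. That order is unrelated
    to the rows in which convergence is assumed; absolute summability of the coefficients makes the
    order irrelevant. *)
Lemma H1norm_series_decomp g (G : nat -> T -> R) (s : nat -> R) (S : R)
    (lam : nat * nat -> R) (a : nat * nat -> T -> R) :
  L1 g -> (forall n, L1 (G n)) -> (forall p, atom d mu (a p)) ->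
  (forall n J, \sum_(j < J) `|lam (n, nat_of_ord j)| <= s n) ->
  (forall N, \sum_(n < N) s n <= S) ->
  (forall n, Int (fun x => `|G n x - \sum_(j < J) lam (n, nat_of_ord j) * a (n, nat_of_ord j) x|)
      @[J --> \oo] --> (0 : R)) ->
  Int (fun x => `|g x - \sum_(n < N) G n x|) @[N --> \oo] --> (0 : R) ->
  (H1 g <= S%:E)%E.
Proof.
move=> gi Gi aa ls sS Ga gG.
have [x0 _] := aa (0, 0)%N.
pose c m := oapp lam 0 (pickle_inv m : option (nat * nat)).
pose b m : T -> R := oapp a (fun=> 0) (pickle_inv m : option (nat * nat)).
have sumE (V : zmodType) M (F : nat * nat -> V) :
    \sum_(m < M) oapp F 0 (pickle_inv m) = \sum_(p <- enumP M) F p.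
  by rewrite big_pmap -(big_mkord xpredT (fun m => oapp F 0 (pickle_inv m)))
    /index_iota subn0.
have bndP P : uniq P -> \sum_(p <- P) `|lam p| <= S.
  move=> uP; have [K /(_ K K (leqnn K) (leqnn K)) PK] := box_cover P.
  apply: (le_trans (ler_sum_subset uP PK _)) => //.
  by rewrite big_box; apply: le_trans (sS K); apply: ler_sum => n _; exact: ls.
have Li P : L1 (fun x => \sum_(p <- P) lam p * a p x).
  by apply: isL1_sum => p; exact/isL1Z/(atom_isL1 (aa p)).
have cbE M x : \sum_(m < M) c m * b m x = \sum_(p <- enumP M) lam p * a p x.
  rewrite -sumE; apply: eq_bigr => m _; rewrite /c /b.
  by case: (pickle_inv m) => //=; rewrite mul0r.
apply: (@H1norm_le_decomp _ _ _ d mu g c b) => //.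
- by move=> m; rewrite /b; case: (pickle_inv m) => [p|] /=; [exact: aa|exact: (@atom_0 _ _ _ d mu x0)].
- move=> M; rewrite (eq_bigr (fun m : 'I_M => oapp (fun p => `|lam p|) 0 (pickle_inv m))).
    by rewrite sumE; exact: bndP.
  by move=> m _; rewrite /c; case: (pickle_inv m) => //=; rewrite normr0.
under eq_fun do under eq_Rintegral do rewrite cbE.
(* The total coefficient mass, taken as a supremum over finite lists of pairs so that no order of
   summation is involved. *)
have supE : has_sup [set x | exists P, uniq P /\ x = \sum_(p <- P) `|lam p|].
  split; first by exists 0, [::]; rewrite big_nil.
  by exists S => _ [P [uP ->]]; exact: bndP.
apply/cvgrPdist_le => eta eta0; have e3 : 0 < eta / 3 by rewrite divr_gt0.
have [_ [P0 [uP0 ->]] P0s] := sup_adherent e3 supE.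
have tail P : uniq P -> {in P, forall p, p \notin P0} -> \sum_(p <- P) `|lam p| <= eta / 3.
  move=> uP PP0; rewrite -(lerD2l (\sum_(p <- P0) `|lam p|)) -big_cat/=.
  apply: (@le_trans _ _ (sup [set x | exists P, uniq P /\ x = \sum_(p <- P) `|lam p|])).
    apply: ub_le_sup; first by case: supE.
    exists (P0 ++ P); split => //; rewrite cat_uniq uP0 uP andbT/=.
    by apply/hasPn => p /PP0.
  by rewrite -lerBlDr ltW.
have [K1 K1P] := box_cover P0.
move/cvgrPdist_le : gG => /(_ _ e3)[K2 _ K2P].
pose N := maxn K1 K2.
have /cvgrPdist_le/(_ _ e3)[K3 _ K3P] := @cvg_sum0 R _ (index_enum 'I_N)
  (fun n J => Int (fun x => `|G n x - \sum_(j < J) lam (nat_of_ord n, nat_of_ord j)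
     * a (nat_of_ord n, nat_of_ord j) x|)) (fun n => Ga n).
pose J := maxn K1 K3.
have [K4 K4P] := enumP_cover (box N J).
exists K4 => // M /= K4M; rewrite sub0r normrN ger0_norm; last exact: Int_ge0.
set W := [seq p <- enumP M | p \notin box N J].
(* Three errors, a third of the tolerance each: truncation to [N] rows, truncation of these rows at
   [J], and the enumerated pairs outside the box. The last avoid [P0], since the box contains it, so
   [tail] applies to them. *)
have e1 x : g x - \sum_(p <- enumP M) lam p * a p x =
   (g x - \sum_(n < N) G n x) + (\sum_(n < N) (G n x - \sum_(j < J)
     lam (nat_of_ord n, nat_of_ord j) * a (nat_of_ord n, nat_of_ord j) x))
   - \sum_(p <- W) lam p * a p x.
  rewrite (@sum_split_subset _ _ (enumP M) (box N J))//; last exact: K4P.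
  by rewrite big_box sumrB; ring.
have i1 : L1 (fun x => g x - \sum_(n < N) G n x) by apply/isL1B => //; exact: isL1_sum.
have i2 n : L1 (fun x => G n x - \sum_(j < J) lam (n, nat_of_ord j) * a (n, nat_of_ord j) x).
  by apply/isL1B => //; apply: isL1_sum => j; exact/isL1Z/(atom_isL1 (aa _)).
have i3 : L1 (fun x => \sum_(p <- W) `|lam p| * `|a p x|).
  by apply: isL1_sum => p; exact/isL1Z/isL1_abs/(atom_isL1 (aa _)).
apply: (@le_trans _ _ (Int (fun x => (`|g x - \sum_(n < N) G n x| +
    \sum_(n < N) `|G n x - \sum_(j < J)
     lam (nat_of_ord n, nat_of_ord j) * a (nat_of_ord n, nat_of_ord j) x|)
    + \sum_(p <- W) `|lam p| * `|a p x|))).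
  apply: Int_le.
  - exact/isL1_abs/isL1B.
  - apply: isL1D => //; apply: isL1D; first exact: isL1_abs.
    by apply: isL1_sum => n; exact/isL1_abs.
  - move=> x; rewrite e1 (le_trans (ler_normB _ _))//; apply: lerD.
      by rewrite (le_trans (ler_normD _ _))// lerD2l ler_norm_sum.
    rewrite (le_trans (ler_norm_sum _ _ _))//.
    by apply: ler_sum => p _; rewrite normrM.
have i4 : L1 (fun x => \sum_(n < N) `|G n x - \sum_(j < J)
     lam (nat_of_ord n, nat_of_ord j) * a (nat_of_ord n, nat_of_ord j) x|).
  by apply: isL1_sum => n; exact/isL1_abs.
rewrite IntD//; last by apply: isL1D => //; exact: isL1_abs.
rewrite IntD//; last exact: isL1_abs.
rewrite Int_sum; last by move=> n; exact/isL1_abs.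
rewrite Int_sum; last by move=> p; exact/isL1Z/isL1_abs/(atom_isL1 (aa _)).
have -> : eta = eta / 3 + eta / 3 + eta / 3 by field.
apply: lerD; first apply: lerD.
- have := K2P N; rewrite /= leq_maxr => /(_ isT).
  by rewrite sub0r normrN; exact: le_trans (ler_norm _).
- have := K3P J; rewrite /= leq_maxr => /(_ isT).
  by rewrite sub0r normrN; exact: le_trans (ler_norm _).
- apply: (@le_trans _ _ (\sum_(p <- W) `|lam p|)).
    apply: ler_sum => p _; rewrite IntZ; last exact/isL1_abs/(atom_isL1 (aa _)).
    by rewrite ler_piMr//; exact: atom_Int_abs ht _ (aa p).
  apply: tail; first exact: filter_uniq.
  move=> p; rewrite mem_filter => /andP[+ _]; apply: contra.
  by apply: K1P; rewrite leq_maxl.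
Qed.

(** The decomposition of the [n]-th function is allowed a loss of [e * 2 ^- n.+1]; the losses add up
    to at most [e]. *)
Lemma H1norm_series g (G : nat -> T -> R) (s : nat -> R) (S : R) :
  L1 g -> (forall n, L1 (G n)) -> (forall n, (H1 (G n) <= (s n)%:E)%E) ->
  (forall N, \sum_(n < N) s n <= S) ->
  Int (fun x => `|g x - \sum_(n < N) G n x|) @[N --> \oo] --> (0 : R) ->
  (H1 g <= S%:E)%E.
Proof.
move=> gi Gi Gs sS gG; apply/lee_addgt0Pr => e e0.
have dec n : exists la : (nat -> R) * (nat -> T -> R), [/\ forall j, atom d mu (la.2 j),
    forall J, \sum_(j < J) `|la.1 j| <= s n + e * 2 ^- n.+1 &
    Int (fun x => `|G n x - \sum_(j < J) la.1 j * la.2 j x|) @[J --> \oo] --> (0 : R)].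
  have [|lam [a h]] := @H1norm_lt_decomp _ _ _ d mu (G n) (s n + e * 2 ^- n.+1) (Gi n).
    by rewrite (le_lt_trans (Gs n))// lte_fin ltrDl mulr_gt0// invr_gt0 exprn_gt0.
  by exists (lam, a).
have [la laP] := choice dec.
apply: (@H1norm_series_decomp g G (fun n => s n + e * 2 ^- n.+1) (S + e)
  (fun p => (la p.1).1 p.2) (fun p => (la p.1).2 p.2)) => //.
- by move=> [n j]; case: (laP n).
- by move=> n J; case: (laP n).
- move=> N; rewrite big_split/=; apply: lerD; first exact: sS.
  rewrite -mulr_sumr; apply: ler_piMr; [exact: ltW|exact: sum_half_pow_le1].
- by move=> n; case: (laP n).
Qed.

Lemma H1normD g h (s t : R) : L1 g -> L1 h -> (H1 g <= s%:E)%E -> (H1 h <= t%:E)%E ->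
  (H1 (fun x => g x + h x)%R <= (s + t)%:E)%E.
Proof.
move=> gi hi gs ht'.
pose G n : T -> R := if n is 0 then g else if n is 1 then h else fun=> 0.
pose u n : R := if n is 0 then s else if n is 1 then t else 0.
have s0 : 0 <= s by rewrite -lee_fin (le_trans (H1norm_ge0 _ _ _) gs).
have t0 : 0 <= t by rewrite -lee_fin (le_trans (H1norm_ge0 _ _ _) ht').
(* Bounding the norm of the zero function takes a point to centre a ball at; on an empty space
   [g + h] is the same function as [g]. *)
have [[x0 _]|T0] := pselect (exists x : T, True); last first.
  apply: (le_trans _ (_ : (H1 g <= (s + t)%:E)%E)).
    rewrite (_ : (fun x => _) = g)//.
    by apply/funext => x; exfalso; apply: T0; exists x.
  by rewrite (le_trans gs)// lee_fin lerDl.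
apply: (@H1norm_series _ G u).
- exact: isL1D.
- by case=> [|[|n]] //=; exact: isL1_0.
- case=> [|[|n]] //=.
  have := @H1norm_bounded_supp _ _ _ d mu ht (fun=> 0) x0 1 0.
  rewrite mul0r; apply => //; last exact: Int0.
  by apply: aeW => y; rewrite normr0.
- case=> [|[|n]]; rewrite ?big_ord0 ?big_ord_recl ?big_ord0 /= ?addr0 ?addr_ge0 ?lerDl//.
  by rewrite big1// addr0.
- apply: cvg_near_cst; exists 2%N => // -[|[|n]] //= _.
  rewrite -[RHS](Int0 mu); apply: eq_Int => x.
  by rewrite !big_ord_recl big1//= addr0 subrr normr0.
Qed.

End H1_series.

(** * L2 and orthonormal expansions *)

Section L2_functions.
Context {R : realType} {dsp : measure_display} {T : measurableType dsp}.
Variable mu : {measure set T -> \bar R}.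
Implicit Types (f g u v w : T -> R).
Local Notation Int f := (Rintegral mu setT f).
Local Notation L1 := (isL1 mu).

Definition isL2 f : Prop := measurable_fun setT f /\ L1 (fun x => f x ^+ 2).

Lemma isL2_mul f g : isL2 f -> isL2 g -> L1 (fun x => f x * g x).
Proof.
move=> [mf fi] [mg gi]; apply: (isL1_dom (g := fun x => f x ^+ 2 + g x ^+ 2)).
- exact: measurable_funM.
- exact: isL1D.
- move=> x; have := sqr_ge0 (f x - g x); have := sqr_ge0 (f x + g x).
  by rewrite ler_norml; have := sqr_ge0 (f x); have := sqr_ge0 (g x); nra.
Qed.

Lemma isL2_0 : isL2 (fun=> 0).
Proof. by split=> //; apply: isL1_ext (isL1_0 mu) => x; rewrite expr0n. Qed.

Lemma isL2Z c f : isL2 f -> isL2 (fun x => c * f x).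
Proof.
move=> [mf fi]; split; first exact: measurable_funM.
by apply: isL1_ext (isL1Z (c ^+ 2) fi) => x; rewrite exprMn.
Qed.

Lemma isL2D f g : isL2 f -> isL2 g -> isL2 (fun x => f x + g x).
Proof.
move=> f2 g2; have := isL2_mul f2 g2; move: f2 g2 => [mf fi] [mg gi] fgi.
split; first exact: measurable_funD.
by apply: isL1_ext (isL1D (isL1D fi gi) (isL1Z 2 fgi)) => x; ring.
Qed.

Lemma isL2B f g : isL2 f -> isL2 g -> isL2 (fun x => f x - g x).
Proof.
move=> f2 /(isL2Z (-1)) /(isL2D f2); congr isL2.
by apply/funext => x; rewrite mulN1r.
Qed.

Lemma isL2_sum I (s : seq I) (F : I -> T -> R) :
  (forall i, isL2 (F i)) -> isL2 (fun x => \sum_(i <- s) F i x).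
Proof.
move=> iF; elim: s => [|i s IH].
  by rewrite (_ : (fun x => _) = fun=> 0); [exact: isL2_0|apply/funext => x; rewrite big_nil].
rewrite (_ : (fun x => _) = fun x => F i x + \sum_(j <- s) F j x); first exact: isL2D.
by apply/funext => x; rewrite big_cons.
Qed.

(** Weighted form of Cauchy-Schwarz without square roots; the free weight [t] is chosen by the
    caller to balance the two terms. *)
Lemma abs_Int_mul_le f g t : 0 < t -> isL2 f -> isL2 g ->
  `|Int (fun x => f x * g x)| <= (t * Int (fun x => f x ^+ 2) + t^-1 * Int (fun x => g x ^+ 2)) / 2.
Proof.
move=> t0 f2 g2; have fgi := isL2_mul f2 g2.
move: f2 g2 => [mf fi] [mg gi].
apply: (le_trans (le_abs_Int fgi)).
rewrite -(IntZ t fi) -(IntZ t^-1 gi) -IntD; [|exact: isL1Z|exact: isL1Z].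
rewrite mulrC -IntZ; last by apply: isL1D; exact: isL1Z.
apply: Int_le; [exact: isL1_abs|by apply/isL1Z/isL1D; exact: isL1Z|move=> x].
(* Both signs [s = 1] and [s = -1] are treated at once by completing the square; the second disjunct
   discards all other [s]. *)
have E s : 0 <= 2^-1 * (t * f x ^+ 2 + t^-1 * g x ^+ 2) + s * (f x * g x) \/ s ^+ 2 != 1.
  have [s1|] := eqVneq (s ^+ 2) 1; last by right.
  left; have -> : 2^-1 * (t * f x ^+ 2 + t^-1 * g x ^+ 2) + s * (f x * g x) =
    (2 * t)^-1 * (t * f x + s * g x) ^+ 2.
    rewrite sqrrD [(s * _) ^+ 2]exprMn s1 mul1r; field; exact: lt0r_neq0.
  by rewrite mulr_ge0 ?sqr_ge0// invr_ge0 mulr_ge0// ltW.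
have [E1|/negP[]] := E 1; last by rewrite expr1n.
have [E2|/negP[]] := E (-1); last by rewrite sqrrN expr1n.
by rewrite ler_norml; lra.
Qed.

Lemma fast_cauchy_cvg (u : nat -> R) (s : R) :
  (forall n, `|u n.+1 - u n| <= s / 2 ^+ n) ->
  exists2 l, u n @[n --> \oo] --> l & forall n, `|l - u n| <= 2 * s / 2 ^+ n.
Proof.
move=> us.
have s0 : 0 <= s by have := le_trans (normr_ge0 _) (us 0%N); rewrite expr0 divr1.
(* The subtracted term is the unspent part of the geometric series; with it the induction on [k]
   closes exactly. *)
have bnd n k : `|u (n + k)%N - u n| <= 2 * s / 2 ^+ n - 2 * s / 2 ^+ (n + k).
  elim: k => [|k IH]; first by rewrite addn0 !subrr normr0.
  rewrite addnS; have -> : u (n + k).+1 - u n = (u (n + k).+1 - u (n + k)%N) + (u (n + k)%N - u n) by ring.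
  apply: (le_trans (ler_normD _ _)); apply: (le_trans (lerD (us _) IH)).
  rewrite exprS invfM; set q := (2 ^+ (n + k))^-1; lra.
have bnd' n k : `|u (n + k)%N - u n| <= 2 * s / 2 ^+ n.
  apply: (le_trans (bnd n k)); rewrite gerBl divr_ge0 ?mulr_ge0//.
have geo : (2 * s / 2 ^+ n) @[n --> \oo] --> (0 : R).
  have -> : (fun n => 2 * s / 2 ^+ n) = (fun n => geometric (2 * s) 2^-1 n).
    by apply/funext => n; rewrite /geometric /= exprVn.
  by apply: cvg_geometric; rewrite ger0_norm// invf_lt1// ltr1n.
have : cvg (u n @[n --> \oo]).
  apply/cauchy_cvgP/cauchyP => e e0.
  move/cvgrPdist_lt : geo => /(_ e e0)[N _ NP].
  exists (u N), N => // n /= Nn.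
  rewrite /ball /= distrC -(subnKC Nn); apply: (le_lt_trans (bnd' N (n - N)%N)).
  have := NP N (leqnn N); rewrite /= sub0r normrN; exact: le_lt_trans (ler_norm _).
move=> /cvg_ex[/= l ul]; exists l => // n; apply/ler_addgt0Pr => e e0.
move/cvgrPdist_lt : ul => /(_ e e0)[N _ /(_ (n + N)%N)]; rewrite /= leq_addl => /(_ isT) h.
have -> : l - u n = (l - u (n + N)%N) + (u (n + N)%N - u n) by ring.
by rewrite (le_trans (ler_normD _ _))// addrC lerD// ltW.
Qed.

(* The weighted sum [w] of the squared increments is integrable, hence finite
   almost everywhere, and it dominates [4 ^+ n * (v - u n) ^+ 2] up to a constant. *)
Lemma L2_fast_cauchy (u : nat -> T -> R) : (forall n, measurable_fun setT (u n)) ->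
  (forall n, L1 (fun x => (u n.+1 x - u n x) ^+ 2)) ->
  (forall n, Int (fun x => (u n.+1 x - u n x) ^+ 2) <= 8 ^- n) ->
  exists v (K : R), [/\ measurable_fun setT v,
    forall n, L1 (fun x => (v x - u n x) ^+ 2) &
    forall n, Int (fun x => (v x - u n x) ^+ 2) <= K / 4 ^+ n].
Proof.
move=> mu_ iu u8.
pose t n x := 4 ^+ n * (u n.+1 x - u n x) ^+ 2.
have t0 n x : 0 <= t n x by rewrite /t mulr_ge0 ?sqr_ge0 ?exprn_ge0.
have ti n : L1 (t n) by exact: isL1Z.
have mt n : measurable_fun setT (EFin \o t n) by exact: measurable_int (ti n).
pose w x := (\sum_(n <oo) (t n x)%:E)%E.
have w0 x : (0 <= w x)%E by apply: nneseries_ge0 => n _ _; rewrite lee_fin.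
have mw : measurable_fun setT w.
  apply: (@ge0_emeasurable_sum _ T R setT (fun n => EFin \o t n) xpredT) => //.
  by move=> n x _ _; rewrite /= lee_fin.
(* [4 ^+ n * 8 ^- n = 2 ^- n], and these sum to at most 2: the rate [8 ^- n] is chosen to leave a
   summable series after weighting. *)
have wint : (\int[mu]_x w x <= 2%:E)%E.
  rewrite integral_nneseries//; last by move=> n x _; rewrite /= lee_fin.
  under eq_eseriesr => n _ do rewrite (IntE (ti n)).
  apply: lime_le; first by apply: is_cvg_nneseries => n _ _; rewrite lee_fin; exact: Int_ge0.
  apply: nearW => N; rewrite big_mkord sumEFin lee_fin.
  apply: (@le_trans _ _ (\sum_(i < N) 2 * 2 ^- i.+1)).
    apply: ler_sum => i _; rewrite IntZ//.
    apply: (@le_trans _ _ (4 ^+ i * 8 ^- i)); first by rewrite ler_wpM2l ?exprn_ge0.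
    have -> : 8 = 4 * 2 :> R by rewrite -natrM.
    rewrite exprMn invfM mulrA mulfV ?mul1r ?expf_neq0//.
    by rewrite exprS invfM mulrA mulfV ?mul1r.
  by rewrite -mulr_sumr ler_piMr// sum_half_pow_le1.
have wi : mu.-integrable setT w.
  apply/integrableP; split => //.
  rewrite (eq_integral w); last by move=> x _; rewrite gee0_abs.
  by rewrite (le_lt_trans wint)// ltry.
have Wi : L1 (fine \o w).
  apply: le_integrable wi => //.
    by apply/measurable_EFinP; apply: measurableT_comp.
  move=> x _ /=; case: (w x) (w0 x) => [r|_|] //=; first by rewrite normr0 leey.
have [N [mN N0 wN]] := integrable_ae measurableT wi.
(* Killing the sequence on the null set [N] makes it converge at every point, so that its limit is
   measurable. *)
pose u' n x := u n x * \1_(~` N) x.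
have bndN x : ~ N x -> forall n, `|u n.+1 x - u n x| <= Num.sqrt (fine (w x)) / 2 ^+ n.
  move=> Nx n; have wfin : w x \is a fin_num.
    by apply: contra_notT Nx => h; apply: wN => /= /(_ I); exact/negP.
  have tw : t n x <= fine (w x).
    have := (nneseries_le_fin (u := fun n => t n x) (fine (w x)) (fun n => t0 n x)).1.
    rewrite -/(w x) fineK// => /(_ (lexx _) n.+1); apply: le_trans.
    by rewrite big_ord_recr/= lerDr sumr_ge0.
  rewrite ler_pdivlMr ?exprn_gt0// -[X in _ * X]ger0_norm ?exprn_ge0// -normrM.
  rewrite -sqrtr_sqr ler_wsqrtr//; apply: le_trans tw.
  rewrite exprMn mulrC /t ler_wpM2r ?sqr_ge0//.
  have -> : 4 = 2 ^+ 2 :> R by rewrite -natrX.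
  by rewrite -!exprM mulnC.
have /choice[v vP] : forall x, exists l, u' n x @[n --> \oo] --> l /\
    (~ N x -> forall n, `|l - u n x| <= 2 * Num.sqrt (fine (w x)) / 2 ^+ n).
  move=> x; have [Nx|Nx] := pselect (N x).
    exists 0; split => //; rewrite (_ : (fun n => _) = cst 0); first exact: cvg_cst.
    by apply/funext => n; rewrite /u' indicE memNset ?mulr0// => /(_ Nx).
  have [l ul lb] := fast_cauchy_cvg (bndN x Nx); exists l; split => //.
  rewrite (_ : (fun n => _) = (fun n => u n x))//.
  by apply/funext => n; rewrite /u' indicE mem_set ?mulr1.
have mv : measurable_fun setT v.
  apply: (@measurable_fun_cvg _ _ _ setT u') => [n|x _]; last by case: (vP x).
  by apply: measurable_funM => //; apply: measurable_indic; exact: measurableC.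
have aeb n : {ae mu, forall x, `|(v x - u n x) ^+ 2| <= 4 / 4 ^+ n * fine (w x)}.
  exists N; split => // x; apply: contra_notP => Nx.
  rewrite /= ger0_norm ?sqr_ge0//.
  have W0 : 0 <= fine (w x) by rewrite fine_ge0.
  apply: (@le_trans _ _ ((2 * Num.sqrt (fine (w x)) / 2 ^+ n) ^+ 2)).
    rewrite -(real_normK (num_real (v x - u n x))).
    by rewrite ler_sqr ?nnegrE ?divr_ge0 ?mulr_ge0 ?exprn_ge0 ?sqrtr_ge0//; case: (vP x) => _; apply.
  have -> : 4 = 2 ^+ 2 :> R by rewrite -natrX.
  rewrite !exprMn sqr_sqrtr// exprVn -!exprM [(n * 2)%N]mulnC.
  by rewrite [leRHS]mulrAC mul2n -addnn exprD.
have vi n : L1 (fun x => (v x - u n x) ^+ 2).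
  apply: isL1_dom_ae (aeb n); last exact: isL1Z.
  by apply: measurable_funX; exact: measurable_funB.
exists v, (4 * Int (fine \o w)); split => // n.
rewrite mulrAC -IntZ//; apply: Int_le_ae => //; first exact: isL1Z.
by apply: filterS (aeb n) => x; exact: le_trans (ler_norm _).
Qed.

End L2_functions.

(** * Bessel's identity and L2 convergence of orthonormal expansions *)

Section orthonormal_expansion.
Context {R : realType} {dsp : measure_display} {T : measurableType dsp}.
Variable mu : {measure set T -> \bar R}.
Implicit Types (f g u v w : T -> R).
Local Notation Int f := (Rintegral mu setT f).
Local Notation L1 := (isL1 mu).
Local Notation L2 := (isL2 mu).
Variable phi : nat -> T -> R.
Hypothesis phi2 : forall n, L2 (phi n).
Hypothesis phi_orth : forall n m, Int (fun x => phi n x * phi m x) = (n == m)%:R.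
Hypothesis phi_complete : forall f, L2 f ->
  (forall n, Int (fun x => f x * phi n x) = 0) -> {ae mu, forall x, f x = 0}.

Definition psum u N x := \sum_(n < N) Int (fun x => u x * phi n x) * phi n x.

Lemma psum_L2 u N : L2 (psum u N).
Proof. by apply: isL2_sum => n; exact: isL2Z. Qed.

Lemma psum_coef u N n :
  Int (fun x => psum u N x * phi n x) = if (n < N)%N then Int (fun x => u x * phi n x) else 0.
Proof.
rewrite (@eq_Int _ _ _ mu _ (fun x => \sum_(m < N) Int (fun x => u x * phi m x) * (phi m x * phi n x))).
  rewrite Int_sum; last by move=> m; apply/isL1Z/isL2_mul.
  rewrite (eq_bigr (fun m : 'I_N => if nat_of_ord m == n then Int (fun x => u x * phi n x) else 0)).
    rewrite -(big_mkord xpredT (fun m => if m == n then _ else 0)) -big_mkcond/=.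
    case: ltnP => [nN|Nn].
      by rewrite big_nat1_eq/= nN.
    by rewrite big_nat1_eq/= ltnNge Nn.
  move=> m _; rewrite IntZ; last exact: isL2_mul.
  by rewrite phi_orth; case: eqP => [->|]; rewrite ?mulr1 ?mulr0.
by move=> x; rewrite /psum mulr_suml; apply: eq_bigr => m _; rewrite mulrA.
Qed.

Lemma bessel_identity u N : L2 u ->
  Int (fun x => (u x - psum u N x) ^+ 2) =
  Int (fun x => u x ^+ 2) - \sum_(n < N) Int (fun x => u x * phi n x) ^+ 2.
Proof.
move=> u2; elim: N => [|N IH].
  by rewrite big_ord0 subr0; apply: eq_Int => x; rewrite /psum big_ord0 subr0.
rewrite big_ord_recr/= opprD addrA -IH; set c := Int (fun x => u x * phi N x).
have w2 : L2 (fun x => u x - psum u N x) by apply: isL2B => //; exact: psum_L2.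
have wp : Int (fun x => (u x - psum u N x) * phi N x) = c.
  rewrite (@eq_Int _ _ _ mu _ (fun x => u x * phi N x - psum u N x * phi N x)).
    rewrite IntB; [|exact: isL2_mul|apply: isL2_mul => //; exact: psum_L2].
    by rewrite psum_coef ltnn subr0.
  by move=> x; ring.
rewrite (@eq_Int _ _ _ mu _ (fun x => ((u x - psum u N x) ^+ 2 +
    (- 2 * c) * ((u x - psum u N x) * phi N x)) + c ^+ 2 * (phi N x * phi N x))).
  rewrite IntD; last 2 first.
  - by apply: isL1D; [case: w2|apply/isL1Z/isL2_mul].
  - exact/isL1Z/isL2_mul.
  rewrite IntD; [|by case: w2|by apply/isL1Z/isL2_mul].
  rewrite !IntZ; [|exact: isL2_mul|exact: isL2_mul].
  by rewrite wp phi_orth eqxx (_ : true%:R = 1)//; ring.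
by move=> x; rewrite /psum big_ord_recr/= -/c; ring.
Qed.

(** Bessel's identity for [psum u M], which has the coefficients of [u] below [M] and is its own
    partial sum of order [M]. *)
Lemma psum_sub_sqr u M N : (N <= M)%N ->
  Int (fun x => (psum u M x - psum u N x) ^+ 2) =
  \sum_(n < M) Int (fun x => u x * phi n x) ^+ 2 - \sum_(n < N) Int (fun x => u x * phi n x) ^+ 2.
Proof.
move=> NM; have pp K : (K <= M)%N -> psum (psum u M) K =1 psum u K.
  move=> KM x; apply: eq_bigr => n _; rewrite psum_coef.
  by rewrite (leq_trans (ltn_ord n) KM).
have ss K : (K <= M)%N -> \sum_(n < K) Int (fun x => psum u M x * phi n x) ^+ 2 =
    \sum_(n < K) Int (fun x => u x * phi n x) ^+ 2.
  by move=> KM; apply: eq_bigr => n _; rewrite psum_coef (leq_trans (ltn_ord n) KM).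
have := bessel_identity N (psum_L2 u M); have := bessel_identity M (psum_L2 u M).
rewrite !ss//.
rewrite (@eq_Int _ _ _ mu _ (fun=> 0)); last by move=> x; rewrite pp// subrr expr0n.
rewrite Int0 => /esym/subr0_eq ->.
by move=> <-; apply: eq_Int => x; rewrite pp.
Qed.

Lemma psum_sqr_le u N : L2 u -> Int (fun x => (u x - psum u N x) ^+ 2) <= Int (fun x => u x ^+ 2).
Proof. by move=> u2; rewrite bessel_identity// gerBl sumr_ge0// => n _; exact: sqr_ge0. Qed.

(** Completeness of [phi] only says that a function orthogonal to every [phi n] vanishes. So a limit
    [v] is built along a fast subsequence, its coefficients are identified with those of [u], and
    completeness gives [u = v] almost everywhere. Monotonicity of Bessel's defect extends the
    estimate from the subsequence to all large [N]. *)
Lemma psum_cvg u : L2 u -> forall e, 0 < e -> exists N0, forall N, (N0 <= N)%N ->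
  Int (fun x => (u x - psum u N x) ^+ 2) <= e.
Proof.
move=> u2.
pose S N := \sum_(n < N) Int (fun x => u x * phi n x) ^+ 2.
have Smono : nondecreasing_seq S.
  by apply/nondecreasing_seqP => n; rewrite /S big_ord_recr/= lerDl sqr_ge0.
have Sub N : S N <= Int (fun x => u x ^+ 2).
  have := bessel_identity N u2; rewrite -/(S N) => h.
  by rewrite -subr_ge0 -h; apply: Int_ge0 => x; exact: sqr_ge0.
have Scvg : cvg (S n @[n --> \oo]).
  apply: nondecreasing_is_cvgn => //; exists (Int (fun x => u x ^+ 2)) => _ [n _ <-]; exact: Sub.
have Sl N : S N <= limn S by exact: nondecreasing_cvgn_le.
have /choice[K KP] : forall k : nat, exists K, forall N, (K <= N)%N -> limn S - S N <= 8 ^- k.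
  move=> k; have e0 : 0 < 8 ^- k :> R by rewrite invr_gt0 exprn_gt0.
  move/cvgrPdist_le : Scvg => /(_ _ e0)[K _ KP]; exists K => N /KP.
  exact: le_trans (ler_norm _).
(* Accumulating the thresholds [K] makes them nondecreasing, as [psum_sub_sqr] requires. *)
pose L k := \sum_(i < k.+1) K i.
have KL k : (K k <= L k)%N by rewrite /L big_ord_recr/= leq_addl.
have LS k : (L k <= L k.+1)%N by rewrite {2}/L big_ord_recr/= leq_addr.
have [|||v [C [mv vi vC]]] := @L2_fast_cauchy _ _ _ mu (fun k => psum u (L k)).
- by move=> k; case: (psum_L2 u (L k)).
- by move=> k; case: (isL2B (psum_L2 u (L k.+1)) (psum_L2 u (L k))).
- move=> k; rewrite psum_sub_sqr// -/(S _) -/(S _).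
  by apply: le_trans (KP k (L k) (KL k)); rewrite lerD2r.
have v2 : L2 v.
  have vu : L2 (fun x => v x - psum u (L 0%N) x).
    by split => //; apply: measurable_funB => //; case: (psum_L2 u (L 0%N)).
  have := isL2D vu (psum_L2 u (L 0%N)); congr isL2.
  by apply/funext => x; rewrite subrK.
have C0 : 0 <= C.
  have := le_trans (Int_ge0 mu _) (vC 0%N); rewrite expr0 divr1; apply=> x; exact: sqr_ge0.
have geo : (C / 4 ^+ n) @[n --> \oo] --> (0 : R).
  have -> : (fun n => C / 4 ^+ n) = (fun n => geometric C 4^-1 n).
    by apply/funext => n; rewrite /geometric /= exprVn.
  by apply: cvg_geometric; rewrite ger0_norm// invf_lt1// ltr1n.
have vcoef n : Int (fun x => v x * phi n x) = Int (fun x => u x * phi n x).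
  apply/eqP; rewrite -subr_eq0 -normr_eq0 eq_le normr_ge0 andbT.
  apply/ler_addgt0Pr => e e0; rewrite add0r.
  have e20 : 0 < e ^+ 2 by rewrite exprn_gt0.
  move/cvgrPdist_le : geo => /(_ _ e20)[k1 _ k1P].
  (* [L] is nondecreasing but may stay bounded, in which case it may never pass [n]; hence the
     second alternative. *)
  have [k2 k2P] : exists k2, forall k, (k2 <= k)%N -> (n < L k)%N \/ (forall k, (L k <= n)%N).
    have [h|/existsNP[k0 /negP]] := pselect (forall k, (L k <= n)%N).
      by exists 0%N => k _; right.
    rewrite -ltnNge => nL; exists k0 => k k0k; left.
    by apply: leq_trans nL _; apply: (homo_leq (f := L) leqnn leq_trans LS).
  pose k := maxn k1 k2.
  have vk : Int (fun x => (v x - psum u (L k) x) ^+ 2) <= e ^+ 2.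
    apply: (le_trans (vC k)); have := k1P k; rewrite /= leq_maxl => /(_ isT).
    by rewrite sub0r normrN; exact: le_trans (ler_norm _).
  have pk2 := psum_L2 u (L k).
  have cc : Int (fun x => psum u (L k) x * phi n x) = Int (fun x => u x * phi n x).
    rewrite psum_coef; case: (ltnP n (L k)) => // Lkn.
    have [|nL|hL] := k2P k; first exact: leq_maxr.
      by move: Lkn; rewrite leqNgt nL.
    (* here [S] is eventually constant, so the remaining coefficients vanish *)
    apply/esym/eqP; rewrite -sqrf_eq0 eq_le sqr_ge0 andbT.
    apply/ler_addgt0Pr => e' e'0; rewrite add0r.
    have [m mP] : exists m, 8 ^- m <= e'.
      have geo8 : ((1 : R) / 8 ^+ n) @[n --> \oo] --> (0 : R).
        have -> : (fun n => (1 : R) / 8 ^+ n) = (fun n => geometric 1 8^-1 n).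
          by apply/funext => i; rewrite /geometric /= exprVn.
        by apply: cvg_geometric; rewrite ger0_norm// invf_lt1// ltr1n.
      move/cvgrPdist_le : geo8 => /(_ _ e'0)[m _ /(_ m (leqnn m))].
      rewrite sub0r normrN mul1r => h; exists m; exact: le_trans (ler_norm _) h.
    apply: le_trans mP; apply: le_trans (KP m n _); last exact: leq_trans (KL m) (hL m).
    have := Sl n.+1; rewrite {1}/S big_ord_recr/= -/(S n); lra.
  rewrite -cc -IntB; [|exact: isL2_mul|exact: isL2_mul].
  rewrite (@eq_Int _ _ _ mu _ (fun x => (v x - psum u (L k) x) * phi n x)); last first.
    by move=> x; ring.
  apply: (le_trans (abs_Int_mul_le (t := e^-1) _ _ _)) => //.
  - by rewrite invr_gt0.
  - exact: isL2B.
  rewrite invrK (@eq_Int _ _ _ mu (fun x => phi n x ^+ 2) (fun x => phi n x * phi n x)) ?phi_orth ?eqxx; last first.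
    by move=> x; rewrite expr2.
  have : e^-1 * Int (fun x => (v x - psum u (L k) x) ^+ 2) <= e.
    by rewrite ler_pdivrMl// -expr2.
  rewrite /=; lra.
have uv : {ae mu, forall x, u x - v x = 0}.
  apply: phi_complete => [|n]; first exact: isL2B.
  rewrite (@eq_Int _ _ _ mu _ (fun x => u x * phi n x - v x * phi n x)); last by move=> x; ring.
  by rewrite IntB ?vcoef ?subrr//; exact: isL2_mul.
move=> e e0; move/cvgrPdist_le : geo => /(_ _ e0)[k _ kP].
exists (L k) => N LN.
apply: (@le_trans _ _ (Int (fun x => (u x - psum u (L k) x) ^+ 2))).
  rewrite !bessel_identity// lerD2l lerN2 -/(S _) -/(S _).
  exact: Smono.
apply: (@le_trans _ _ (Int (fun x => (v x - psum u (L k) x) ^+ 2))).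
  apply: Int_le_ae => //; first by case: (isL2B u2 (psum_L2 u (L k))).
  by apply: filterS uv => x /subr0_eq ->.
apply: (le_trans (vC k)); have := kP k (leqnn k).
by rewrite sub0r normrN; exact: le_trans (ler_norm _).
Qed.

End orthonormal_expansion.

(** * Calderon-Zygmund decomposition *)

Section averaging.
Context {R : realType} {dsp : measure_display} {T : measurableType dsp}.
Variables (mu : {measure set T -> \bar R}) (P : nat -> set T).
Implicit Types (f g h : T -> R).
Local Notation Int f := (Rintegral mu setT f).
Local Notation L1 := (isL1 mu).
Hypothesis mP : forall n, measurable (P n).
Hypothesis dP : trivIset setT P.
Hypothesis fP : forall n, (mu (P n) < +oo)%E.

Let P_inj n m x : P n x -> P m x -> n = m.
Proof. by move=> nx mx; apply: (dP I I); exists x. Qed.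

Definition avg h n := Int (fun x => h x * \1_(P n) x) / fine (mu (P n)).

(** The good function of a Calderon-Zygmund decomposition along [P]. Since the sets are disjoint,
    the index chosen by [cid] is the only one. *)
Definition avg_on h x : R :=
  if pselect (exists n, P n x) is left e then avg h (projT1 (cid e)) else h x.

Definition bad_part h n x := (h x - avg h n) * \1_(P n) x.

Lemma avg_on_in h n x : P n x -> avg_on h x = avg h n.
Proof.
move=> Pnx; rewrite /avg_on; case: pselect => [e|[]]; last by exists n.
by case: (cid e) => m Pmx /=; rewrite (P_inj Pmx Pnx).
Qed.

Lemma avg_on_out h x : (forall n, ~ P n x) -> avg_on h x = h x.
Proof. by move=> Px; rewrite /avg_on; case: pselect => [e|//]; exfalso; case: e => n; exact: Px. Qed.

Lemma sum_disjoint_in n x (F : nat -> R) N : P n x ->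
  \sum_(m < N) F m * \1_(P m) x = if (n < N)%N then F n else 0.
Proof.
move=> Pnx; rewrite -(big_mkord xpredT (fun m => F m * \1_(P m) x)).
rewrite (eq_bigr (fun m => if m == n then F n else 0)).
  by rewrite -big_mkcond/= big_nat1_eq.
move=> m _; rewrite indicE; case: eqP => [->|mn]; first by rewrite mem_set// mulr1.
by rewrite memNset ?mulr0// => Pmx; apply: mn; exact: P_inj Pmx Pnx.
Qed.

Lemma sum_disjoint_out x (F : nat -> R) N : (forall n, ~ P n x) ->
  \sum_(m < N) F m * \1_(P m) x = 0.
Proof. by move=> Px; rewrite big1// => m _; rewrite indicE memNset ?mulr0. Qed.

(** At most one bad part is nonzero at a given point, so the sequence is eventually constant.
    Measurability of [avg_on] follows from this rather than from its definition by choice. *)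
Lemma avg_on_cvg h x : h x - \sum_(n < N) bad_part h n x @[N --> \oo] --> avg_on h x.
Proof.
apply: cvg_near_cst; rewrite /bad_part.
have [[n Pnx]|Px] := pselect (exists n, P n x).
  exists n.+1 => // N /= nN; rewrite (@sum_disjoint_in n _ (fun n => h x - avg h n))//.
  by rewrite nN (avg_on_in _ Pnx); ring.
have Px' n : ~ P n x by move=> Pnx; apply: Px; exists n.
exists 0%N => // N _ /=; rewrite (@sum_disjoint_out _ (fun n => h x - avg h n))//.
by rewrite subr0 avg_on_out.
Qed.

Lemma measurable_bad_part h n : measurable_fun setT h -> measurable_fun setT (bad_part h n).
Proof.
move=> mh; apply: measurable_funM; last exact: measurable_indic.
exact: measurable_funB.
Qed.

Lemma measurable_avg_on h : measurable_fun setT h -> measurable_fun setT (avg_on h).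
Proof.
move=> mh; apply: (@measurable_fun_cvg _ _ _ setT
  (fun N x => h x - \sum_(n < N) bad_part h n x)) => [N|x _]; last exact: avg_on_cvg.
by apply: measurable_funB => //; apply: measurable_sum => n; exact: measurable_bad_part.
Qed.

(** This also covers null sets: there the quotient in [avg] is multiplied by zero, and the integral
    vanishes. *)
Lemma avg_mass h n : L1 h ->
  avg h n * fine (mu (P n)) = Int (fun x => h x * \1_(P n) x).
Proof.
move=> hi; rewrite /avg; have [P0|P0] := eqVneq (fine (mu (P n))) 0; last by rewrite divfK.
rewrite P0 mulr0; have mu0 : mu (P n) = 0%E.
  by rewrite -(fineK (_ : mu (P n) \is a fin_num)) ?P0// ge0_fin_numE.
apply/esym/eqP; rewrite -normr_eq0 eq_le normr_ge0 andbT.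
have iP := isL1_mul_indic (mP n) hi.
apply: (le_trans (le_abs_Int iP)); rewrite -(Int0 mu).
apply: Int_le_ae; [exact: isL1_abs|exact: isL1_0|].
exists (P n); split => // x; apply: contra_notP => Px /=.
by rewrite indicE memNset// mulr0 normr0.
Qed.

Lemma avg_abs_le h n : L1 h ->
  `|avg h n| * fine (mu (P n)) <= Int (fun x => `|h x| * \1_(P n) x).
Proof.
move=> hi; have iP := isL1_mul_indic (mP n) hi.
rewrite -[X in _ * X]ger0_norm ?fine_ge0// -normrM avg_mass//.
apply: (le_trans (le_abs_Int iP)); rewrite le_eqVlt; apply/orP; left; apply/eqP.
by apply: eq_Int => x; rewrite normrM [X in _ * X]ger0_norm.
Qed.

Lemma Int_sum_disjoint_le f N : L1 f -> (forall x, 0 <= f x) ->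
  \sum_(n < N) Int (fun x => f x * \1_(P n) x) <= Int f.
Proof.
move=> fi f0; rewrite -Int_sum; last by move=> n; exact: isL1_mul_indic.
apply: Int_le => //; first by apply: isL1_sum => n; exact: isL1_mul_indic.
move=> x; have [[n Pnx]|Px] := pselect (exists n, P n x).
  by rewrite (@sum_disjoint_in n x (fun=> f x))//; case: ifP.
by rewrite (@sum_disjoint_out x (fun=> f x))// => n Pnx; apply: Px; exists n.
Qed.

Lemma isL1_bad_part h n : L1 h -> L1 (bad_part h n).
Proof.
move=> hi; have := isL1B (isL1_mul_indic (mP n) hi) (isL1Z (avg h n) (isL1_indic (mP n) (fP n))).
by apply: isL1_ext => x; rewrite /bad_part; ring.
Qed.

Lemma Int_bad_part h n : L1 h -> Int (bad_part h n) = 0.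
Proof.
move=> hi; rewrite (@eq_Int _ _ _ mu _ (fun x => h x * \1_(P n) x - avg h n * \1_(P n) x)).
  rewrite IntB; [|exact: isL1_mul_indic|exact/isL1Z/isL1_indic].
  by rewrite IntZ ?Int_indic ?avg_mass ?subrr//; exact: isL1_indic.
by move=> x; rewrite /bad_part; ring.
Qed.

Lemma Int_abs_bad_part h n : L1 h ->
  Int (fun x => `|bad_part h n x|) <= 2 * Int (fun x => `|h x| * \1_(P n) x).
Proof.
move=> hi; have iP := isL1_mul_indic (mP n) (isL1_abs hi).
have jP := isL1Z `|avg h n| (isL1_indic (mP n) (fP n)).
apply: (@le_trans _ _ (Int (fun x => `|h x| * \1_(P n) x + `|avg h n| * \1_(P n) x))).
  apply: Int_le; [exact/isL1_abs/isL1_bad_part|exact: isL1D|move=> x].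
  rewrite /bad_part normrM -mulrDl [X in _ * X]ger0_norm//.
  by rewrite ler_wpM2r// ler_normB.
rewrite IntD// IntZ; last exact: isL1_indic.
by rewrite Int_indic//; have := avg_abs_le n hi; lra.
Qed.

(** The variance is the second moment minus [c ^+ 2 * mu (P n)]. *)
Lemma Int_sqr_bad_part h n : isL2 mu h -> L1 h ->
  Int (fun x => bad_part h n x ^+ 2) <= Int (fun x => h x ^+ 2 * \1_(P n) x).
Proof.
move=> [mh h2] hi; set c := avg h n.
have i1 := isL1_mul_indic (mP n) h2; have i2 := isL1_mul_indic (mP n) hi.
have i3 := isL1_indic (mP n) (fP n).
rewrite (@eq_Int _ _ _ mu _ (fun x => (h x ^+ 2 * \1_(P n) x - (2 * c) * (h x * \1_(P n) x))
    + c ^+ 2 * \1_(P n) x)).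
  rewrite IntD; [|by apply: isL1B => //; exact: isL1Z|exact: isL1Z].
  rewrite IntB//; last exact: isL1Z.
  rewrite !IntZ// Int_indic// -(avg_mass n hi) -/c.
  have := sqr_ge0 c; have : 0 <= fine (mu (P n)) by rewrite fine_ge0.
  by move=> m0 c0; have := mulr_ge0 c0 m0; lra.
move=> x; rewrite /bad_part -/c; rewrite indicE; case: (_ \in _) => /=; ring.
Qed.

(** Averaging is an L1 contraction. The comparison is made between extended integrals, split along
    the union of the [P n], because integrability of [avg_on] is itself part of the conclusion. *)
Lemma isL1_avg_on_and_le h : L1 h ->
  L1 (avg_on h) /\ Int (fun x => `|avg_on h x|) <= Int (fun x => `|h x|).
Proof.
move=> hi; have mh := isL1_measurable hi; have mg := measurable_avg_on mh.
have mU : measurable (\bigcup_n P n) by exact: bigcup_measurable.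
have mag D : measurable_fun D (fun x => (`|avg_on h x|)%:E).
  by apply: (@measurable_funS _ _ _ _ setT) => //; apply/measurable_EFinP; exact: measurableT_comp.
have mah D : measurable_fun D (fun x => (`|h x|)%:E).
  by apply: (@measurable_funS _ _ _ _ setT) => //; apply/measurable_EFinP; exact: measurableT_comp.
have le : (\int[mu]_x (`|avg_on h x|)%:E <= \int[mu]_x (`|h x|)%:E)%E.
  rewrite -(setUv (\bigcup_n P n)).
  have dC : [disjoint \bigcup_n P n & ~` \bigcup_n P n] by apply/disj_setPCl.
  rewrite !ge0_integral_setU//; try exact: measurableC.
  apply: leeD; last first.
    rewrite le_eqVlt; apply/orP; left; apply/eqP; apply: eq_integral => x.
    rewrite inE => Px; rewrite avg_on_out// => n Pnx; apply: Px; by exists n.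
  rewrite !ge0_integral_bigcup//.
  apply: lee_nneseries => [n _ _|n _]; first exact: integral_ge0.
  rewrite (eq_integral (fun=> (`|avg h n|)%:E)); last first.
    by move=> x /set_mem Pnx; rewrite (avg_on_in _ Pnx).
  rewrite -[X in (X <= _)%E]/(\int[mu]_(x in P n) cst (`|avg h n|)%:E x)%E.
  rewrite integral_cst// -(fineK (_ : mu (P n) \is a fin_num)) ?ge0_fin_numE//.
  rewrite -EFinM; apply: (@le_trans _ _ (Int (fun x => `|h x| * \1_(P n) x))%:E).
    by rewrite lee_fin avg_abs_le.
  rewrite -IntE; last exact/isL1_mul_indic/isL1_abs.
  rewrite [leRHS]integral_mkcond.
  rewrite le_eqVlt; apply/orP; left; apply/eqP; apply: eq_integral => x _.
  rewrite patchE indicE; case: (_ \in _) => /=; by rewrite ?mulr1 ?mulr0.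
have gi : L1 (avg_on h).
  apply/integrableP; split; first exact/measurable_EFinP.
  by apply: (le_lt_trans le); case/integrableP : hi.
by split => //; rewrite -lee_fin -!IntE//; exact: isL1_abs.
Qed.

Lemma isL1_avg_on h : L1 h -> L1 (avg_on h).
Proof. by move=> /isL1_avg_on_and_le[]. Qed.

Lemma avg_on_expansion_cvg h : L1 h ->
  Int (fun x => `|h x - avg_on h x - \sum_(n < N) bad_part h n x|) @[N --> \oo] --> (0 : R).
Proof.
move=> hi; have gi := isL1_avg_on hi.
apply: (@Int_dominated_cvg0 _ _ _ mu _ (fun x => `|h x - avg_on h x|)).
- move=> N; apply: measurable_funB; first exact: (isL1_measurable (isL1B hi gi)).
  by apply: measurable_sum => n; apply: measurable_bad_part; exact: isL1_measurable hi.
- exact/isL1_abs/isL1B.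
- move=> N x; rewrite /bad_part; have [[n Pnx]|Px] := pselect (exists n, P n x).
    rewrite (@sum_disjoint_in n _ (fun n => h x - avg h n))// (avg_on_in _ Pnx).
    by case: ifP => _; rewrite ?subr0 ?subrr ?normr0.
  rewrite (@sum_disjoint_out _ (fun n => h x - avg h n)) ?subr0// => n Pnx.
  by apply: Px; exists n.
- move=> x; have := @avg_on_cvg h x; move=> /cvgrPdist_lt H.
  apply/cvgrPdist_lt => e e0; have := H e e0.
  apply: filterS => N; rewrite sub0r normrN distrC.
  by congr (`|_| < e); ring.
Qed.

Lemma Int_avg_on h : L1 h -> Int (avg_on h) = Int h.
Proof.
move=> hi; have gi := isL1_avg_on hi.
apply/eqP; rewrite eq_sym -subr_eq0 -normr_eq0 eq_le normr_ge0 andbT.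
apply/ler_addgt0Pr => e e0; rewrite add0r.
have /cvgrPdist_lt/(_ e e0)[N _ /(_ N (leqnn N))] := avg_on_expansion_cvg hi.
rewrite sub0r normrN => h1; apply: ltW; apply: le_lt_trans h1.
have bi : L1 (fun x => \sum_(n < N) bad_part h n x).
  by apply: isL1_sum => n; exact: isL1_bad_part.
rewrite -IntB//; apply: le_trans (ler_norm _).
rewrite (_ : Int (fun x => h x - avg_on h x) =
  Int (fun x => h x - avg_on h x - \sum_(n < N) bad_part h n x)).
  by apply: le_abs_Int; apply: isL1B => //; exact: isL1B.
rewrite [RHS]IntB//; last exact: isL1B.
rewrite Int_sum; last by move=> n; exact: isL1_bad_part.
by rewrite big1 ?subr0// => n _; exact: Int_bad_part.
Qed.

Lemma H1norm_avg_on d h (s0 S : R) (s : nat -> R) : homogeneous_type d mu -> L1 h ->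
  (H1norm d mu (avg_on h) <= s0%:E)%E ->
  (forall n, (H1norm d mu (bad_part h n) <= (s n)%:E)%E) ->
  (forall N, \sum_(n < N) s n <= S) -> (H1norm d mu h <= (s0 + S)%:E)%E.
Proof.
move=> ht hi gs bs sS; have gi := isL1_avg_on hi.
have bi : L1 (fun x => h x - avg_on h x) by exact: isL1B.
have -> : h = (fun x => avg_on h x + (h x - avg_on h x)).
  by apply/funext => x; ring.
apply: (H1normD ht) => //.
apply: (H1norm_series ht bi _ bs sS) => [n|]; first exact: isL1_bad_part.
exact: avg_on_expansion_cvg.
Qed.

End averaging.

(** * Geometry of dyadic cubes and dyadic differentiation *)

Section dyadic_cubes.
Context {R : realType} {dsp : measure_display} {T : measurableType dsp}.
Variables (d : T -> T -> R) (mu : {measure set T -> \bar R}).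
Hypothesis ht : homogeneous_type d mu.
Implicit Types (f g h : T -> R).
Local Notation Int f := (Rintegral mu setT f).
Local Notation L1 := (isL1 mu).
Local Notation L2 := (isL2 mu).
Local Notation ball := (dball d).
Local Notation V := (Vol d mu).
Local Notation H1 := (H1norm d mu).

Lemma Vol_le x y r s : ball x r `<=` ball y s -> V x r <= V y s.
Proof.
move=> xy; rewrite -lee_fin -!(VolE ht); apply: le_measure => //; rewrite inE;
  exact: (ht_ball_meas ht).
Qed.

Lemma Vol_mono x r s : r <= s -> V x r <= V x s.
Proof. by move=> rs; apply: Vol_le => y; rewrite /dball /= => /lt_le_trans; apply. Qed.

Lemma Vol_doubling : exists2 C : R, 1 <= C &
  forall p x r, 0 < r -> V x (2 ^+ p * r) <= C ^+ p * V x r.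
Proof.
have [C CP] := ht_doubling ht.
exists (Num.max C 1); first by rewrite le_max lexx orbT.
have C0 : 0 <= Num.max C 1 by rewrite le_max ler01 orbT.
move=> p x r r0; elim: p => [|p IH]; first by rewrite !expr0 !mul1r.
have p0 : 0 < 2 ^+ p * r by rewrite mulr_gt0// exprn_gt0.
rewrite !exprS -!mulrA; apply: (@le_trans _ _ (Num.max C 1 * V x (2 ^+ p * r))).
  have := CP x _ p0; rewrite !(VolE ht) -EFinM lee_fin => /le_trans; apply.
  by rewrite ler_wpM2r ?le_max ?lexx// Vol_ge0.
by rewrite ler_wpM2l.
Qed.

Variables (delta : R) (A : int -> set nat) (pt : nat -> T) (Q : int -> nat -> set T).
Hypothesis delta_int : 0 < delta <= 1 / 1000.
Hypothesis dy : dyadic_system d delta A pt Q.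
Local Notation mQ k a := (fine (mu (Q k a))).

Let delta_gt0 : 0 < delta. Proof. by case/andP : delta_int. Qed.

Lemma delta_pow_gt0 k : 0 < delta ^ k.
Proof. exact: exprz_gt0. Qed.

Lemma delta_powS k : delta ^ k = delta * delta ^ (k - 1).
Proof.
have -> : delta * delta ^ (k - 1) = delta ^ 1 * delta ^ (k - 1) by rewrite expr1z.
by rewrite -expfzDr ?gt_eqF//; congr (_ ^ _); ring.
Qed.

Lemma delta_pow_small x : 0 < x -> exists j : nat, delta ^+ j < x.
Proof.
move=> x0; have : delta ^+ n @[n --> \oo] --> (0 : R).
  by apply: cvg_expr; rewrite ger0_norm ?ltW//; case/andP : delta_int => _; lra.
move=> /cvgrPdist_lt/(_ x x0)[j _ /(_ j (leqnn j))]; rewrite sub0r normrN => h.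
by exists j; apply: le_lt_trans (ler_norm _) h.
Qed.

Lemma scale_of_radius r : 0 < r -> exists k : int, delta ^ k <= r < delta ^ (k - 1).
Proof.
move=> r0; have [n nr] := delta_pow_small r0.
(* Shifting exponents by [m] turns the search over integers into one for a least natural number [j];
   since [delta ^ (- m) > r], the least [j] is not 0 and its predecessor fails. *)
have [m mr] : exists m : nat, delta ^+ m < r^-1 by apply: delta_pow_small; rewrite invr_gt0.
have ex : exists j : nat, delta ^ (j%:Z - m%:Z) <= r.
  exists (n + m)%N; rewrite (_ : (n + m)%N%:Z - m%:Z = n%:Z); last by rewrite PoszD; ring.
  exact: ltW.
case: (ex_minnP ex) => j jr jmin; exists (j%:Z - m%:Z); rewrite jr/=.
case: j jr jmin => [|j] jr jmin.
  exfalso; move: jr; rewrite sub0r.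
  rewrite leNgt => /negP; apply.
  rewrite -exprnN -[ltLHS]invrK ltf_pV2 ?posrE ?invr_gt0 ?exprn_gt0//.
rewrite ltNge; apply/negP => h.
have := jmin j; rewrite (_ : j%:Z - m%:Z = j.+1%:Z - m%:Z - 1); last by rewrite -addn1 PoszD; ring.
by move=> /(_ h); rewrite ltnn.
Qed.

Lemma cube_center k a : A k a -> Q k a (pt a).
Proof.
move=> Aa; have [+ _] := dy_balls dy Aa; apply; rewrite /dball /=.
by rewrite ((ht_sep ht _ _).2 erefl) divr_gt0// delta_pow_gt0.
Qed.

Lemma cube_dist k a x y : A k a -> Q k a x -> Q k a y -> d x y < 8 * delta ^ k.
Proof.
move=> Aa Qx Qy; have [_ QB] := dy_balls dy Aa.
have := QB _ Qx; have := QB _ Qy; rewrite /dball /= => h1 h2.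
by apply: (le_lt_trans (ht_tri ht x (pt a) y)); rewrite (ht_sym ht x); lra.
Qed.

Lemma mu_cube_lty k a : A k a -> (mu (Q k a) < +oo)%E.
Proof.
move=> Aa; have [_ QB] := dy_balls dy Aa.
apply: (le_lt_trans (le_measure mu _ _ QB)); rewrite ?inE.
- exact: (dy_Q_meas dy).
- exact: (ht_ball_meas ht).
- exact: (ht_ball_fin ht).
Qed.

Lemma mu_cubeE k a : A k a -> mu (Q k a) = (mQ k a)%:E.
Proof. by move=> Aa; rewrite fineK// ge0_fin_numE//; exact: mu_cube_lty. Qed.

Lemma cube_le k a x r : A k a -> Q k a `<=` ball x r -> mQ k a <= V x r.
Proof.
move=> Aa QB; rewrite -lee_fin -mu_cubeE// -(VolE ht); apply: le_measure => //; rewrite inE.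
  exact: (dy_Q_meas dy).
exact: (ht_ball_meas ht).
Qed.

Lemma cube_ge k a : A k a -> V (pt a) (delta ^ k / 3) <= mQ k a.
Proof.
move=> Aa; have [BQ _] := dy_balls dy Aa.
rewrite -lee_fin -mu_cubeE// -(VolE ht); apply: le_measure => //; rewrite inE.
  exact: (ht_ball_meas ht).
exact: (dy_Q_meas dy).
Qed.

Lemma cube_gt0 k a : A k a -> 0 < mQ k a.
Proof.
move=> Aa; apply: lt_le_trans (cube_ge Aa).
by apply: (Vol_gt0 ht); rewrite divr_gt0// delta_pow_gt0.
Qed.

Lemma cube_parent k a : A k a -> exists2 b, A (k - 1) b & Q k a `<=` Q (k - 1) b.
Proof.
move=> Aa; have [b Ab Qb] := dy_cover dy (k - 1) (pt a); exists b => //.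
have [|//|Q0] := dy_nested dy (_ : k - 1 <= k) Ab Aa; first by lia.
by exfalso; suff : set0 (pt a) by []; rewrite -Q0; split => //; exact: cube_center.
Qed.

(** One constant serves every later comparison: parent with child, cube with surrounding ball, and
    ball with its enlargement by 16. *)
Lemma cube_constant : exists2 D : R, 1 <= D &
  (forall k a, A k a -> V (pt a) (16 * delta ^ (k - 1)) <= D * mQ k a) /\
  (forall x r, 0 < r -> V x (16 * r) <= D * V x r).
Proof.
have [C C1 CP] := Vol_doubling.
(* The radii [16 * delta ^ (k - 1)] and [delta ^ k / 3] have ratio [48 / delta]; the added 4 ensures
   [16 <= 2 ^+ p] for the second estimate. *)
pose p := (Num.bound (48 / delta) + 4)%N.
have C0 : 0 <= C by exact: le_trans C1.
have pd : 48 / delta <= 2 ^+ p.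
  apply: (@le_trans _ _ (Num.bound (48 / delta))%:R).
    by apply/ltW/archi_boundP; rewrite divr_ge0// ltW.
  rewrite -natrX ler_nat; apply: ltnW; apply: (leq_trans (ltn_expl _ (isT : (1 < 2)%N))).
  by rewrite leq_exp2l// leq_addr.
have p4 : 16 <= 2 ^+ p :> R.
  by rewrite (_ : 16 = 2 ^+ 4 :> R) ?ler_eXn2l ?leq_addl ?ltr1n// -natrX.
exists (C ^+ p); first exact: exprn_ege1.
split => [k a Aa|x r r0].
  have k0 := delta_pow_gt0 k.
  apply: (@le_trans _ _ (V (pt a) (2 ^+ p * (delta ^ k / 3)))).
    apply: Vol_mono; rewrite (delta_powS k) -(ler_pM2r (_ : 0 < 3 / delta ^ (k - 1))); last first.
      by rewrite divr_gt0// delta_pow_gt0.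
    have kn0 : delta ^ (k - 1) != 0 by rewrite gt_eqF// delta_pow_gt0.
    have -> : 16 * delta ^ (k - 1) * (3 / delta ^ (k - 1)) = 48 by field.
    have -> : 2 ^+ p * (delta * delta ^ (k - 1) / 3) * (3 / delta ^ (k - 1)) = 2 ^+ p * delta by field.
    by rewrite -ler_pdivrMr.
  apply: (le_trans (CP _ _ _ _)); first by rewrite divr_gt0.
  by rewrite ler_wpM2l ?exprn_ge0//; exact: cube_ge.
apply: le_trans (CP _ _ _ r0); apply: Vol_mono; by rewrite ler_wpM2r// ltW.
Qed.

(** Labels that are not selected carry the empty set, which makes the family a sequence of disjoint
    sets as the averaging lemmas expect. *)
Definition gen_cubes (k : int) (S : set nat) (a : nat) : set T :=
  if `[< A k a /\ S a >] then Q k a else set0.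

Lemma gen_cubesP k S a x : gen_cubes k S a x -> [/\ A k a, S a & Q k a x].
Proof. by rewrite /gen_cubes; case: asboolP => // -[]. Qed.

Lemma gen_cubesE k S a : A k a -> S a -> gen_cubes k S a = Q k a.
Proof. by move=> Aa Sa; rewrite /gen_cubes; case: asboolP => // -[]. Qed.

Lemma measurable_gen_cubes k S a : measurable (gen_cubes k S a).
Proof. by rewrite /gen_cubes; case: ifP => // _; exact: (dy_Q_meas dy). Qed.

Lemma trivIset_gen_cubes k S : trivIset setT (gen_cubes k S).
Proof.
move=> a b _ _ [x [/gen_cubesP[Aa _ ax] /gen_cubesP[Ab _ bx]]].
apply: contrapT => ab; suff : set0 x by [].
by rewrite -(dy_disj dy Aa Ab ab).
Qed.

Lemma mu_gen_cubes_lty k S a : (mu (gen_cubes k S a) < +oo)%E.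
Proof.
rewrite /gen_cubes; case: asboolP => [[Aa _]|_]; first exact: mu_cube_lty.
by rewrite measure0.
Qed.

Hypothesis dense : forall u, L2 u -> forall e : R, 0 < e -> exists w, [/\ L2 w,
  (forall eta, 0 < eta -> exists2 rho, 0 < rho &
     forall x y, d x y < rho -> `|w x - w y| <= eta) &
  Int (fun x => (u x - w x) ^+ 2) <= e].

(* Dyadic Lebesgue differentiation: [|h|] is approximated in L2 by a uniformly
   continuous [w], which is almost constant on the cubes of a fine generation,
   so that [|h|] exceeds the averages of [|h|] by a quantity of small integral. *)
Lemma dyadic_differentiation k0 a0 h (F : set T) (Lam : R) : A k0 a0 -> 0 <= Lam ->
  measurable F -> L2 h -> L1 h -> (forall x, ~ Q k0 a0 x -> h x = 0) ->
  (forall x, F x -> forall k a, k0 <= k -> A k a -> Q k a x ->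
     Int (fun y => `|h y| * \1_(Q k a) y) <= Lam * mQ k a) ->
  {ae mu, forall x, F x -> `|h x| <= Lam}.
Proof.
move=> Aa0 Lam0 mF h2 hi h0 hF; have mh : measurable_fun setT h by case: h2.
have mah : measurable_fun setT (fun x => `|h x|) by exact: measurableT_comp.
have ah2 : L2 (fun x => `|h x|).
  split => //; case: h2 => _; apply: isL1_ext => x; by rewrite real_normK ?num_real.
have mQ0 := dy_Q_meas dy k0 a0; have fQ0 := mu_cube_lty Aa0.
pose phi x := Num.max (`|h x| - Lam) 0 * \1_F x.
have phi0 x : 0 <= phi x by rewrite mulr_ge0// le_max lexx orbT.
have phile x : phi x <= `|h x|.
  apply: (@le_trans _ _ (Num.max (`|h x| - Lam) 0)).
    by rewrite ler_piMr// ?le_max ?lexx ?orbT// indicE; case: (_ \in _).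
  by rewrite ge_max normr_ge0 gerBl Lam0.
have phii : L1 phi.
  apply: (isL1_dom _ (isL1_abs hi)).
    apply: measurable_funM; last exact: measurable_indic.
    by apply: measurable_maxr => //; exact: measurable_funB.
  by move=> x; rewrite ger0_norm.
suff phiI0 : Int (fun x => `|phi x|) = 0.
  have := Int_abs_eq0 phii phiI0; apply: filterS => x phix Fx.
  move: phix; rewrite /phi indicE mem_set// mulr1 => /eqP.
  by rewrite eq_le => /andP[+ _]; rewrite ge_max => /andP[]; rewrite subr_le0.
apply/eqP; rewrite eq_le Int_ge0 ?andbT//.
pose m0 := mQ k0 a0; have m0_gt0 : 0 < m0 by exact: cube_gt0.
(* The bound consists of twice the integral of [h'], because averaging is an L1 contraction, plus
   [e] integrated over the cube. *)
suff small e : 0 < e -> Int (fun x => `|phi x|) <= e + 2 * e * m0.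
  apply/ler_addgt0Pr => e e0; rewrite add0r.
  have e'0 : 0 < e / (1 + 2 * m0) by rewrite divr_gt0// addr_gt0// mulr_gt0.
  apply: (le_trans (small _ e'0)).
  set q := e / _; have : q * (1 + 2 * m0) = e.
    by rewrite /q divfK// gt_eqF// addr_gt0// mulr_gt0.
  lra.
move=> e0.
have [|w [w2 wu we]] := dense ah2 (e := e ^+ 2); first exact: exprn_gt0.
have [rho rho0 wrho] := wu e e0.
have [j jrho] : exists j : nat, delta ^+ j < rho / (8 * delta ^ k0).
  by apply: delta_pow_small; rewrite divr_gt0// mulr_gt0// delta_pow_gt0.
pose n : int := k0 + j%:Z.
have nrho : 8 * delta ^ n < rho.
  have := delta_pow_gt0 k0 => k0_gt0.
  rewrite /n expfzDr ?gt_eqF// mulrA mulrC.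
  by move: jrho; rewrite ltr_pdivlMr// mulr_gt0.
have k0n : k0 <= n by rewrite /n lerDl.
pose h' x := `| `|h x| - w x| * \1_(Q k0 a0) x.
have h'0 x : 0 <= h' x by rewrite mulr_ge0.
have ind2 : L2 (\1_(Q k0 a0)).
  split; first exact: measurable_indic.
  apply: isL1_ext (isL1_indic mQ0 fQ0) => x.
  by rewrite indicE; case: (_ \in _); rewrite ?expr1n ?expr0n.
have dw2 : L2 (fun x => `| `|h x| - w x|).
  have [mhw hw2] := isL2B ah2 w2; split; first exact: measurableT_comp.
  by apply: isL1_ext hw2 => x; rewrite real_normK ?num_real.
have h'i : L1 h' by exact: isL2_mul.
(* The weight [e^-1] balances the L2 error [e ^+ 2] against the measure of the cube. *)
have Ih' : Int h' <= (e + e * m0) / 2.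
  have := abs_Int_mul_le (t := e^-1) _ dw2 ind2; rewrite invr_gt0 => /(_ e0).
  rewrite invrK (@eq_Int _ _ _ mu (fun x => \1_(Q k0 a0) x ^+ 2) (\1_(Q k0 a0))); last first.
    by move=> x; rewrite indicE; case: (_ \in _); rewrite ?expr1n ?expr0n.
  rewrite Int_indic// -/m0 -[Int (fun x => _ * _)]/(Int h') ger0_norm; last exact: Int_ge0.
  move=> /le_trans; apply; rewrite ler_pM2r ?invr_gt0// lerD2r.
  rewrite ler_pdivrMl// -expr2; apply: le_trans we.
  rewrite le_eqVlt; apply/orP; left; apply/eqP; apply: eq_Int => x.
  by rewrite real_normK ?num_real.
pose G := gen_cubes n setT.
have mG a : measurable (G a) by exact: measurable_gen_cubes.
have dG : trivIset setT G by exact: trivIset_gen_cubes.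
have fG a : (mu (G a) < +oo)%E by exact: mu_gen_cubes_lty.
have [gi gle] := isL1_avg_on_and_le mG dG fG h'i.
(* On the small cube through [x] one has [|h| >= w - h' >= w x - e - h']; averaging gives
   [w x - e - avg h' <= Lam], and [|h x| - w x <= h' x] finishes. *)
have ptw x : phi x <= h' x + `|avg_on mu G h' x| + e * \1_(Q k0 a0) x.
  have [Fx|Fx] := pselect (F x); last first.
    rewrite {1}/phi indicE memNset// mulr0 !addr_ge0// mulr_ge0// ltW//.
  have [Qx|Qx] := pselect (Q k0 a0 x); last first.
    apply: (le_trans (phile x)); rewrite h0// normr0 !addr_ge0// mulr_ge0// ltW//.
  have rhs0 : 0 <= h' x + `|avg_on mu G h' x| + e * \1_(Q k0 a0) x.
    by rewrite !addr_ge0// mulr_ge0// ltW//.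
  rewrite {1}/phi indicE mem_set// mulr1 ge_max rhs0 andbT indicE mem_set// mulr1.
  have [a Aa Qa] := dy_cover dy n x.
  have QQ : Q n a `<=` Q k0 a0.
    have [//|Q0] := dy_nested dy k0n Aa0 Aa.
    by exfalso; suff : set0 x by []; rewrite -Q0.
  have Ga : G a = Q n a by exact: gen_cubesE.
  have Gx : G a x by rewrite Ga.
  rewrite (avg_on_in mu dG h' Gx) /avg Ga.
  have ma := cube_gt0 Aa; have mQa := dy_Q_meas dy n a; have fQa := mu_cube_lty Aa.
  have i1 := isL1_mul_indic mQa h'i.
  have i2 := isL1_indic mQa fQa.
  have i3 := isL1_mul_indic mQa (isL1_abs hi).
  have key : (w x - e) * mQ n a - Int (fun y => h' y * \1_(Q n a) y) <= Lam * mQ n a.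
    apply: le_trans (hF x Fx n a k0n Aa Qa).
    rewrite -Int_indic// -IntZ// -IntB//; last exact: isL1Z.
    apply: Int_le => //; first by apply: isL1B => //; exact: isL1Z.
    move=> y; rewrite indicE; case: (boolP (y \in Q n a)) => /=; last by rewrite !mulr0 subr0.
    rewrite inE => Qy; rewrite !mulr1 /h' indicE mem_set ?mulr1; last exact: QQ.
    have := wrho x y (lt_trans (cube_dist Aa Qa Qy) nrho).
    rewrite ler_norml => /andP[_ h1].
    have := ler_norm (w y - `|h y|); rewrite distrC; lra.
  have key2 : w x - e - Int (fun y => h' y * \1_(Q n a) y) / mQ n a <= Lam.
    rewrite -(ler_pM2r ma) mulrBl; apply: le_trans key.
    by rewrite -mulrA mulVf ?gt_eqF// mulr1.
  have := ler_norm (Int (fun y => h' y * \1_(Q n a) y) / mQ n a).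
  have := ler_norm (`|h x| - w x).
  rewrite /h' [X in _ -> _ -> _ <= X + _ + _](_ : _ = `| `|h x| - w x|).
    set I1 := Int _; set q := I1 / _; have : w x - e - q <= Lam by []. lra.
  by rewrite indicE mem_set// mulr1.
have iQ0 := isL1Z e (isL1_indic mQ0 fQ0).
apply: (@le_trans _ _ (Int (fun x => h' x + `|avg_on mu G h' x| + e * \1_(Q k0 a0) x))).
  apply: Int_le; [exact: isL1_abs| |move=> x; rewrite ger0_norm//].
  by apply: isL1D => //; apply: isL1D => //; exact: isL1_abs.
rewrite IntD//; last by apply: isL1D => //; exact: isL1_abs.
rewrite IntD//; last exact: isL1_abs.
rewrite IntZ ?Int_indic// -/m0; last exact: isL1_indic.
have : Int (fun x => `|h' x|) = Int h' by apply: eq_Int => x; rewrite ger0_norm.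
by move: gle => + h1; rewrite h1 => gle; lra.
Qed.

End dyadic_cubes.

(** * Stopping cubes and the H1 norm of L2 functions on a ball *)

Section calderon_zygmund.
Context {R : realType} {dsp : measure_display} {T : measurableType dsp}.
Variables (d : T -> T -> R) (mu : {measure set T -> \bar R}).
Hypothesis ht : homogeneous_type d mu.
Implicit Types (f g h : T -> R).
Local Notation Int f := (Rintegral mu setT f).
Local Notation L1 := (isL1 mu).
Local Notation L2 := (isL2 mu).
Local Notation ball := (dball d).
Local Notation V := (Vol d mu).
Local Notation H1 := (H1norm d mu).
Variables (delta : R) (A : int -> set nat) (pt : nat -> T) (Q : int -> nat -> set T).
Hypothesis delta_int : 0 < delta <= 1 / 1000.
Hypothesis dy : dyadic_system d delta A pt Q.
Local Notation mQ k a := (fine (mu (Q k a))).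
Hypothesis dense : forall u, L2 u -> forall e : R, 0 < e -> exists w, [/\ L2 w,
  (forall eta, 0 < eta -> exists2 rho, 0 < rho &
     forall x y, d x y < rho -> `|w x - w y| <= eta) &
  Int (fun x => (u x - w x) ^+ 2) <= e].
Variable D : R.
Hypothesis D1 : 1 <= D.
Hypothesis DQ : forall k a, A k a -> V (pt a) (16 * delta ^ (k - 1)) <= D * mQ k a.
Hypothesis DV : forall x r, 0 < r -> V x (16 * r) <= D * V x r.

Let D0 : 0 < D. Proof. exact: lt_le_trans D1. Qed.

Lemma parent_cube_le k a b : A k a -> A (k - 1) b -> Q k a `<=` Q (k - 1) b ->
  mQ (k - 1) b <= D * mQ k a.
Proof.
move=> Aa Ab ab; apply: le_trans (DQ Aa); apply: (cube_le ht dy Ab) => z Qz.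
have := cube_dist ht dy Ab (ab _ (cube_center ht delta_int dy Aa)) Qz.
rewrite /dball /= => /lt_trans; apply; rewrite ltr_pM2r ?ltr_nat//.
exact: delta_pow_gt0.
Qed.

Lemma cube_ball4_le k a : A k a -> V (pt a) (4 * delta ^ k) <= D * mQ k a.
Proof.
move=> Aa; apply: le_trans (DQ Aa); apply: (Vol_mono ht).
have := delta_pow_gt0 delta_int (k - 1); rewrite (delta_powS delta_int k).
by case/andP : delta_int => _ h; nra.
Qed.

(** The selected cubes are the coarsest ones on which the mean of [|h|] exceeds [Lam]. The parent of
    such a cube is not bad, so its mean is at most [Lam], and passing to the child costs the factor
    [D]. *)
Lemma stopping_cubes k0 a0 h (Lam : R) : A k0 a0 -> 0 <= Lam -> L1 h ->
  (forall x, ~ Q k0 a0 x -> h x = 0) ->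
  Int (fun x => `|h x|) <= Lam * mQ k0 a0 ->
  exists P : nat -> set T, [/\ forall n, measurable (P n), trivIset setT P,
    forall n, P n = set0 \/ exists k a, [/\ A k a, P n = Q k a, Q k a `<=` Q k0 a0,
        Lam * mQ k a < Int (fun x => `|h x| * \1_(Q k a) x) &
        Int (fun x => `|h x| * \1_(Q k a) x) <= Lam * D * mQ k a] &
    forall x, (forall n, ~ P n x) -> forall k a, k0 <= k -> A k a -> Q k a x ->
        Int (fun y => `|h y| * \1_(Q k a) y) <= Lam * mQ k a].
Proof.
move=> Aa0 Lam0 hi h0 hL.
pose J k a := Int (fun y => `|h y| * \1_(Q k a) y).
have Ji k a : L1 (fun y => `|h y| * \1_(Q k a) y).
  by apply: isL1_mul_indic; [exact: (dy_Q_meas dy)|exact: isL1_abs].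
pose bad (p : int * nat) := [/\ k0 <= p.1, A p.1 p.2 & Lam * mQ p.1 p.2 < J p.1 p.2].
have bad_sub p : bad p -> Q p.1 p.2 `<=` Q k0 a0.
  move=> [kp Ap LJ]; have [//|Q0] := dy_nested dy kp Aa0 Ap.
  exfalso; move: LJ; rewrite ltNge => /negP; apply.
  rewrite /J (@eq_Int _ _ _ mu _ (fun=> 0)) ?Int0 ?mulr_ge0 ?fine_ge0// => y.
  rewrite indicE; case: (boolP (y \in _)) => /=; last by rewrite mulr0.
  rewrite inE => Qy; rewrite h0 ?normr0 ?mul0r// => Q0y.
  by suff : set0 y by []; rewrite -Q0.
(* The top cube is not bad, by the assumption on the mean of [h]; hence the parent of a bad cube
   still has generation at least [k0]. *)
have bad_gt p : bad p -> k0 < p.1.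
  move=> bp; have QQ := bad_sub p bp; case: bp => kp Ap LJ.
  rewrite lt_neqAle kp andbT; apply/eqP => kE.
  have [aE|aN] := eqVneq p.2 a0.
    move: LJ; rewrite -kE aE ltNge => /negP; apply; apply: le_trans hL.
    apply: Int_le; [exact: Ji|exact: isL1_abs|move=> y].
    by rewrite ler_piMr// indicE; case: (_ \in _).
  rewrite -kE in QQ Ap; suff : set0 (pt p.2) by [].
  rewrite -(dy_disj dy Ap Aa0 (elimN eqP aN)).
  by have c := cube_center ht delta_int dy Ap; split => //; exact: QQ.
pose stop p := bad p /\ forall p', p'.1 < p.1 -> bad p' -> ~ (Q p.1 p.2 `<=` Q p'.1 p'.2).
have stop_uniq p q x : stop p -> stop q -> Q p.1 p.2 x -> Q q.1 q.2 x -> p = q.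
  wlog pq : p q / p.1 <= q.1.
    move=> W sp sq px qx; have [h1|h1] := leP p.1 q.1; first exact: W.
    by apply/esym; apply: W => //; exact: ltW.
  move=> [bp sp] [bq sq] px qx; have [_ Ap _] := bp; have [_ Aq _] := bq.
  have qp : Q q.1 q.2 `<=` Q p.1 p.2.
    have [//|Q0] := dy_nested dy pq Ap Aq.
    by exfalso; suff : set0 x by []; rewrite -Q0.
  have E1 : p.1 = q.1.
    apply/eqP; apply: contrapT => /negP pq'.
    by apply: (sq p) => //; rewrite lt_neqAle pq pq'.
  have E2 : p.2 = q.2.
    apply: contrapT => pq'; rewrite E1 in Ap px; suff : set0 x by [].
    by rewrite -(dy_disj dy Ap Aq pq').
  by case: p q E1 E2 {pq sp sq px qx qp bp bq Ap Aq} => [? ?] [? ?] /= -> ->.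
(* The stopping cubes are listed through the encoding of pairs; codes of anything else give the
   empty set. *)
pose P n : set T := if pickle_inv n is Some p then
  (if `[< stop p >] then Q p.1 p.2 else set0) else set0.
have PE n : P n = set0 \/ exists p, [/\ stop p, P n = Q p.1 p.2 & pickle p = n].
  rewrite /P; case E : (pickle_inv n) => [p|]; last by left.
  case: asboolP => sp; last by left.
  by right; exists p; split => //; have := @pickle_invK (int * nat)%type n; rewrite E.
exists P; split.
- move=> n; have [->//|[p [_ -> _]]] := PE n; exact: (dy_Q_meas dy).
- move=> n m _ _ [x []]; have [->//|[p [sp -> <-]]] := PE n.
  have [->//|[q [sq -> <-]]] := PE m.
  by move=> px qx; rewrite (stop_uniq p q x sp sq px qx).
- move=> n; have [->|[p [[bp sp] -> _]]] := PE n; first by left.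
  right; exists p.1, p.2; have k0p := bad_gt _ bp; have QQ := bad_sub _ bp.
  have [_ Ap LJ] := bp; split => //.
  have [b Ab pb] := cube_parent ht delta_int dy Ap.
  have nb : ~ bad (p.1 - 1, b).
    by move=> bb; apply: (sp (p.1 - 1, b)) => //=; rewrite gtrBl.
  have le1 : J (p.1 - 1) b <= Lam * mQ (p.1 - 1) b.
    rewrite leNgt; apply/negP => h1; apply: nb; split => //=.
    by rewrite lerBrDr -ltzD1 ltrD2r.
  apply: (@le_trans _ _ (J (p.1 - 1) b)).
    apply: Int_le => // y; rewrite ler_wpM2l// !indicE.
    case: (boolP (y \in Q p.1 p.2)) => // /set_mem/pb Qy.
    by rewrite mem_set.
  by apply: (le_trans le1); rewrite -mulrA ler_wpM2l//; exact: parent_cube_le.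
- move=> x Px k a k0k Aa Qx; rewrite leNgt; apply/negP => LJ.
  (* Counting generations from [k0] by naturals provides a coarsest bad cube through [x], and that
     one is a stopping cube. *)
  have ex : exists j : nat, `[< exists b, bad (k0 + j%:Z, b) /\ Q (k0 + j%:Z) b x >].
    exists `|k - k0|%N; apply/asboolP; exists a.
    have -> : k0 + `|k - k0|%N%:Z = k by rewrite gez0_abs ?subr_ge0//; ring.
    by split.
  case: (ex_minnP ex) => j /asboolP[b [bb Qb]] jmin.
  apply: (Px (pickle (k0 + j%:Z, b))); rewrite /P pickleK_inv.
  case: asboolP => // -[]; split => // p' p'lt bp' sub.
  have [kp' _ _] := bp'.
  have := jmin `|p'.1 - k0|%N.
  have -> : k0 + `|p'.1 - k0|%N%:Z = p'.1 by rewrite gez0_abs ?subr_ge0//; ring.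
  have asb : `[< exists b0, bad (p'.1, b0) /\ Q p'.1 b0 x >].
    by apply/asboolP; exists p'.2; split; [case: p' bp' {p'lt sub kp'}|exact: sub].
  move=> /(_ asb); rewrite leqNgt => /negP; apply.
  rewrite -ltz_nat gez0_abs ?subr_ge0//.
  by move: p'lt; rewrite /= -ltrBlDl.
Qed.

Lemma isL2_bounded_supp h x r M : measurable_fun setT h ->
  (forall y, ~ ball x r y -> h y = 0) -> {ae mu, forall y, `|h y| <= M} -> L2 h.
Proof.
move=> mh h0 hM; split => //; apply: (isL1_bounded_supp ht (x := x) (r := r) (M := M ^+ 2)).
- exact: measurable_funX.
- by move=> y /h0 ->; rewrite expr0n.
- apply: filterS hM => y hyM; rewrite normrX ler_sqr ?nnegrE//.
  exact: le_trans hyM.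
Qed.

Lemma H1norm_0 (x0 : T) h : h =1 (fun=> 0) -> (H1 h <= 0%:E)%E.
Proof.
move=> h0; have -> : h = (fun=> 0) by apply/funext.
have := @H1norm_bounded_supp _ _ _ d mu ht (fun=> 0) x0 1 0.
rewrite mul0r; apply => //; last exact: Int0.
by apply: aeW => y; rewrite normr0.
Qed.

(* Stopping at height [3 * D * lam] leaves cubes of total mass small enough
   that the recursive bounds for the bad parts, at height [6 * D ^+ 2 * lam],
   are absorbed by the second term. *)
Lemma H1norm_cube n : forall k0 a0 h (lam : R), A k0 a0 -> 0 < lam ->
  measurable_fun setT h -> (forall x, ~ Q k0 a0 x -> h x = 0) ->
  {ae mu, forall x, `|h x| <= (3 * D ^+ 2) ^+ n * lam} -> Int h = 0 ->
  Int (fun x => `|h x|) <= lam * mQ k0 a0 ->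
  (H1 h <= (3 * D ^+ 3 * (lam * mQ k0 a0 + Int (fun x => h x ^+ 2) / lam))%:E)%E.
Proof.
have D2 : 1 <= D ^+ 2 by exact: exprn_ege1.
pose K := 3 * D ^+ 2; have K1 : 1 <= K by rewrite /K; lra.
have K0 : 0 <= K by exact: le_trans K1.
have D3 : 0 <= 3 * D ^+ 3 by rewrite mulr_ge0// exprn_ge0// ltW.
have supp_ball k0 a0 h : A k0 a0 -> (forall x, ~ Q k0 a0 x -> h x = 0) ->
    forall y, ~ ball (pt a0) (4 * delta ^ k0) y -> h y = 0.
  by move=> Aa0 h0 y yB; apply: h0 => Qy; apply: yB; have [_] := dy_balls dy Aa0; apply.
have r0 k0 : 0 < 4 * delta ^ k0 by rewrite mulr_gt0// delta_pow_gt0.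
elim: n => [|n IH] k0 a0 h lam Aa0 lam0 mh h0 hM Ih hlam;
  have hB := supp_ball k0 a0 h Aa0 h0; have m0 := cube_gt0 ht delta_int dy Aa0.
  have h20 : 0 <= Int (fun x => h x ^+ 2) / lam.
    by rewrite divr_ge0 ?(ltW lam0)// Int_ge0// => x; exact: sqr_ge0.
  apply: (le_trans (H1norm_bounded_supp ht (r0 k0) (ltW lam0) mh hB _ Ih)).
    by apply: filterS hM => x; rewrite expr0 mul1r.
  rewrite lee_fin; apply: (@le_trans _ _ (lam * (D * mQ k0 a0))).
    by rewrite ler_pM2l//; exact: cube_ball4_le.
  have DD : D <= 3 * D ^+ 3.
    have -> : D ^+ 3 = D * D ^+ 2 by rewrite -exprS.
    have D0' := D0; nra.
  apply: (@le_trans _ _ (3 * D ^+ 3 * (lam * mQ k0 a0))).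
    rewrite [leLHS](_ : _ = D * (lam * mQ k0 a0)); last by ring.
    by rewrite ler_wpM2r// mulr_ge0// ltW.
  by rewrite ler_wpM2l// lerDl.
have hi : L1 h by exact: (isL1_bounded_supp ht mh hB hM).
have h2 : L2 h by exact: (isL2_bounded_supp mh hB hM).
(* Averages over cubes stopped at this height are at most [Lam * D = K * lam], so [K] is the growth
   factor of the sup bound in the induction on [n]. *)
pose Lam := 3 * D * lam; have Lam0 : 0 < Lam by rewrite !mulr_gt0.
have lamLam : lam <= Lam by rewrite /Lam ler_peMl ?(ltW lam0)//; have D1' := D1; lra.
have hLam : Int (fun x => `|h x|) <= Lam * mQ k0 a0.
  by apply: (le_trans hlam); rewrite ler_pM2r.
have [P [mP dP Pcase Pout]] := stopping_cubes Aa0 (ltW Lam0) hi h0 hLam.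
have fP m : (mu (P m) < +oo)%E.
  have [->|[k [a [Aa -> _ _ _]]]] := Pcase m; first by rewrite measure0.
  exact: (mu_cube_lty ht dy).
have mF : measurable (~` \bigcup_m P m) by apply: measurableC; exact: bigcup_measurable.
have hF := dyadic_differentiation ht delta_int dy dense Aa0 (ltW Lam0) mF h2 hi h0.
have {}hF : {ae mu, forall x, (~` \bigcup_m P m) x -> `|h x| <= Lam}.
  by apply: hF => x Fx; apply: Pout => m Pmx; apply: Fx; exists m.
have LamK : Lam * D = K * lam by rewrite /Lam /K; ring.
have LamK' : Lam <= K * lam by rewrite -LamK ler_peMr// ltW.
have avgK m : `|avg mu P h m| <= K * lam.
  have [P0|[k [a [Aa PQ _ _ le2]]]] := Pcase m.
    rewrite /avg P0 measure0 invr0 mulr0 normr0 mulr_ge0// ltW//.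
  have ma := cube_gt0 ht delta_int dy Aa.
  rewrite -(ler_pM2r ma) -LamK; apply: le_trans le2.
  by rewrite -{1}PQ; apply: (le_trans (avg_abs_le mP fP m hi)); rewrite PQ.
have gsupp y : ~ ball (pt a0) (4 * delta ^ k0) y -> avg_on mu P h y = 0.
  move=> yB; rewrite avg_on_out; first exact: hB.
  move=> m; have [->//|[k [a [Aa -> QQ _ _]]]] := Pcase m.
  by move=> /QQ Qy; apply: yB; have [_] := dy_balls dy Aa0; apply.
have gbound : {ae mu, forall x, `|avg_on mu P h x| <= K * lam}.
  apply: filterS hF => x hx; have [[m Pmx]|Px] := pselect (exists m, P m x).
    by rewrite (avg_on_in mu dP h Pmx).
  rewrite avg_on_out; first by apply: le_trans LamK'; apply: hx => -[m _ Pmx]; apply: Px; exists m.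
  by move=> m Pmx; apply: Px; exists m.
have sq i : 0 <= Int (fun x => h x ^+ 2 * \1_(P i) x) by apply: Int_ge0 => x; rewrite mulr_ge0 ?sqr_ge0.
rewrite mulrDr; apply: (H1norm_avg_on mP dP fP
  (s := fun m => 3 * D ^+ 3 * (Int (fun x => h x ^+ 2 * \1_(P m) x) / lam)) ht hi).
- have mg : measurable_fun setT (avg_on mu P h) by exact: measurable_avg_on.
  have Kl0 : 0 <= K * lam by rewrite mulr_ge0// ltW.
  apply: (le_trans (H1norm_bounded_supp ht (r0 k0) Kl0 mg gsupp gbound _)).
    by rewrite Int_avg_on.
  rewrite lee_fin; apply: (@le_trans _ _ (K * lam * (D * mQ k0 a0))).
    by rewrite ler_wpM2l//; exact: cube_ball4_le.
  by rewrite /K le_eqVlt; apply/orP; left; apply/eqP; ring.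
- move=> m; have [P0|[k [a [Aa PQ _ lt1 le2]]]] := Pcase m.
    apply: (le_trans (H1norm_0 (pt a0) _)).
      by move=> x; rewrite /bad_part P0 indicE memNset// mulr0.
    by rewrite lee_fin mulr_ge0// divr_ge0// ltW.
  have ma := cube_gt0 ht delta_int dy Aa.
  have D20 : 0 < D ^+ 2 by rewrite exprn_gt0.
  (* Removing the mean at most doubles the L1 norm, hence the new height [2 * (K * lam)]. The sup
     bound [K ^+ n.+1 * lam + K * lam] is at most [K ^+ n] times this height, so one round has been
     used up. *)
  have lam'0 : 0 < 2 * (K * lam) by rewrite !mulr_gt0// (lt_le_trans _ K1).
  apply: (le_trans (IH k a (bad_part mu P h m) (2 * (K * lam)) Aa lam'0 _ _ _ _ _)).
  + exact: measurable_bad_part.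
  + by move=> x Qx; rewrite /bad_part PQ indicE memNset// mulr0.
  + apply: filterS hM => x hx; rewrite /bad_part normrM.
    apply: (@le_trans _ _ (`|h x - avg mu P h m|)).
      by rewrite ler_piMr//; exact: normr_indic_le1.
    apply: (le_trans (ler_normB _ _)); apply: (le_trans (lerD hx (avgK m))).
    rewrite -/K; have Kn : K * lam <= K ^+ n.+1 * lam.
      by rewrite ler_pM2r// exprS ler_peMr// exprn_ege1.
    by move: Kn; rewrite exprS; set q := K ^+ n; lra.
  + exact: Int_bad_part.
  + apply: (le_trans (Int_abs_bad_part mP fP m hi)); rewrite PQ.
    by move: le2; rewrite LamK; lra.
  have iQ := isL1_indic (dy_Q_meas dy k a) (mu_cube_lty ht dy Aa).
  have [_ h2i] := h2.
  have i2 := isL1_mul_indic (dy_Q_meas dy k a) h2i.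
  (* The mean of [|h|] on a stopping cube exceeds [Lam]; with [|h| <= h^2 / (2 Lam) + Lam / 2] this
     forces the mean of [h^2] to be at least [Lam ^+ 2]. *)
  have le3 : Lam ^+ 2 * mQ k a <= Int (fun x => h x ^+ 2 * \1_(Q k a) x).
    have : Int (fun x => `|h x| * \1_(Q k a) x) <=
        Int (fun x => (2 * Lam)^-1 * (h x ^+ 2 * \1_(Q k a) x) + (Lam / 2) * \1_(Q k a) x).
      apply: Int_le; [exact/(isL1_mul_indic (dy_Q_meas dy k a))/isL1_abs| |move=> x].
        by apply: isL1D; exact: isL1Z.
      rewrite mulrA -mulrDl ler_wpM2r//.
      rewrite -subr_ge0 -real_normK ?num_real//.
      have -> : (2 * Lam)^-1 * `|h x| ^+ 2 + Lam / 2 - `|h x| =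
        (2 * Lam)^-1 * (`|h x| - Lam) ^+ 2 by field; rewrite gt_eqF.
      by rewrite mulr_ge0 ?sqr_ge0// invr_ge0 mulr_ge0// ltW.
    rewrite IntD ?IntZ//; try exact: isL1Z.
    rewrite Int_indic//; last exact: (mu_cube_lty ht dy); last exact: (dy_Q_meas dy).
    set Iq := Int (fun x => _ ^+ 2 * _) => h3.
    have h4 : Lam * mQ k a <= (2 * Lam)^-1 * Iq + Lam / 2 * mQ k a by exact: le_trans (ltW lt1) h3.
    have h5 : Lam / 2 * mQ k a <= (2 * Lam)^-1 * Iq by lra.
    have := ler_wpM2l (ltW (_ : 0 < 2 * Lam)) h5; rewrite mulr_gt0// => /(_ isT).
    have -> : 2 * Lam * ((2 * Lam)^-1 * Iq) = Iq by field; rewrite gt_eqF.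
    apply: le_trans.
    by rewrite le_eqVlt; apply/orP; left; apply/eqP; field.
  rewrite lee_fin PQ ler_wpM2l//; set J := Int (fun x => h x ^+ 2 * _) in le3 *.
  have le4 : Int (fun x => bad_part mu P h m x ^+ 2) <= J.
    by apply: (le_trans (Int_sqr_bad_part mP fP m h2 hi)); rewrite PQ.
  have J0 : 0 <= J by rewrite /J -PQ.
  set y := J / lam; have yJ : J = y * lam by rewrite /y divfK// gt_eqF.
  have y0 : 0 <= y by rewrite divr_ge0// ltW.
  have le5 : 9 * D ^+ 2 * lam * mQ k a <= y.
    rewrite -(ler_pM2r lam0) -yJ; apply: le_trans le3.
    by rewrite /Lam le_eqVlt; apply/orP; left; apply/eqP; ring.
  have le6 : Int (fun x => bad_part mu P h m x ^+ 2) / (2 * (K * lam)) <= y / 6.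
    rewrite ler_pdivrMr//; apply: (le_trans le4); rewrite yJ /K.
    have -> : y / 6 * (2 * (3 * D ^+ 2 * lam)) = D ^+ 2 * (y * lam) by field.
    by rewrite ler_peMl// mulr_ge0// ltW.
  (* The two terms of the recursive bound are at most [2 / 3] and [1 / 6] of [y]. Their sum stays
     below [y], so the constant [3 * D ^+ 3] reproduces itself at every round. *)
  have -> : 2 * (K * lam) * mQ k a = (2 / 3) * (9 * D ^+ 2 * lam * mQ k a) by rewrite /K; field.
  lra.
- move=> N; rewrite -mulr_sumr ler_wpM2l// -mulr_suml ler_wpM2r ?invr_ge0 ?(ltW lam0)//.
  by apply: (Int_sum_disjoint_le mP dP N); [case: h2|move=> x; exact: sqr_ge0].
Qed.

(** A ball is not a cube, so [h] is first averaged over the cubes of scale comparable to [r] that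
    meet the ball. The averaged function is bounded and lives on [ball x (16 * r)]; each bad part
    lives on one cube and is given to [H1norm_cube] at height [2 * (D * lam)]. *)
Lemma H1norm_ball_L2_const x r h (lam M : R) : 0 < r -> 0 < lam ->
  measurable_fun setT h -> (forall y, ~ ball x r y -> h y = 0) ->
  {ae mu, forall y, `|h y| <= M} -> Int h = 0 ->
  Int (fun y => h y ^+ 2) <= lam ^+ 2 * V x r ->
  (H1 h <= ((D ^+ 2 + 3 * D ^+ 3 * (2 * D ^+ 2 + 1)) * (lam * V x r))%:E)%E.
Proof.
move=> r0 lam0 mh h0 hM Ih h2lam.
have hi : L1 h by exact: (isL1_bounded_supp ht mh h0 hM).
have h2 : L2 h by exact: (isL2_bounded_supp mh h0 hM).
have D3 : 0 <= 3 * D ^+ 3 by rewrite mulr_ge0// exprn_ge0// ltW.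
have [k /andP[kr rk]] := scale_of_radius delta_int r0.
pose S : set nat := [set a | exists y, Q k a y /\ ball x r y].
pose G := gen_cubes A Q k S.
have mG a : measurable (G a) by exact: (measurable_gen_cubes dy).
have dG : trivIset setT G by exact: (trivIset_gen_cubes dy).
have fG a : (mu (G a) < +oo)%E by exact: (mu_gen_cubes_lty ht dy).
have QB a : A k a -> S a -> Q k a `<=` ball x (16 * r).
  move=> Aa [y [Qy By]] z Qz; have h1 := cube_dist ht dy Aa Qy Qz.
  rewrite /dball /= in By *; apply: (le_lt_trans (ht_tri ht x y z)); lra.
(* Points of [ball x r] are within [8 * delta ^ k + 2 * r] of the centre of any selected cube, and
   this is below [16 * delta ^ (k - 1)] by the choice of [k]. *)
have BQ a : A k a -> S a -> V x r <= D * mQ k a.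
  move=> Aa [y [Qy By]]; apply: le_trans (DQ Aa); apply: (Vol_le ht) => z Bz.
  have h1 := cube_dist ht dy Aa (cube_center ht delta_int dy Aa) Qy.
  rewrite /dball /= in By Bz *.
  apply: (le_lt_trans (ht_tri ht _ y z)).
  have := ht_tri ht y x z; rewrite (ht_sym ht y x); lra.
have Ihabs : Int (fun y => `|h y|) <= lam * V x r.
  have [_ h2i] := h2; have iB := isL1_ball ht x r.
  apply: (@le_trans _ _ (Int (fun y => (2 * lam)^-1 * h y ^+ 2 + (lam / 2) * \1_(ball x r) y))).
    apply: Int_le; [exact: isL1_abs|by apply: isL1D; exact: isL1Z|move=> y].
    rewrite indicE; case: (boolP (y \in _)) => [_|/negP yB] /=; last first.
      by rewrite h0 ?normr0 ?expr0n ?mulr0 ?addr0// => /mem_set.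
    rewrite mulr1 -subr_ge0 -(real_normK (num_real (h y))).
    have -> : (2 * lam)^-1 * `|h y| ^+ 2 + lam / 2 - `|h y| =
      (2 * lam)^-1 * (`|h y| - lam) ^+ 2 by field; rewrite gt_eqF.
    by rewrite mulr_ge0 ?sqr_ge0// invr_ge0 mulr_ge0// ltW.
  rewrite IntD ?IntZ ?(Int_ball ht)//; try exact: isL1Z.
  have : (2 * lam)^-1 * Int (fun y => h y ^+ 2) <= (2 * lam)^-1 * (lam ^+ 2 * V x r).
    by rewrite ler_wpM2l// invr_ge0 mulr_ge0// ltW.
  have -> : (2 * lam)^-1 * (lam ^+ 2 * V x r) = lam / 2 * V x r by field; rewrite gt_eqF.
  lra.
have V0 : 0 < V x r by exact: (Vol_gt0 ht).
have Jle a : Int (fun y => `|h y| * \1_(G a) y) <= lam * V x r.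
  apply: le_trans Ihabs; apply: Int_le; [exact/isL1_mul_indic/isL1_abs|exact: isL1_abs|move=> y].
  by rewrite ler_piMr// indicE; case: (_ \in _).
have avgD a : `|avg mu G h a| <= D * lam.
  rewrite /G /gen_cubes; have [AS|AS] := asboolP (A k a /\ S a); last first.
    rewrite /avg /gen_cubes; case: asboolP => // _.
    by rewrite measure0 invr0 mulr0 normr0 mulr_ge0// ltW.
  case: AS => Aa Sa; have ma := cube_gt0 ht delta_int dy Aa.
  have GE : G a = Q k a by exact: gen_cubesE.
  rewrite -/G -(ler_pM2r ma) -{1}GE; apply: (le_trans (avg_abs_le mG fG a hi)).
  apply: (le_trans (Jle a)); rewrite -mulrA mulrCA ler_pM2l//; exact: BQ.
have outG y : (forall a, ~ G a y) -> h y = 0.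
  move=> Gy; apply: h0 => By; have [a Aa Qa] := dy_cover dy k y.
  have Sa : S a by exists y.
  by apply: (Gy a); rewrite /G gen_cubesE.
have supp y : ~ ball x (16 * r) y -> avg_on mu G h y = 0.
  move=> yB; have Gy a : ~ G a y.
    by move=> /gen_cubesP[Aa Sa Qy]; apply: yB; exact: (QB a).
  by rewrite avg_on_out// outG.
have gbound : {ae mu, forall y, `|avg_on mu G h y| <= D * lam}.
  apply: aeW => y; have [[a Ga]|Gy] := pselect (exists a, G a y).
    by rewrite (avg_on_in mu dG h Ga).
  have Gy' a : ~ G a y by move=> Ga; apply: Gy; exists a.
  by rewrite avg_on_out// outG// normr0 mulr_ge0// ltW.
have Dl0 : 0 < D * lam by rewrite mulr_gt0.
(* The number of rounds: powers of [3 * D ^+ 2 >= 2] eventually exceed the sup bound of the bad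
   parts divided by their height. [M] influences only this [n]. *)
have [n nM] : exists n, M + D * lam <= (3 * D ^+ 2) ^+ n * (2 * (D * lam)).
  have M0 : 0 <= M + D * lam \/ M + D * lam < 0.
    by case: (leP 0 (M + D * lam)) => ?; [left|right].
  case: M0 => [M0|M0]; last by exists 0%N; rewrite expr0 mul1r; lra.
  exists (Num.bound ((M + D * lam) / (2 * (D * lam)))).
  rewrite -ler_pdivrMr ?mulr_gt0//; set q := _ / _.
  have q0 : 0 <= q by rewrite divr_ge0// mulr_ge0// ltW.
  apply: (le_trans (ltW (archi_boundP q0))).
  apply: (@le_trans _ _ (2 ^+ Num.bound q)); first by rewrite -natrX ler_nat ltnW// ltn_expl.
  have D2 : 1 <= D ^+ 2 by exact: exprn_ege1.
  by apply: lerXn2r; rewrite ?nnegrE; lra.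
rewrite mulrDl; apply: (H1norm_avg_on mG dG fG
  (s := fun a => 3 * D ^+ 3 * (2 * (D * lam) * fine (mu (G a)) +
      Int (fun y => h y ^+ 2 * \1_(G a) y) / (2 * (D * lam)))) ht hi).
- have mg : measurable_fun setT (avg_on mu G h) by exact: measurable_avg_on.
  have r16 : 0 < 16 * r by rewrite mulr_gt0.
  apply: (le_trans (H1norm_bounded_supp ht r16 (ltW Dl0) mg supp gbound _)).
    by rewrite Int_avg_on.
  rewrite lee_fin; apply: (@le_trans _ _ (D * lam * (D * V x r))).
    by rewrite ler_pM2l//; exact: DV.
  by rewrite le_eqVlt; apply/orP; left; apply/eqP; ring.
- move=> a; have sq : 0 <= Int (fun y => h y ^+ 2 * \1_(G a) y).
    by apply: Int_ge0 => y; rewrite mulr_ge0 ?sqr_ge0.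
  have [[Aa Sa]|AS] := pselect (A k a /\ S a); last first.
    apply: (le_trans (H1norm_0 x _)).
      move=> y; rewrite /bad_part indicE memNset ?mulr0// => /gen_cubesP[Aa Sa _].
      by apply: AS.
    rewrite lee_fin mulr_ge0// addr_ge0//.
      by rewrite mulr_ge0 ?fine_ge0// mulr_ge0// ltW.
    by rewrite divr_ge0// mulr_ge0// ltW.
  have GE : G a = Q k a by exact: gen_cubesE.
  have l0 : 0 < 2 * (D * lam) by rewrite mulr_gt0.
  rewrite GE; apply: (le_trans (H1norm_cube (n := n) Aa l0 _ _ _ _ _)).
  + exact: measurable_bad_part.
  + by move=> y Qy; rewrite /bad_part GE indicE memNset// mulr0.
  + apply: filterS hM => y hy; rewrite /bad_part normrM.
    apply: (@le_trans _ _ (`|h y - avg mu G h a|)).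
      by rewrite ler_piMr//; exact: normr_indic_le1.
    by apply: (le_trans (ler_normB _ _)); apply: (le_trans (lerD hy (avgD a))).
  + exact: Int_bad_part.
  + apply: (le_trans (Int_abs_bad_part mG fG a hi)).
    apply: (@le_trans _ _ (2 * (lam * V x r))); first by rewrite ler_pM2l//; exact: Jle.
    rewrite -!mulrA ler_pM2l// mulrCA ler_pM2l//; exact: BQ.
  rewrite lee_fin ler_wpM2l// lerD2l ler_pM2r ?invr_gt0//.
  by rewrite -GE; exact: Int_sqr_bad_part.
(* The selected cubes are disjoint inside [ball x (16 * r)], whose volume is at most [D * V x r];
   this produces [2 * D ^+ 2]. The L2 terms add at most [lam * V x r / (2 * D)], which is absorbed
   in the summand 1. *)
- move=> N; rewrite -mulr_sumr -[leRHS]mulrA ler_wpM2l// big_split/= -mulr_sumr -mulr_suml.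
  have s1 : \sum_(i < N) fine (mu (G i)) <= D * V x r.
    apply: le_trans (DV x r0); rewrite -(Int_ball ht x (16 * r)).
    have i0 y : 0 <= \1_(ball x (16 * r)) y :> R by [].
    apply: le_trans (Int_sum_disjoint_le mG dG N (isL1_ball ht x (16 * r)) i0).
    apply: ler_sum => i _; rewrite -Int_indic//.
    apply: Int_le; [exact: isL1_indic|apply: isL1_mul_indic => //; exact: isL1_ball|move=> y].
    rewrite [X in _ <= _ * X]indicE indicE; case: (boolP (y \in G i)) => //=; last by rewrite mulr0.
    move=> /set_mem/gen_cubesP[Aa Sa Qy]; rewrite indicE mem_set ?mulr1//; exact: (QB i).
  have s2 : \sum_(i < N) Int (fun y => h y ^+ 2 * \1_(G i) y) <= lam ^+ 2 * V x r.
    apply: le_trans h2lam; apply: (Int_sum_disjoint_le mG dG N).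
      by case: h2.
    by move=> y; exact: sqr_ge0.
  rewrite [leRHS]mulrDl [1 * _]mul1r; apply: lerD.
    apply: (@le_trans _ _ (2 * (D * lam) * (D * V x r))).
      by rewrite ler_wpM2l// mulr_ge0// ltW.
    by rewrite le_eqVlt; apply/orP; left; apply/eqP; ring.
  rewrite ler_pdivrMr ?mulr_gt0//; apply: (le_trans s2).
  have -> : lam * V x r * (2 * (D * lam)) = (2 * D) * (lam ^+ 2 * V x r) by ring.
  apply: ler_peMl; last by have D1' := D1; lra.
  by apply: mulr_ge0; [exact: sqr_ge0|exact: ltW].
Qed.

End calderon_zygmund.

(** * Molecules *)

Section molecules.
Context {R : realType} {dsp : measure_display} {T : measurableType dsp}.
Variables (d : T -> T -> R) (mu : {measure set T -> \bar R}).
Hypothesis ht : homogeneous_type d mu.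
Implicit Types (f g h a : T -> R).
Local Notation Int f := (Rintegral mu setT f).
Local Notation L1 := (isL1 mu).
Local Notation L2 := (isL2 mu).
Local Notation ball := (dball d).
Local Notation V := (Vol d mu).
Local Notation H1 := (H1norm d mu).
Variable D : R.
Hypothesis D1 : 1 <= D.
Hypothesis DV : forall x r, 0 < r -> V x (2 * r) <= D * V x r.

(* With [G l] the mean-zero truncation of [g] to the ball [B l] of radius
   [2 ^+ l * r], [g] is the sum of [G m] and the multiples of atoms
   [G l.+1 - G l] for [l >= m]. *)
Lemma H1norm_annuli g x0 r (E q s : R) m : 0 < r -> 0 <= E -> 0 < q < 1 -> (0 < m)%N ->
  L1 g -> Int g = 0 ->
  (forall l x, (0 < l)%N -> 2 ^+ l * r <= d x0 x < 2 ^+ l.+1 * r ->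
     `|g x| <= E * q ^+ l / V x0 (2 ^+ l * r)) ->
  (H1 (bad_part mu (fun l => ball x0 (2 ^+ l * r)) g m) <= s%:E)%E ->
  (H1 g <= (s + 2 * D ^+ 2 * E * q ^+ m / (1 - q) ^+ 2)%:E)%E.
Proof.
move=> r0 E0 /andP[q0 q1] m0 gi Ig gdec Gm.
have D0 : 0 <= D by exact: le_trans D1.
have q10 : 0 < 1 - q by rewrite subr_gt0.
have mg := isL1_measurable gi.
pose rad l : R := 2 ^+ l * r.
have rad0 l : 0 < rad l by rewrite mulr_gt0// exprn_gt0.
have radS l : rad l.+1 = 2 * rad l by rewrite /rad exprS mulrA.
pose B l := ball x0 (rad l).
have mB l : measurable (B l) by exact: (ht_ball_meas ht).
have fB l : (mu (B l) < +oo)%E by exact: (ht_ball_fin ht).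
pose W l := V x0 (rad l).
have W0 l : 0 < W l by exact: (Vol_gt0 ht).
have WS l : W l.+1 <= D * W l by rewrite /W radS; exact: DV.
have BS l : B l `<=` B l.+1.
  by move=> y; rewrite /B /dball /= radS => /lt_trans; apply; have := rad0 l; lra.
have WS' l : W l <= W l.+1 by apply: (Vol_le ht); exact: BS.
pose G l := bad_part mu B g l.
pose I l := Int (fun x => g x * \1_(B l) x).
have giB l : L1 (fun x => g x * \1_(B l) x) by exact: isL1_mul_indic.
have Gi l : L1 (G l) by exact: isL1_bad_part.
have ann l x : (0 < l)%N -> ~ B l x -> B l.+1 x -> `|g x| <= E * q ^+ l / W l.
  move=> l0 /negP; rewrite /B /dball /= -leNgt => h1 h2; apply: gdec => //.
  by rewrite h1.
have IS l : (0 < l)%N -> `|I l.+1 - I l| <= E * D * q ^+ l.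
  move=> l0; rewrite /I -IntB//; apply: (le_trans (le_abs_Int (isL1B _ _))) => //.
  apply: (@le_trans _ _ (Int (fun x => (E * q ^+ l / W l) * \1_(B l.+1) x))).
    apply: Int_le; [exact/isL1_abs/isL1B|exact/isL1Z/isL1_indic|move=> x].
    rewrite !indicE; case: (pselect (B l x)) => [Bx|Bx].
      rewrite !mem_set//; last exact: BS.
      by rewrite subrr normr0 mulr1 divr_ge0 ?(ltW (W0 l))// mulr_ge0// exprn_ge0// ltW.
    rewrite (memNset Bx) mulr0 subr0; case: (pselect (B l.+1 x)) => [Bx'|Bx'].
      by rewrite mem_set// !mulr1; exact: ann.
    by rewrite memNset// !mulr0 normr0.
  rewrite IntZ; last exact: isL1_indic.
  rewrite Int_indic// -/(V x0 _) -/(W _).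
  have -> : E * D * q ^+ l = E * q ^+ l / W l * (D * W l).
    by field; rewrite gt_eqF.
  by rewrite ler_wpM2l// divr_ge0 ?(ltW (W0 l))// mulr_ge0// exprn_ge0// ltW.
have IB l k : (0 < l)%N -> `|I (l + k)%N - I l| <= E * D / (1 - q) * (q ^+ l - q ^+ (l + k)).
  move=> l0; elim: k => [|k IH]; first by rewrite addn0 !subrr normr0 mulr0.
  rewrite addnS; have -> : I (l + k).+1 - I l = (I (l + k).+1 - I (l + k)%N) + (I (l + k)%N - I l) by ring.
  apply: (le_trans (ler_normD _ _)); apply: (le_trans (lerD (IS _ _) IH)); first by rewrite addn_gt0 l0.
  rewrite le_eqVlt; apply/orP; left; apply/eqP; rewrite exprS.
  by field; rewrite gt_eqF.
have tail : Int (fun x => `|g x - g x * \1_(B l) x|) @[l --> \oo] --> (0 : R).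
  apply: (@Int_dominated_cvg0 _ _ _ mu _ (fun x => `|g x|)).
  - by move=> l; apply: measurable_funB => //; exact: isL1_measurable (giB l).
  - exact: isL1_abs.
  - move=> l x; rewrite indicE; case: (_ \in _); rewrite ?mulr1 ?mulr0 ?subrr ?subr0 ?normr0//.
  - move=> x; apply: cvg_near_cst; near=> l.
    suff : B l x by move=> Bx; rewrite indicE mem_set// mulr1 subrr.
    rewrite /B /dball /= /rad -ltr_pdivrMr//.
    have dr : 0 <= d x0 x / r by rewrite divr_ge0 ?(ht_nonneg ht)// ltW.
    apply: (lt_le_trans (archi_boundP dr)).
    apply: (@le_trans _ _ l%:R).
      by rewrite ler_nat; near: l; exact: nbhs_infty_ge.
    by rewrite -natrX ler_nat ltnW// ltn_expl.
(* Because [Int g = 0], the integrals [I (l + k)] tend to zero, so the geometric control of the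
   increments bounds [I l] itself. *)
have Ibnd l : (0 < l)%N -> `|I l| <= E * D / (1 - q) * q ^+ l.
  move=> l0; apply/ler_addgt0Pr => e e0.
  move/cvgrPdist_lt : tail => /(_ e e0)[k _ /(_ (l + k)%N)]; rewrite /= leq_addl => /(_ isT).
  rewrite sub0r normrN => h1.
  have h2 : `|I (l + k)%N| <= e.
    have -> : I (l + k)%N = - Int (fun x => g x - g x * \1_(B (l + k)%N) x).
      by rewrite IntB// Ig sub0r opprK.
    rewrite normrN; apply: (le_trans (le_abs_Int (isL1B gi (giB _)))).
    exact: le_trans (ler_norm _) (ltW h1).
  have -> : I l = I (l + k)%N - (I (l + k)%N - I l) by ring.
  apply: (le_trans (ler_normB _ _)); rewrite addrC; apply: lerD => //.
  apply: (le_trans (IB l k l0)); rewrite ler_wpM2l ?divr_ge0 ?mulr_ge0 ?(ltW q10)//.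
  by rewrite gerBl exprn_ge0// ltW.
have avgI l : avg mu B g l = I l / W l by [].
(* As [D / (1 - q) >= 1], this dominates both [g] on the annulus and the averages over the two
   balls. *)
pose Z l := E * D / (1 - q) * q ^+ l / W l.
have Z0 l : 0 <= Z l by rewrite /Z !(mulr_ge0, divr_ge0, invr_ge0, exprn_ge0)// ltW.
have avgb l : (0 < l)%N -> `|avg mu B g l| <= Z l.
  move=> l0; rewrite avgI normrM [`|(W l)^-1|]ger0_norm ?invr_ge0 ?(ltW (W0 l))//.
  by rewrite /Z ler_wpM2r ?invr_ge0 ?(ltW (W0 l))//; exact: Ibnd.
have ZS l : Z l.+1 <= Z l.
  rewrite /Z; apply: ler_pM.
  - by rewrite !(mulr_ge0, divr_ge0, invr_ge0, exprn_ge0)// ltW.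
  - by rewrite invr_ge0 ltW.
  - by rewrite ler_wpM2l ?divr_ge0 ?mulr_ge0 ?(ltW q10)// exprS ler_piMl ?exprn_ge0 ?(ltW q0) ?(ltW q1).
  - by rewrite lef_pV2 ?posrE.
have annZ l x : (0 < l)%N -> ~ B l x -> B l.+1 x -> `|g x| <= Z l.
  move=> l0 h1 h2; apply: (le_trans (ann l x l0 h1 h2)); rewrite /Z ler_wpM2r ?invr_ge0 ?(ltW (W0 l))//.
  rewrite ler_wpM2r ?exprn_ge0 ?(ltW q0)// -mulrA ler_peMr//.
  by rewrite ler_pdivlMr// mul1r; have := D1; lra.
have diffH l : (0 < l)%N -> (H1 (fun x => G l.+1 x - G l x)%R <= (2 * Z l * (D * W l))%:E)%E.
  move=> l0; apply: (@le_trans _ _ (2 * Z l * W l.+1)%:E); last first.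
    by rewrite lee_fin ler_wpM2l// mulr_ge0.
  apply: (H1norm_bounded_supp ht).
  - exact: rad0.
  - by rewrite mulr_ge0.
  - exact: isL1_measurable (isL1B (Gi _) (Gi _)).
  - move=> y yB; rewrite /G /bad_part !indicE !memNset// ?mulr0 ?subrr//.
    by move=> By; apply: yB; exact: BS.
  - apply: aeW => y; rewrite /G /bad_part !indicE.
    have a1 := avgb l l0; have a2 := le_trans (avgb l.+1 (ltn0Sn l)) (ZS l).
    case: (pselect (B l y)) => [By|By].
      rewrite !mem_set//; last exact: BS.
      rewrite !mulr1 (_ : _ - _ - _ = avg mu B g l - avg mu B g l.+1); last by ring.
      by rewrite (le_trans (ler_normB _ _))//; lra.
    rewrite (memNset By) mulr0 subr0; case: (pselect (B l.+1 y)) => [By'|By'].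
      rewrite mem_set// mulr1 (le_trans (ler_normB _ _))//.
      by have := annZ l y l0 By By'; lra.
    by rewrite memNset// mulr0 normr0 mulr_ge0.
  - by rewrite IntB// !Int_bad_part// subrr.
have -> : g = (fun x => G m x + (g x - G m x)) by apply/funext => x; ring.
have gG : L1 (fun x => g x - G m x) by exact: isL1B.
apply: (H1normD ht) => //.
apply: (H1norm_series ht (G := fun n x => G (m + n).+1 x - G (m + n)%N x)
  (s := fun n => 2 * Z (m + n)%N * (D * W (m + n)%N)) gG).
- by move=> n; exact: isL1B.
- by move=> n; apply: diffH; rewrite addn_gt0 m0.
(* The volumes cancel, so what is left to sum is a pure geometric series in [q]. *)
- move=> N; have ZW n : 2 * Z n * (D * W n) = 2 * D ^+ 2 * E / (1 - q) * q ^+ n.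
    by rewrite /Z; field; rewrite !gt_eqF.
  under eq_bigr do rewrite ZW.
  rewrite -mulr_sumr; have -> : \sum_(i < N) q ^+ (m + i) = (q ^+ m - q ^+ (m + N)) / (1 - q).
    elim: N => [|N IHN]; first by rewrite big_ord0 addn0 subrr mul0r.
    by rewrite big_ord_recr/= IHN addnS exprS; field; rewrite gt_eqF.
  have -> : 2 * D ^+ 2 * E * q ^+ m / (1 - q) ^+ 2 =
    2 * D ^+ 2 * E / (1 - q) * (q ^+ m / (1 - q)) by field; rewrite gt_eqF.
  rewrite ler_wpM2l ?divr_ge0 ?mulr_ge0 ?sqr_ge0 ?(ltW q10)//.
  by rewrite ler_wpM2r ?invr_ge0 ?(ltW q10)// gerBl exprn_ge0// ltW.
(* The remainder is [g - G (m + N)]: the tail of [g] off the ball, plus a constant on the ball whose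
   L1 norm is [|I (m + N)|], again at most the tail. *)
- have telG N x : g x - G m x - \sum_(n < N) (G (m + n).+1 x - G (m + n)%N x) = g x - G (m + N)%N x.
    elim: N => [|N IHN]; first by rewrite big_ord0 addn0 subr0.
    by rewrite big_ord_recr/= opprD addrA IHN addnS; ring.
  under eq_fun do under eq_Rintegral do rewrite telG.
  apply/cvgrPdist_le => e e0; have e2 : 0 < e / 2 by rewrite divr_gt0.
  move/cvgrPdist_le : tail => /(_ _ e2)[k _ kP].
  exists k => // N /= kN.
  have /kP : (k <= m + N)%N by apply: leq_trans kN _; exact: leq_addl.
  rewrite /= !sub0r !normrN => h1.
  have {}h1 := le_trans (ler_norm _) h1.
  rewrite ger0_norm; last exact: Int_ge0.
  have IM : `|I (m + N)%N| <= e / 2.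
    have -> : I (m + N)%N = - Int (fun x => g x - g x * \1_(B (m + N)%N) x).
      by rewrite IntB// Ig sub0r opprK.
    by rewrite normrN; apply: (le_trans (le_abs_Int (isL1B gi (giB _)))).
  have i1 := isL1_abs (isL1B gi (giB (m + N)%N)).
  have i2 := isL1Z `|avg mu B g (m + N)| (isL1_indic (mB (m + N)%N) (fB (m + N)%N)).
  apply: (@le_trans _ _ (Int (fun x => `|g x - g x * \1_(B (m + N)%N) x| +
      `|avg mu B g (m + N)| * \1_(B (m + N)%N) x))).
    apply: Int_le; [exact/isL1_abs/isL1B|exact: isL1D|move=> x].
    rewrite /G /bad_part (_ : g x - _ = (g x - g x * \1_(B (m + N)%N) x) +
       avg mu B g (m + N) * \1_(B (m + N)%N) x); last by ring.
    by rewrite (le_trans (ler_normD _ _))// lerD2l normrM [`|\1_ _ x|]ger0_norm.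
  rewrite IntD// IntZ; last exact: isL1_indic.
  rewrite Int_indic// -/(V x0 _) -/(W _) avgI normrM.
  rewrite [`|(W _)^-1|]ger0_norm ?invr_ge0 ?(ltW (W0 _))// divfK ?gt_eqF//; lra.
Unshelve. all: by end_near. Qed.

Variable A1 : R.
Hypothesis HB : forall x r h (lam M : R), 0 < r -> 0 < lam ->
  measurable_fun setT h -> (forall y, ~ ball x r y -> h y = 0) ->
  {ae mu, forall y, `|h y| <= M} -> Int h = 0 ->
  Int (fun y => h y ^+ 2) <= lam ^+ 2 * V x r ->
  (H1 h <= (A1 * (lam * V x r))%:E)%E.

(** The recentred truncation at radius [2 ^+ m * r] satisfies the assumptions of [HB], since
    removing the mean does not increase the L2 norm. [M] only certifies boundedness and is absent
    from the bound. *)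
Lemma H1norm_molecule g x0 r (E q lam M : R) m : 0 < r -> 0 <= E -> 0 < q < 1 -> (0 < m)%N ->
  0 < lam -> L1 g -> L2 g -> {ae mu, forall y, `|g y| <= M} -> Int g = 0 ->
  (forall l x, (0 < l)%N -> 2 ^+ l * r <= d x0 x < 2 ^+ l.+1 * r ->
     `|g x| <= E * q ^+ l / V x0 (2 ^+ l * r)) ->
  Int (fun y => g y ^+ 2) <= lam ^+ 2 * V x0 (2 ^+ m * r) ->
  (H1 g <= (A1 * (lam * V x0 (2 ^+ m * r)) +
     2 * D ^+ 2 * E * q ^+ m / (1 - q) ^+ 2)%:E)%E.
Proof.
move=> r0 E0 q01 m0 lam0 gi g2 gM Ig gdec gl.
pose B l := ball x0 (2 ^+ l * r).
have mB l : measurable (B l) by exact: (ht_ball_meas ht).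
have fB l : (mu (B l) < +oo)%E by exact: (ht_ball_fin ht).
have rm : 0 < 2 ^+ m * r by rewrite mulr_gt0// exprn_gt0.
apply: (H1norm_annuli r0 E0 q01 m0 gi Ig gdec).
apply: (HB (M := M + `|avg mu B g m|) rm lam0).
- by apply: measurable_bad_part => //; exact: isL1_measurable gi.
- by move=> y yB; rewrite /bad_part indicE memNset// mulr0.
- apply: filterS gM => y gy; rewrite /bad_part normrM.
  apply: (@le_trans _ _ (`|g y - avg mu B g m|)).
    by rewrite ler_piMr//; exact: normr_indic_le1.
  by rewrite (le_trans (ler_normB _ _))// lerD2r.
- exact: (Int_bad_part mB fB).
- apply: le_trans gl; apply: (le_trans (Int_sqr_bad_part mB fB m g2 gi)).
  have [_ g2i] := g2.
  apply: Int_le => //; first exact: isL1_mul_indic.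
  by move=> y; rewrite ler_piMr ?sqr_ge0// indicE; case: (_ \in _).
Qed.

End molecules.

Lemma cvge0P (R : realType) (u : nat -> \bar R) : (forall n, (0 <= u n)%E) ->
  (u n @[n --> \oo] --> 0%E) <->
  (forall e : R, 0 < e -> exists N0, forall N, (N0 <= N)%N -> (u N <= e%:E)%E).
Proof.
move=> u0; split => [/fine_cvgP[[N1 _ N1P]] /cvgrPdist_le h e e0|h].
  have [N2 _ N2P] := h e e0; exists (maxn N1 N2) => N; rewrite geq_max => /andP[h1 h2].
  have := N2P N h2; rewrite /= sub0r normrN => /(le_trans (ler_norm _)).
  by rewrite -lee_fin fineK//; exact: N1P.
have fin N (e : R) : (u N <= e%:E)%E -> u N \is a fin_num.
  by move=> uNe; rewrite ge0_fin_numE// (le_lt_trans uNe)// ltry.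
apply/fine_cvgP; split.
  by have [N0 N0P] := h 1 ltr01; exists N0 => // N /= /N0P; exact: fin.
apply/cvgrPdist_le => e e0; have [N0 N0P] := h e e0; exists N0 => // N /= /N0P uN.
rewrite sub0r normrN ger0_norm ?fine_ge0//.
by rewrite -lee_fin fineK//; exact: fin uN.
Qed.

Section H1_scaling.
Context {R : realType} {dsp : measure_display} {T : measurableType dsp}.
Variables (d : T -> T -> R) (mu : {measure set T -> \bar R}).
Local Notation Int f := (Rintegral mu setT f).
Local Notation H1 := (H1norm d mu).

Lemma H1normZ (g : T -> R) (c s : R) : isL1 mu g -> (H1 g <= s%:E)%E ->
  (H1 (fun x => c * g x)%R <= (`|c| * s)%:E)%E.
Proof.
move=> gi gs; apply/lee_addgt0Pr => e e0.
(* Dividing by [|c| + 1] instead of [|c|] includes the case [c = 0]. *)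
have c1 : 0 < `|c| + 1 by rewrite ltr_wpDl.
have [|lam [a [aa ls ga]]] := @H1norm_lt_decomp _ _ _ d mu g (s + e / (`|c| + 1)) gi.
  by rewrite (le_lt_trans gs)// lte_fin ltrDl divr_gt0.
apply: (@H1norm_le_decomp _ _ _ d mu _ (fun j => c * lam j) a); [exact: isL1Z|by []| |].
- move=> n; under eq_bigr do rewrite normrM.
  rewrite -mulr_sumr; apply: (@le_trans _ _ (`|c| * (s + e / (`|c| + 1)))).
    by rewrite ler_wpM2l.
  rewrite mulrDr lerD2l mulrCA ler_piMr ?(ltW e0)// ler_pdivrMr// mul1r lerDl//.
- have E n : Int (fun x => `|c * g x - \sum_(j < n) c * lam j * a j x|) =
      `|c| * Int (fun x => `|g x - \sum_(j < n) lam j * a j x|).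
    rewrite -IntZ; last by apply/isL1_abs/isL1B => //; exact: isL1_atom_comb.
    apply: eq_Int => x; rewrite -normrM mulrBr mulr_sumr; congr `|_ - _|.
    by apply: eq_bigr => j _; rewrite mulrA.
  under eq_fun do rewrite E.
  suff: `|c| * Int (fun x => `|g x - \sum_(j < n) lam j * a j x|) @[n --> \oo] --> (`|c| * 0 : R).
    by rewrite mulr0.
  by apply: cvgM => //; exact: cvg_cst.
Qed.

End H1_scaling.

(** * Wavelet expansions *)

Section wavelets.
Context {R : realType} {dsp : measure_display} {T : measurableType dsp}.
Variables (d : T -> T -> R) (mu : {measure set T -> \bar R}).
Hypothesis ht : homogeneous_type d mu.
Hypothesis unbounded : forall M : R, exists x y, M < d x y.
Implicit Types (f g h a w : T -> R).
Local Notation Int f := (Rintegral mu setT f).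
Local Notation L1 := (isL1 mu).
Local Notation L2 := (isL2 mu).
Local Notation ball := (dball d).
Local Notation V := (Vol d mu).
Local Notation H1 := (H1norm d mu).
Variables (delta : R) (A : int -> set nat) (pt : nat -> T) (Q : int -> nat -> set T).
Hypothesis delta_int : 0 < delta <= 1 / 1000.
Hypothesis dy : dyadic_system d delta A pt Q.
Variable psi : int * nat * nat -> T -> R.
Hypothesis wv : AH_wavelets d mu delta A pt Q psi.
Local Notation I := (Iset A Q).

(** If a centre [b] disappears when passing to generation [l], its parent cube, centred at some [a],
    contains the two cubes labelled [a] and [b] of the next generation, which creates the index
    [(l, a, b)]. *)
Lemma coarse_stable k : (forall t, I t -> k <= t.1.1) ->
  forall j : nat, A k `<=` A (k - j%:Z).
Proof.
move=> kI; elim => [|j IH]; first by rewrite subr0.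
move=> b /IH Ab; apply: contrapT => nAb.
set l := k - j.+1%:Z in nAb; have lE : k - j%:Z = l + 1 by rewrite /l -addn1 PoszD; ring.
rewrite lE in Ab.
have [a] := cube_parent ht delta_int dy Ab; rewrite addrK => Aa ba.
have Aa' : A (l + 1) a by exact: (dy_nest dy).
have ab : a <> b by move=> E; apply: nAb; rewrite -E.
have aa : Q (l + 1) a `<=` Q l a.
  have [|//|Q0] := dy_nested dy (_ : l <= l + 1) Aa Aa'; first by rewrite lerDl.
  exfalso; suff : set0 (pt a) by [].
  by rewrite -Q0; split; exact: (cube_center ht delta_int dy).
have /kI /= : I (l, a, b).
  split => //=; split; last by split => //; exact: nesym.
  by exists a, b; split; [split|split; [split|]].
by rewrite /l leNgt ltrBlDr ltrDl.
Qed.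

(* If the index set were finite, all coarse generations would have the same
   centres, hence a single cube, and the space would be bounded. *)
Lemma infinite_Iset : ~ finite_set I.
Proof.
move=> /finite_seqP[s Is].
pose k : int := - (\max_(t <- s) `|t.1.1|%N)%:Z.
have kI t : I t -> k <= t.1.1.
  rewrite Is /= => ts; rewrite /k lerNl.
  have := @leq_bigmax_seq _ s xpredT (fun t : int * nat * nat => `|t.1.1|%N) t ts isT.
  rewrite -lez_nat; apply: le_trans.
  by rewrite abszE (le_trans (ler_norm _))// normrN.
have Ak := coarse_stable kI.
have uniqA (a b : nat) : A k a -> A k b -> a = b.
  move=> Aa Ab; apply: contrapT => ab.
  (* Both labels survive in every coarser generation, and the separation required there grows
     without bound. *)
  have dab j : delta ^ (k - j%:Z) <= d (pt a) (pt b) by apply: (dy_sep dy) => //; exact: Ak.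
  have dpos : 0 < d (pt a) (pt b) by exact: lt_le_trans (delta_pow_gt0 delta_int _) (dab 0%N).
  have kpos := delta_pow_gt0 delta_int k.
  have [j jP] : exists j : nat, delta ^+ j < delta ^ k / d (pt a) (pt b).
    by apply: (delta_pow_small delta_int); rewrite divr_gt0.
  have d0 : 0 < delta by case/andP : delta_int.
  have := dab j; rewrite expfzDr ?gt_eqF// -exprnN ler_pdivrMr ?exprn_gt0//.
  by move: jP; rewrite ltr_pdivlMr// mulrC => /lt_le_trans h /h; rewrite ltxx.
have [x [y]] := unbounded (8 * delta ^ k).
have [a Aa Qx] := dy_cover dy k x; have [b Ab Qy] := dy_cover dy k y.
rewrite (uniqA b a Ab Aa) in Qy; have := cube_dist ht dy Aa Qx Qy.
by move=> /lt_trans h /h; rewrite ltxx.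
Qed.

Lemma enumeration_Iset : exists sigma : nat -> int * nat * nat, set_bij setT I sigma.
Proof.
have := eq_card_nat (countableP I) infinite_Iset.
move=> /card_set_bijP[g [_ gI gS]].
have /choice[sigma sP] : forall n, exists t, I t /\ g t = n.
  by move=> n; have [t It gt] := gS n Logic.I; exists t.
exists sigma; split.
- by move=> n _; case: (sP n).
- by move=> n m _ _ nm; have [_ <-] := sP n; have [_ <-] := sP m; rewrite nm.
- move=> t It; exists (g t) => //; have [Is gs] := sP (g t).
  by apply: gI; rewrite ?inE.
Qed.

Lemma psi_bounded i : I i -> exists M, forall x, `|psi i x| <= M.
Proof.
move=> Ii; have [eta [nu [C [_ nu0 C0 size _]]]] := wv_size_reg wv.
exists (C / Num.sqrt (V (pt i.2) (delta ^ i.1.1))) => x.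
apply: (le_trans (size i x Ii)); rewrite ler_piMr ?divr_ge0 ?sqrtr_ge0 ?(ltW C0)//.
rewrite -expR0 ler_expR mulNr mulNr oppr_le0.
by rewrite !mulr_ge0 ?(ltW nu0) ?(ht_nonneg ht)// ltW// delta_pow_gt0.
Qed.

(* [+oo - +oo = -oo] in [\bar R], so a vanishing integral forces integrability. *)
Lemma psi_L1 i : I i -> L1 (psi i).
Proof.
move=> Ii; have mi : measurable_fun setT (EFin \o psi i).
  by apply/measurable_EFinP; exact: (wv_meas wv).
apply/integrableP; split => //; apply/(abse_integralP mu measurableT mi).
by rewrite -[X in `|X|%E]/(\int[mu]_x (psi i x)%:E)%E (wv_cancel wv Ii) abse0.
Qed.

Lemma psi_L2 i : I i -> L2 (psi i).
Proof. by move=> Ii; split; [exact: (wv_meas wv)|exact: (wv_L2 wv Ii)]. Qed.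

Lemma Int_psi i : I i -> Int (psi i) = 0.
Proof. by move=> Ii; rewrite /Rintegral (wv_cancel wv Ii). Qed.

Definition unif_cont w := forall eta : R, 0 < eta -> exists2 rho : R, 0 < rho &
  forall x y, d x y < rho -> `|w x - w y| <= eta.

Lemma unif_cont_psi i : I i -> unif_cont (psi i).
Proof.
move=> Ii e e0; have [eta [nu [C [/andP[eta0 _] nu0 C0 _ reg]]]] := wv_size_reg wv.
set M := C / Num.sqrt (V (pt i.2) (delta ^ i.1.1)).
have M0 : 0 <= M by rewrite divr_ge0 ?sqrtr_ge0 ?(ltW C0).
have kpos := delta_pow_gt0 delta_int i.1.1.
have M1 : 0 < M + 1 by rewrite ltr_wpDl.
pose t := Num.min 1 ((e / (M + 1)) `^ eta^-1).
have t0 : 0 < t by rewrite lt_min ltr01/= powR_gt0// divr_gt0.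
exists (t * delta ^ i.1.1); first by rewrite mulr_gt0.
move=> x y dxy.
have dk : d x y <= delta ^ i.1.1.
  by apply: (le_trans (ltW dxy)); rewrite ler_piMl ?(ltW kpos)// ge_min lexx.
apply: (le_trans (reg i x y Ii dk)); rewrite -/M.
apply: (@le_trans _ _ (M * (d x y / delta ^ i.1.1) `^ eta)).
  apply: ler_piMr; first by rewrite mulr_ge0 ?powR_ge0.
  rewrite -expR0 ler_expR mulNr mulNr oppr_le0.
  by rewrite !mulr_ge0 ?(ltW nu0) ?(ht_nonneg ht)// ltW// delta_pow_gt0.
apply: (@le_trans _ _ (M * (e / (M + 1)))); last first.
  by rewrite mulrCA ler_piMr ?(ltW e0)// ler_pdivrMr// mul1r lerDl.
rewrite ler_wpM2l//.
have e1 : 0 <= e / (M + 1) by rewrite divr_ge0// ltW.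
have -> : e / (M + 1) = ((e / (M + 1)) `^ eta^-1) `^ eta.
  by rewrite -powRrM mulVf ?gt_eqF// powRr1.
apply: (ge0_ler_powR (ltW eta0)); rewrite ?nnegrE ?powR_ge0//.
  by rewrite divr_ge0 ?(ht_nonneg ht)// ltW.
rewrite ler_pdivrMr//; apply: (le_trans (ltW dxy)).
by rewrite ler_wpM2r ?(ltW kpos)// ge_min lexx orbT.
Qed.

Lemma unif_cont_comb (s : seq nat) (c : nat -> R) (F : nat -> T -> R) :
  (forall n, unif_cont (F n)) -> unif_cont (fun x => \sum_(n <- s) c n * F n x).
Proof.
move=> uF; elim: s => [|n s IH] e e0.
  by exists 1 => // x y _; rewrite !big_nil subrr normr0 ltW.
have e2 : 0 < e / 2 by rewrite divr_gt0.
have c1 : 0 < `|c n| + 1 by rewrite ltr_wpDl.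
have [r1 r10 h1] := IH _ e2.
have [|r2 r20 h2] := uF n (e / 2 / (`|c n| + 1)); first by rewrite divr_gt0.
exists (Num.min r1 r2); first by rewrite lt_min r10 r20.
move=> x y; rewrite lt_min => /andP[/h1 k1 /h2 k2].
rewrite !big_cons (_ : _ + _ - _ = c n * (F n x - F n y) +
   (\sum_(m <- s) c m * F m x - \sum_(m <- s) c m * F m y)); last by ring.
rewrite (le_trans (ler_normD _ _))// (_ : e = e / 2 + e / 2); last by field.
apply: lerD => //; rewrite normrM.
apply: (@le_trans _ _ (`|c n| * (e / 2 / (`|c n| + 1)))); first by rewrite ler_wpM2l.
by rewrite mulrCA ler_piMr ?(ltW e2)// ler_pdivrMr// mul1r lerDl.
Qed.

Variable sigma : nat -> int * nat * nat.
Hypothesis sigma_bij : set_bij setT I sigma.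
Let phi n := psi (sigma n).

Let sI n : I (sigma n).
Proof. by have [h _ _] := sigma_bij; exact: h. Qed.

Let s_inj n m : sigma n = sigma m -> n = m.
Proof. by have [_ h _] := sigma_bij; apply: h; rewrite inE. Qed.

Let phi2 n : L2 (phi n). Proof. exact: psi_L2. Qed.

Let phi1 n : L1 (phi n). Proof. exact: psi_L1. Qed.

Lemma phi_orth n m : Int (fun x => phi n x * phi m x) = (n == m)%:R.
Proof.
rewrite /Rintegral (wv_orthonormal wv (sI n) (sI m)) /=.
by case: eqP => [/s_inj ->|h]; rewrite ?eqxx//; case: eqP => // nm; case: h; rewrite nm.
Qed.

Lemma phi_complete f : L2 f -> (forall n, Int (fun x => f x * phi n x) = 0) ->
  {ae mu, forall x, f x = 0}.
Proof.
move=> f2 f0; have [mf fi] := f2; apply: (wv_complete wv mf fi) => i Ii.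
have [_ _ /(_ i Ii)[n _ ni]] := sigma_bij; rewrite -ni.
by rewrite (IntE (isL2_mul f2 (phi2 n))) f0.
Qed.

(** Discharges the hypothesis [dense] carried by the differentiation and stopping lemmas. *)
Lemma wavelets_dense u : L2 u -> forall e : R, 0 < e -> exists w, [/\ L2 w,
  (forall eta, 0 < eta -> exists2 rho, 0 < rho &
     forall x y, d x y < rho -> `|w x - w y| <= eta) &
  Int (fun x => (u x - w x) ^+ 2) <= e].
Proof.
move=> u2 e e0; have [N NP] := psum_cvg phi2 phi_orth phi_complete u2 e0.
exists (psum mu phi u N); split; [exact: psum_L2| |exact: NP].
have := @unif_cont_comb (iota 0 N) (fun n => Int (fun x => u x * phi n x)) phi.
move=> /(_ (fun n => unif_cont_psi (sI n))); rewrite /unif_cont /psum => h eta eta0.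
have [rho rho0 hr] := h eta eta0; exists rho => // x y /hr.
have E z : \sum_(n <- iota 0 N) Int (fun x => u x * phi n x) * phi n z =
  \sum_(n < N) Int (fun x => u x * phi n x) * phi n z.
  by rewrite -(big_mkord xpredT (fun n => Int (fun x => u x * phi n x) * phi n z)) /index_iota subn0.
by rewrite !E.
Qed.

Lemma psum_L1 u N : L1 (psum mu phi u N).
Proof. by apply: isL1_sum => n; exact: isL1Z. Qed.

Lemma Int_psum u N : Int (psum mu phi u N) = 0.
Proof.
rewrite /psum (Int_sum (index_enum 'I_N) (F := fun n x => Int (fun x => u x * phi n x) * phi n x)); last by move=> n; exact: isL1Z.
by rewrite big1// => n _; rewrite IntZ// Int_psi ?mulr0.
Qed.

Lemma isL1_mul_phi h n : L1 h -> L1 (fun x => h x * phi n x).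
Proof.
move=> hi; have [M MP] := psi_bounded (sI n).
by apply: (isL1_mulb (M := M)) => //; exact: (wv_meas wv).
Qed.

(* Since [a] has integral zero, the kernel [K x y] may be replaced by
   [K x y - K x x0]. *)
Lemma psum_atom_decay a x0 r (eps Ck : R) N : 0 < eps -> 0 < Ck ->
  (forall (s : seq (int * nat * nat)) (sgn : int * nat * nat -> R),
     uniq s -> (forall i, i \in s -> I i) -> (forall i, sgn i = 1 \/ sgn i = -1) ->
     CZ_kernel d mu eps Ck (fun x y => \sum_(i <- s) sgn i * psi i x * psi i y)) ->
  0 < r -> L1 a -> (forall y, ~ ball x0 r y -> a y = 0) -> Int a = 0 ->
  Int (fun y => `|a y|) <= 1 ->
  forall l x, (0 < l)%N -> 2 ^+ l * r <= d x0 x < 2 ^+ l.+1 * r ->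
    `|a x - psum mu phi a N x| <= Ck * (2^-1 `^ eps) ^+ l / V x0 (2 ^+ l * r).
Proof.
move=> eps0 Ck0 CZ r0 ai a0 Ia Ia1 l x l0 /andP[lx _].
(* With all signs equal to 1 this is the kernel of the projection [psum]. *)
pose K x y := \sum_(i <- map sigma (iota 0 N)) (fun=> 1) i * psi i x * psi i y.
have [_ Kreg] : CZ_kernel d mu eps Ck K.
  apply: CZ.
  - by rewrite map_inj_uniq ?iota_uniq// => n m; exact: s_inj.
  - by move=> i /mapP[n _ ->]; exact: sI.
  - by move=> _; left.
have KE y z : K y z = \sum_(n < N) phi n y * phi n z.
  rewrite /K big_map -(big_mkord xpredT (fun n => phi n y * phi n z)) /index_iota subn0.
  by apply: eq_bigr => n _; rewrite mul1r.
have pow_gt0 : 0 < 2 ^+ l :> R by rewrite exprn_gt0.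
have lr0 : 0 < 2 ^+ l * r by rewrite mulr_gt0.
have dx0 : 0 < d x0 x by exact: lt_le_trans lx.
have l2 : 2 <= 2 ^+ l :> R.
  by rewrite -[leLHS]expr1 ler_eXn2l// ltr1n.
have r2 : 2 * r <= d x0 x by apply: le_trans lx; rewrite ler_pM2r.
have xN : ~ ball x0 r x by rewrite /dball /=; apply/negP; rewrite -leNgt; lra.
have x0x : x0 <> x by move=> E; move: dx0; rewrite E ((ht_sep ht x x).2 erefl) ltxx.
rewrite a0// sub0r normrN.
have aK z : L1 (fun y => a y * K x z) by under eq_fun do rewrite mulrC; exact: isL1Z.
have pE : psum mu phi a N x = Int (fun y => a y * (K x y - K x x0)).
  rewrite (@eq_Int _ _ _ mu _ (fun y => a y * K x y - K x x0 * a y)); last by move=> y; ring.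
  have i1 : L1 (fun y => a y * K x y).
    apply: (@isL1_ext _ _ _ mu (fun y => \sum_(n < N) phi n x * (a y * phi n y))).
      by move=> y; rewrite KE mulr_sumr; apply: eq_bigr => n _; ring.
    by apply: isL1_sum => n; apply/isL1Z/isL1_mul_phi.
  rewrite IntB//; last exact: isL1Z.
  rewrite IntZ// Ia mulr0 subr0.
  rewrite (@eq_Int _ _ _ mu _ (fun y => \sum_(n < N) phi n x * (a y * phi n y))); last first.
    by move=> y; rewrite KE mulr_sumr; apply: eq_bigr => n _; ring.
  rewrite Int_sum; last by move=> n; apply/isL1Z/isL1_mul_phi.
  rewrite /psum; apply: eq_bigr => n _.
  by rewrite [RHS](IntZ (phi n x) (isL1_mul_phi n ai)) [RHS]mulrC.
set Z := Ck * _ / _.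
have Z0 : 0 <= Z.
  by rewrite /Z divr_ge0 ?Vol_ge0// mulr_ge0 ?(ltW Ck0)// exprn_ge0// powR_ge0.
(* The second summand of the regularity estimate is the one needed, with [x0] moved to [y]. It
   applies since [l >= 1] gives [d x0 y <= d x0 x / 2], and the ratio of distances is at most
   [2 ^- l]. *)
have kb y : ball x0 r y -> `|K x y - K x x0| <= Z.
  rewrite /dball /= => y0.
  have := Kreg x0 y x x0x; have yh : d x0 y <= d x0 x / 2 by rewrite ler_pdivlMr//; lra.
  move=> /(_ yh); rewrite distrC => h.
  apply: (@le_trans _ _ (`|K x0 x - K y x| + `|K x x0 - K x y|)).
    by rewrite [`|K x y - _|]distrC lerDr.
  rewrite [`|K x0 x - _|]distrC; apply: (le_trans h); rewrite /Z.
  have pw : (d x0 y / d x0 x) `^ eps <= (2^-1 `^ eps) ^+ l.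
    have -> : (2^-1 `^ eps) ^+ l = (2^-1 ^+ l) `^ eps.
      by rewrite -powR_mulrn ?powR_ge0// -powRrM mulrC powRrM powR_mulrn// invr_ge0.
    apply: (ge0_ler_powR (ltW eps0)); rewrite ?nnegrE.
    - by rewrite divr_ge0 ?(ht_nonneg ht).
    - by rewrite exprn_ge0// invr_ge0.
    - rewrite ler_pdivrMr// exprVn mulrC ler_pdivlMr//.
      by apply: le_trans lx; rewrite mulrC ler_pM2l// ltW.
  apply: ler_pM.
  - by rewrite mulr_ge0 ?(ltW Ck0)// powR_ge0.
  - by rewrite invr_ge0 Vol_ge0.
  - by rewrite ler_pM2l.
  - rewrite lef_pV2 ?posrE; [|exact: (Vol_gt0 ht)|exact: (Vol_gt0 ht)].
    exact: (Vol_mono ht).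
have i2 : L1 (fun y => a y * (K x y - K x x0)).
  apply: (@isL1_ext _ _ _ mu (fun y => \sum_(n < N) phi n x * (a y * phi n y) - K x x0 * a y)).
    by move=> y; rewrite mulrBr (KE x y) mulr_sumr; congr (_ - _);
      [apply: eq_bigr => n _; ring|rewrite mulrC].
  by apply: isL1B; [apply: isL1_sum => n; apply/isL1Z/isL1_mul_phi|exact: isL1Z].
rewrite pE; apply: (le_trans (le_abs_Int i2)).
apply: (@le_trans _ _ (Int (fun y => Z * `|a y|))).
  apply: Int_le; [exact: isL1_abs|exact/isL1Z/isL1_abs|move=> y].
  rewrite normrM mulrC; case: (pselect (ball x0 r y)) => [By|By].
    by rewrite ler_wpM2r//; exact: kb.
  by rewrite a0// normr0 !mulr0.
rewrite IntZ; last exact: isL1_abs.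
by rewrite ler_piMr.
Qed.

(** Both claims come from the molecule estimate [main], with different cut-off radii: [m = 1] yields
    the uniform bound, a large [m] the convergence. *)
Lemma H1norm_atom_psum : exists2 U : R, 0 <= U &
  (forall a N, atom d mu a -> (H1 (fun x => a x - psum mu phi a N x)%R <= U%:E)%E) /\
  (forall a (e : R), atom d mu a -> 0 < e -> exists N0, forall N, (N0 <= N)%N ->
     (H1 (fun x => a x - psum mu phi a N x)%R <= e%:E)%E).
Proof.
have [D D1 [DQ DV]] := cube_constant ht delta_int dy.
have D0 : 0 < D by exact: lt_le_trans D1.
pose A1 := D ^+ 2 + 3 * D ^+ 3 * (2 * D ^+ 2 + 1).
have A10 : 0 <= A1.
  by rewrite /A1 !(addr_ge0, mulr_ge0, exprn_ge0)// ltW.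
have HB x r h (lam M : R) : 0 < r -> 0 < lam ->
  measurable_fun setT h -> (forall y, ~ ball x r y -> h y = 0) ->
  {ae mu, forall y, `|h y| <= M} -> Int h = 0 ->
  Int (fun y => h y ^+ 2) <= lam ^+ 2 * V x r ->
  (H1 h <= (A1 * (lam * V x r))%:E)%E.
  exact: (H1norm_ball_L2_const ht delta_int dy wavelets_dense D1 DQ DV).
have DV2 x r : 0 < r -> V x (2 * r) <= D * V x r.
  move=> r0; apply: le_trans (DV x r r0); apply: (Vol_mono ht).
  by rewrite ler_pM2r// ler_nat.
have [eps [Ck [eps0 [Ck0 CZ]]]] := wv_CZ wv.
pose q : R := 2^-1 `^ eps.
have q01 : 0 < q < 1.
  rewrite /q powR_gt0 ?invr_gt0//=.
  have := @gt0_ltr_powR R eps eps0 2^-1 1; rewrite powR1; apply; rewrite ?nnegrE//.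
  by rewrite invf_lt1// ltr1n.
have [q0 q1] := andP q01.
pose C1 := 2 * D ^+ 2 * Ck / (1 - q) ^+ 2.
have C10 : 0 <= C1.
  by rewrite /C1 divr_ge0 ?sqr_ge0// !mulr_ge0 ?exprn_ge0 ?ltW.
have main a x0 r N m (lam : R) : 0 < r -> measurable_fun setT a ->
    (forall y, ~ ball x0 r y -> a y = 0) -> {ae mu, forall y, `|a y| <= (V x0 r)^-1} ->
    L1 a -> Int a = 0 -> L2 a -> Int (fun y => `|a y|) <= 1 -> (0 < m)%N -> 0 < lam ->
    Int (fun y => (a y - psum mu phi a N y) ^+ 2) <= lam ^+ 2 * V x0 (2 ^+ m * r) ->
    (H1 (fun x => a x - psum mu phi a N x)%R <= (A1 * (lam * V x0 (2 ^+ m * r)) + C1 * q ^+ m)%:E)%E.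
  move=> r0 ma a0 aV ai Ia a2 Ia1 m0 lam0 hl.
  have gi : L1 (fun x => a x - psum mu phi a N x) by apply: isL1B => //; exact: psum_L1.
  have g2 : L2 (fun x => a x - psum mu phi a N x) by apply: isL2B => //; exact: psum_L2.
  have [M MP] : exists M, forall x, `|psum mu phi a N x| <= M.
    have /choice[b bP] : forall n, exists M, forall x, `|phi n x| <= M.
      by move=> n; exact: psi_bounded.
    exists (\sum_(n < N) `|Int (fun x => a x * phi n x)| * b n) => x.
    rewrite /psum (le_trans (ler_norm_sum _ _ _))//; apply: ler_sum => n _.
    by rewrite normrM ler_wpM2l.
  have -> : C1 * q ^+ m = 2 * D ^+ 2 * Ck * q ^+ m / (1 - q) ^+ 2.
    by rewrite /C1 mulrAC.
  apply: (H1norm_molecule ht D1 DV2 HB (M := (V x0 r)^-1 + M) r0 (ltW Ck0) q01 m0 lam0) => //.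
  - by apply: filterS aV => y ay; rewrite (le_trans (ler_normB _ _))// lerD.
  - by rewrite IntB ?Ia ?Int_psum ?subrr//; exact: psum_L1.
  - exact: (psum_atom_decay N eps0 Ck0 CZ r0 ai a0 Ia Ia1).
have data a : atom d mu a -> exists x0 r, [/\ 0 < r, measurable_fun setT a,
    (forall y, ~ ball x0 r y -> a y = 0), {ae mu, forall y, `|a y| <= (V x0 r)^-1} &
    [/\ L1 a, Int a = 0, L2 a, Int (fun y => `|a y|) <= 1 &
      Int (fun y => a y ^+ 2) <= (V x0 r)^-1]].
  move=> aa; have Ia1 := atom_Int_abs ht aa; have [x0 [r [r0 ma a0 aV [ai Ia]]]] := aa.
  exists x0, r; split => //.
  have a2 : L2 a by exact: (isL2_bounded_supp ht ma a0 aV).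
  have V0 := Vol_gt0 ht x0 r0.
  split => //; first by rewrite /Rintegral Ia.
  have aV2 : {ae mu, forall y, `|a y ^+ 2| <= (V x0 r)^-1 ^+ 2}.
    apply: filterS aV => y ay; rewrite normrX ler_sqr ?nnegrE//.
    by rewrite invr_ge0 ltW.
  have := Int_abs_bounded_supp ht _ _ aV2.
  move=> /(_ x0 r) h; apply: (@le_trans _ _ ((V x0 r)^-1 ^+ 2 * V x0 r)).
    rewrite (_ : Int _ = Int (fun y => `|a y ^+ 2|)).
      by apply: h; [case: a2 => _ /isL1_measurable|move=> y /a0 ->; rewrite expr0n].
    by apply: eq_Int => y; rewrite ger0_norm ?sqr_ge0.
  by rewrite expr2 -mulrA mulVf ?gt_eqF// mulr1.
exists (A1 * D + C1 * q); first by rewrite addr_ge0// mulr_ge0// ltW.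
split.
- move=> a N /data[x0 [r [r0 ma a0 aV [ai Ia a2 Ia1 Ia2]]]].
  have V0 := Vol_gt0 ht x0 r0.
  have Vm : V x0 r <= V x0 (2 ^+ 1 * r) by apply: (Vol_mono ht); rewrite expr1; lra.
  have lam0 : 0 < (V x0 r)^-1 by rewrite invr_gt0.
  (* Here [lam] is the height of the atom: since [psum] does not increase the L2 distance to zero of
     [a - S_N a], the L2 assumption holds for every [N], and doubling removes the volumes from the
     bound. *)
  apply: (le_trans (main a x0 r N 1%N (V x0 r)^-1 r0 ma a0 aV ai Ia a2 Ia1 isT lam0 _)).
    apply: (le_trans (psum_sqr_le phi2 phi_orth N a2)); apply: (le_trans Ia2).
    rewrite expr2 -mulrA ler_peMr ?(ltW lam0)//.
    by rewrite ler_pdivlMl// mulr1.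
  rewrite lee_fin expr1 lerD2r ler_wpM2l// ler_pdivrMl// [leRHS]mulrC.
  exact: DV2.
- move=> a e /data[x0 [r [r0 ma a0 aV [ai Ia a2 Ia1 Ia2]]]] e0.
  have e2 : 0 < e / 2 by rewrite divr_gt0.
  (* The cut-off [m] is fixed before [N], because the L2 accuracy to be reached depends on the
     volume of the enlarged ball. *)
  have [m m0 mq] : exists2 m, (0 < m)%N & C1 * q ^+ m <= e / 2.
    have : C1 * q ^+ n @[n --> \oo] --> (C1 * 0 : R).
      apply: cvgM; first exact: cvg_cst.
      by apply: cvg_expr; rewrite ger0_norm ?(ltW q0).
    rewrite mulr0 => /cvgrPdist_le/(_ _ e2)[m _ /(_ m.+1 (leqnSn m))].
    by rewrite sub0r normrN => h; exists m.+1 => //; exact: le_trans (ler_norm _) h.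
  have Vm0 : 0 < V x0 (2 ^+ m * r) by apply: (Vol_gt0 ht); rewrite mulr_gt0// exprn_gt0.
  have A11 : 0 < A1 + 1 by rewrite ltr_wpDl.
  (* Solves [(A1 + 1) * (lam * V x0 (2 ^+ m * r)) = e / 2]. *)
  pose lam := e / 2 / (A1 + 1) / V x0 (2 ^+ m * r).
  have lam0 : 0 < lam by rewrite /lam !divr_gt0.
  have [|N0 N0P] := psum_cvg phi2 phi_orth phi_complete a2 (e := lam ^+ 2 * V x0 (2 ^+ m * r)).
    by rewrite mulr_gt0// exprn_gt0.
  exists N0 => N /N0P hN.
  apply: (le_trans (main a x0 r N m lam r0 ma a0 aV ai Ia a2 Ia1 m0 lam0 hN)).
  rewrite lee_fin (_ : e = e / 2 + e / 2); last by field.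
  apply: lerD => //; rewrite /lam divfK ?gt_eqF// mulrCA ler_piMr ?(ltW e2)//.
  by rewrite ler_pdivrMr// mul1r lerDl.
Qed.

(** The constant depends on [N]. It is applied with [N] fixed, only to carry an L1-convergent atomic
    series through [psum]. *)
Lemma psum_L1_bounded N : exists2 C : R, 0 <= C & forall h, L1 h ->
  Int (fun x => `|psum mu phi h N x|) <= C * Int (fun x => `|h x|).
Proof.
have /choice[b bP] : forall n, exists M, forall x, `|phi n x| <= M.
  by move=> n; exact: psi_bounded.
have [x0 _] := unbounded 0.
have b0 n : 0 <= b n by exact: le_trans (normr_ge0 _) (bP n x0).
exists (\sum_(n < N) b n * Int (fun x => `|phi n x|)).
  by apply: sumr_ge0 => n _; rewrite mulr_ge0// Int_ge0.
move=> h hi; have pi n : L1 (fun x => `|Int (fun x => h x * phi n x)| * `|phi n x|).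
  exact/isL1Z/isL1_abs.
apply: (@le_trans _ _ (Int (fun x => \sum_(n < N) `|Int (fun x => h x * phi n x)| * `|phi n x|))).
  apply: Int_le; [exact/isL1_abs/psum_L1|exact: isL1_sum|move=> x].
  by rewrite /psum (le_trans (ler_norm_sum _ _ _))//; apply: ler_sum => n _; rewrite normrM.
rewrite (Int_sum (index_enum 'I_N) (F := fun n x => `|Int (fun x => h x * phi n x)| * `|phi n x|))//.
rewrite mulr_suml; apply: ler_sum => n _; rewrite IntZ; last exact: isL1_abs.
rewrite mulrAC ler_wpM2r ?Int_ge0//.
apply: (le_trans (le_abs_Int (isL1_mul_phi n hi))); rewrite -IntZ; last exact: isL1_abs.
apply: Int_le; [exact/isL1_abs/isL1_mul_phi|exact/isL1Z/isL1_abs|move=> x].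
by rewrite normrM mulrC ler_wpM2r.
Qed.

Lemma psum_sub_comb f (lam : nat -> R) (a : nat -> T -> R) J N x : L1 f -> (forall j, L1 (a j)) ->
  psum mu phi (fun x => f x - \sum_(j < J) lam j * a j x) N x =
  psum mu phi f N x - \sum_(j < J) lam j * psum mu phi (a j) N x.
Proof.
move=> fi ai; rewrite /psum.
under [X in _ = _ - X]eq_bigr do rewrite mulr_sumr.
rewrite exchange_big/= -sumrB; apply: eq_bigr => n _.
under [X in _ = _ - X]eq_bigr do rewrite mulrA.
rewrite -mulr_suml -mulrBl; congr (_ * _).
have i1 j : L1 (fun x => lam j * (a j x * phi n x)) by apply/isL1Z/isL1_mul_phi.
rewrite (@eq_Int _ _ _ mu _ (fun x => f x * phi n x - \sum_(j < J) lam j * (a j x * phi n x))).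
  rewrite IntB; [|exact: isL1_mul_phi|exact: isL1_sum].
  rewrite Int_sum//; congr (_ - _); apply: eq_bigr => j _.
  by rewrite IntZ//; exact: isL1_mul_phi.
move=> y; rewrite mulrBl mulr_suml; congr (_ - _).
by apply: eq_bigr => j _; rewrite mulrA.
Qed.

(** Dominated convergence for series: [f - S_N f] is the sum of the [lam j * (a j - S_N (a j))];
    finitely many terms are small for large [N], and the others are controlled by the uniform bound
    [U] times a tail of the coefficients. *)
Lemma wavelet_expansion f : inH1 d mu f ->
  H1_series_cvg d mu f (fun i => pairing mu f (psi i)) psi sigma.
Proof.
move=> [mf [fi [lam [a [aa ls fa]]]]].
have ai j : L1 (a j) by exact: atom_isL1 (aa j).
have fc J : L1 (fun x => f x - \sum_(j < J) lam j * a j x).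
  by apply: isL1B => //; exact: isL1_atom_comb.
have {}fa : Int (fun x => `|f x - \sum_(j < J) lam j * a j x|) @[J --> \oo] --> (0 : R).
  by apply/(@Int_cvg0 _ _ _ mu (fun J x => `|f x - \sum_(j < J) lam j * a j x|)) => // J; exact: isL1_abs.
have [U U0 [aU acvg]] := H1norm_atom_psum.
pose S n := \sum_(j < n) `|lam j|.
have [L LS] : exists L, forall n, S n <= L.
  exists (fine (\sum_(j <oo) (`|lam j|)%:E)%E) => n.
  apply: (nneseries_le_fin (u := fun j => `|lam j|) _ (fun j => normr_ge0 (lam j))).1.
  by rewrite fineK// ge0_fin_numE//; apply: nneseries_ge0 => *; rewrite lee_fin.
have L0 : 0 <= L by apply: le_trans (LS 0%N); rewrite /S big_ord0.
have Smono : nondecreasing_seq S.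
  by apply/nondecreasing_seqP => n; rewrite /S big_ord_recr/= lerDl.
have Scvg : cvg (S n @[n --> \oo]).
  by apply: nondecreasing_is_cvgn => //; exists L => _ [n _ <-].
rewrite /H1_series_cvg; apply/cvge0P; first by move=> N; exact: H1norm_ge0.
move=> e e0.
(* [e1] limits the tail of the coefficients, to be multiplied by [U]; [e2] limits the first [J0]
   differences, to be multiplied by the total mass [L]. Each side contributes at most [e / 2]. *)
pose e1 := e / 2 / (U + 1); pose e2 := e / 2 / (L + 1).
have U1 : 0 < U + 1 by rewrite ltr_wpDl.
have L1' : 0 < L + 1 by rewrite ltr_wpDl.
have e10 : 0 < e1 by rewrite /e1 !divr_gt0.
have e20 : 0 < e2 by rewrite /e2 !divr_gt0.
have [J0 J0P] : exists J0, forall J, S (J0 + J)%N - S J0 <= e1.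
  have /cvgrPdist_le/(_ _ e10)[J0 _ /(_ J0 (leqnn J0)) h] := Scvg; exists J0 => J.
  have := nondecreasing_cvgn_le Smono Scvg (J0 + J)%N.
  by move: (le_trans (ler_norm _) h); set l := limn _; move=> *; lra.
have /choice[N0 N0P] : forall j, exists N0, forall N, (N0 <= N)%N ->
    (H1 (fun x => a j x - psum mu phi (a j) N x)%R <= e2%:E)%E.
  by move=> j; exact: acvg.
exists (\max_(j < J0) N0 j) => N NN.
pose u j := if (j < J0)%N then e2 else U.
have gi : L1 (fun x => f x - psum mu phi f N x) by apply: isL1B => //; exact: psum_L1.
have agi j : L1 (fun x => a j x - psum mu phi (a j) N x) by apply: isL1B => //; exact: psum_L1.
apply: (@H1norm_series _ _ _ d mu ht (fun x => f x - psum mu phi f N x)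
  (fun j x => lam j * (a j x - psum mu phi (a j) N x)) (fun j => `|lam j| * u j) e) => //.
- by move=> j; exact: isL1Z.
- move=> j; apply: H1normZ => //; rewrite /u; case: ifP => jJ; last exact: aU.
  apply: N0P; apply: leq_trans NN.
  exact: (@leq_bigmax _ (fun j : 'I_J0 => N0 j) (Ordinal jJ)).
- move=> J; apply: (@le_trans _ _ (\sum_(j < J0 + J) `|lam j| * u j)).
    rewrite addnC big_split_ord/= lerDl sumr_ge0// => j _.
    by rewrite mulr_ge0// /u; case: ifP => // _; exact: ltW.
  rewrite big_split_ord/= (_ : e = e / 2 + e / 2); last by field.
  apply: lerD.
    rewrite (eq_bigr (fun j : 'I_J0 => `|lam j| * e2)); last by move=> j _; rewrite /u ltn_ord.
    rewrite -mulr_suml -/(S J0) /e2 mulrCA ler_piMr ?divr_ge0 ?(ltW e0)//.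
    by rewrite ler_pdivrMr// mul1r (le_trans (LS J0))// lerDl.
  rewrite (eq_bigr (fun j : 'I_J => `|lam (J0 + j)%N| * U)); last first.
    by move=> j _; rewrite /u ltnNge leq_addr.
  rewrite -mulr_suml (_ : \sum_(j < J) _ = S (J0 + J)%N - S J0); last first.
    by rewrite /S big_split_ord/= [RHS]addrC addKr.
  apply: (@le_trans _ _ (e1 * U)); first by rewrite ler_wpM2r.
  rewrite /e1 -mulrA ler_piMr ?divr_ge0 ?(ltW e0)// mulrC ler_pdivrMr// mul1r lerDl//.
- have [C C0 CP] := psum_L1_bounded N.
  (* By linearity the remainder of the series is the identity minus [psum], applied to the remainder
     of the atomic series of [f]. *)
  have telE J x : f x - psum mu phi f N x - \sum_(j < J) lam j * (a j x - psum mu phi (a j) N x) =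
     (f x - \sum_(j < J) lam j * a j x) -
       psum mu phi (fun x => f x - \sum_(j < J) lam j * a j x) N x.
    rewrite psum_sub_comb//.
    under eq_bigr do rewrite mulrBr.
    by rewrite sumrB; ring.
  apply/cvgrPdist_le => e' e'0; have C1 : 0 < C + 1 by rewrite ltr_wpDl.
  have e'1 : 0 < e' / (C + 1) by rewrite divr_gt0.
  move/cvgrPdist_le : fa => /(_ _ e'1)[J1 _ J1P]; exists J1 => // J /J1P /=.
  rewrite !sub0r !normrN => h; have {}h := le_trans (ler_norm _) h.
  rewrite ger0_norm; last exact: Int_ge0.
  have pi := psum_L1 (fun x => f x - \sum_(j < J) lam j * a j x) N.
  apply: (@le_trans _ _ (Int (fun x => `|f x - \sum_(j < J) lam j * a j x| +
      `|psum mu phi (fun x => f x - \sum_(j < J) lam j * a j x) N x|))).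
    apply: Int_le => [| |x].
    - apply: isL1_abs; apply: isL1B => //; apply: isL1_sum => j; exact: isL1Z.
    - by apply: isL1D; exact: isL1_abs.
    - by rewrite telE ler_normB.
  rewrite IntD; [|exact: isL1_abs|exact: isL1_abs].
  have h2 := CP _ (fc J).
  move: h; rewrite ler_pdivlMr// => h; lra.
Qed.

(** Pairing with a bounded wavelet is continuous in L1, hence for the H1 norm, and by orthonormality
    the [n]-th coefficient of every partial sum beyond [n] is already [lam (sigma n)]. *)
Lemma wavelet_coefficients_unique f (lam : int * nat * nat -> R) : L1 f ->
  H1_series_cvg d mu f lam psi sigma -> forall i, I i -> lam i = pairing mu f (psi i).
Proof.
move=> fi fl i Ii.
have [_ _ /(_ i Ii)[n _ ni]] := sigma_bij; rewrite -ni {i Ii ni}.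
have [M0 M0P] := psi_bounded (sI n).
pose M := Num.max M0 0; have M1 : 0 <= M by rewrite le_max lexx orbT.
have MP x : `|phi n x| <= M by rewrite le_max M0P.
pose SN N x := \sum_(m < N) lam (sigma m) * phi m x.
have SNi N : L1 (SN N) by apply: isL1_sum => m; exact: isL1Z.
have SNn N : (n < N)%N -> Int (fun x => SN N x * phi n x) = lam (sigma n).
  move=> nN; rewrite (@eq_Int _ _ _ mu _ (fun x => \sum_(m < N) lam (sigma m) * (phi m x * phi n x))).
    rewrite Int_sum; last by move=> m; apply/isL1Z/isL2_mul.
    rewrite (bigD1 (Ordinal nN))//= big1 ?addr0.
      by rewrite IntZ ?phi_orth ?eqxx ?mulr1//; exact: isL2_mul.
    move=> m mn; rewrite IntZ; last exact: isL2_mul.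
    by rewrite phi_orth (negbTE (_ : nat_of_ord m != n)) ?mulr0.
  by move=> x; rewrite /SN mulr_suml; apply: eq_bigr => m _; rewrite mulrA.
apply/eqP; rewrite -subr_eq0 -normr_eq0 eq_le normr_ge0 andbT.
apply/ler_addgt0Pr => e e0; rewrite add0r.
have M2 : 0 < M + 1 by rewrite ltr_wpDl.
move/cvge0P : fl => /(_ (fun N => H1norm_ge0 _ _ _) (e / (M + 1))).
rewrite divr_gt0// => /(_ isT)[N0 N0P].
pose N := maxn N0 n.+1.
have /Int_abs_le_H1norm h := N0P N (leq_maxl _ _).
have di : L1 (fun x => f x - SN N x) by exact: isL1B.
have {}h : Int (fun x => `|f x - SN N x|) <= e / (M + 1) by exact: (h ht di).
rewrite distrC -(SNn N); last exact: leq_maxr.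
rewrite -[pairing _ _ _]/(Int (fun x => f x * phi n x)) -IntB; [|exact: isL1_mul_phi|exact: isL1_mul_phi].
rewrite (@eq_Int _ _ _ mu _ (fun x => (f x - SN N x) * phi n x)); last by move=> x; ring.
apply: (le_trans (le_abs_Int (isL1_mul_phi n di))).
apply: (@le_trans _ _ (Int (fun x => M * `|f x - SN N x|))).
  apply: Int_le; [exact/isL1_abs/isL1_mul_phi|exact/isL1Z/isL1_abs|move=> x].
  by rewrite normrM mulrC ler_wpM2r.
rewrite IntZ; last exact: isL1_abs.
apply: (@le_trans _ _ (M * (e / (M + 1)))); first by rewrite ler_wpM2l.
by rewrite mulrCA ler_piMr ?(ltW e0)// ler_pdivrMr// mul1r lerDl.
Qed.

End wavelets.

Theorem theorem3p10 (R : realType) (dsp : measure_display) (T : measurableType dsp)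
  (d : T -> T -> R) (mu : {measure set T -> \bar R}) (delta : R)
  (A : int -> set nat) (pt : nat -> T) (Q : int -> nat -> set T)
  (psi : int * nat * nat -> T -> R) :
  homogeneous_type d mu ->
  (forall M : R, exists x y, M < d x y) ->
  (forall x : T, mu [set x] = 0%E) ->
  0 < delta <= 1 / 1000 ->
  dyadic_system d delta A pt Q ->
  AH_wavelets d mu delta A pt Q psi ->
  forall f : T -> R, inH1 d mu f ->
    H1_uncond_cvg d mu (Iset A Q) f (fun i => pairing mu f (psi i)) psi /\
    (forall lam : int * nat * nat -> R,
       H1_uncond_cvg d mu (Iset A Q) f lam psi ->
       forall i, Iset A Q i -> lam i = pairing mu f (psi i)).
Proof.
move=> ht unb _ delta_int dy wv f fH; split => [sigma sb|lam fl i Ii].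
  exact: (wavelet_expansion ht unb delta_int dy wv sb).
(* One enumeration is enough, as the value obtained for each coefficient does not depend on the
   order. *)
have [sigma sb] := enumeration_Iset ht unb delta_int dy.
have [_ [fi _]] := fH.
exact: (wavelet_coefficients_unique ht delta_int wv sb fi (fl sigma sb)).
Qed.
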